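(* Let $\pi:\Gamma\to\mathcal U(\mathcal H)$ be a unitary representation of $\Gamma$. Suppose that (i) $(\pi'_+,\mathcal H'_+)$ and $(\pi'_-,\mathcal H'_-)$ are two irreducible $\Gamma\ltimes C(\partial\Gamma)$-representations, inequivalent as $\Gamma\ltimes C(\partial\Gamma)$-representations; (ii) $\iota_+:\mathcal H\to\mathcal H'_+$ and $\iota_-:\mathcal H\to\mathcal H'_-$ are two perfect boundary realizations of $\pi$; (iii) (Finite Trace Condition) for all $a,b\in A$ with $a\neq b$, $$\big\|\big(\iota_+^*\,\pi'_+(\mathbf 1_{\partial\Gamma(a)})\,\iota_+\big)\big(\iota_-^*\,\pi'_-(\mathbf 1_{\partial\Gamma(b)})\,\iota_-\big)\big\|_{HS}<\infty .$$ Then: (1) $\pi$ is irreducible as a $\Gamma$-representation. (2) Up to equivalence, $\iota_+$ and $\iota_-$ are the only perfect boundary realizations of $\pi$. (3) Any imperfect boundary realization of $\pi$ is equivalent to the map $\sqrt{t_+}\,\iota_+\oplus\sqrt{t_-}\,\iota_-:\mathcal H\to\mathcal H'_+\oplus\mathcal H'_-$ for some constants $t_+,t_->0$ with $t_++t_-=1$.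
   Context: $\Gamma$ is a non-abelian free group on a given finite set of free generators; $A\subset\Gamma$ is the set of these generators and their inverses. $\partial\Gamma$ is the set of infinite reduced words $a_1a_2a_3\dots$ ($a_j\in A$, $a_ja_{j+1}\ne 1$) with the compact topology having as basis the sets $\partial\Gamma(x)$, $x\in\Gamma$, where $\partial\Gamma(x)$ is the set of infinite reduced words that start with the reduced word for $x$. $\Gamma$ acts continuously on $\partial\Gamma$ by left multiplication (followed by reduction). $\mathbf 1_S$ is the characteristic function of $S$. $C(\partial\Gamma)$ is the $C^*$-algebra of continuous complex functions on $\partial\Gamma$, and $(\lambda(x)G)(\omega)=G(x^{-1}\omega)$ for $x\in\Gamma$, $G\in C(\partial\Gamma)$. All Hilbert spaces are complex and separable. $\|\cdot\|_{HS}$ is the Hilbert–Schmidt norm (with value $+\infty$ for operators that are not Hilbert–Schmidt). A $\Gamma\ltimes C(\partial\Gamma)$-representation $\pi'$ on $\mathcal H'$ is a pair consisting of a unitary representation of $\Gamma$ on $\mathcal H'$ and a $*$-representation of $C(\partial\Gamma)$ on $\mathcal H'$, both denoted $\pi'$, with $\pi'(x)\pi'(G)\pi'(x)^{-1}=\pi'(\lambda(x)G)$ for all $x\in\Gamma$, $G\in C(\partial\Gamma)$. It is irreducible if $\mathcal H'\neq0$ and no closed subspace other than $0$ and $\mathcal H'$ is invariant under both actions. Two are equivalent if there is a unitary map intertwining both the $\Gamma$-actions and the $C(\partial\Gamma)$-actions. A boundary realization of $\pi$ is an isometric linear map $\iota:\mathcal H\to\mathcal H'$ intertwining the $\Gamma$-actions,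 where $\mathcal H'$ is the space of a $\Gamma\ltimes C(\partial\Gamma)$-representation $\pi'$ and $\iota(\mathcal H)$ is cyclic for $C(\partial\Gamma)$, i.e. the closed linear span of $\pi'(C(\partial\Gamma))\iota(\mathcal H)$ is $\mathcal H'$. It is perfect if $\iota$ is bijective (unitary), and imperfect otherwise. Two boundary realizations $\iota_j:\mathcal H\to\mathcal H'_j$ ($j=1,2$) are equivalent if there is a unitary $J:\mathcal H'_1\to\mathcal H'_2$ intertwining both the $\Gamma$-actions and the $C(\partial\Gamma)$-actions with $J\iota_1=\iota_2$. *)

(* Defs.v *)
From HB Require Import structures.
From mathcomp Require Import all_boot all_order all_algebra.
From mathcomp Require Import sesquilinear complex ring.
From mathcomp Require Import all_classical all_reals all_analysis.

Set Implicit Arguments.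
Unset Strict Implicit.
Unset Printing Implicit Defensive.

Import Order.TTheory GRing.Theory Num.Theory.
Import numFieldNormedType.Exports.

Local Open Scope classical_set_scope.
Local Open Scope ring_scope.

(* The free group on I consists of the reduced words in the letters (i, b),
   where (i, false) is the generator i and (i, true) is its inverse. *)
Definition letter (I : finType) : Type := (I * bool)%type.
HB.instance Definition _ (I : finType) := Finite.on (letter I).

Definition linv (I : finType) (a : letter I) : letter I := (a.1, ~~ a.2).

Definition reduced (I : finType) (w : seq (letter I)) : bool :=
  sorted (fun a b => b != linv a) w.

Record freeGroup (I : finType) :=
  FreeGroup { fgword :> seq (letter I); fgreduced : reduced fgword }.

HB.instance Definition _ (I : finType) := [isSub for @fgword I].
HB.instance Definition _ (I : finType) := [Choice of freeGroup I by <:].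

Section FreeGroup.
Variable I : finType.
Implicit Types (a b : letter I) (w : seq (letter I)) (x y z : freeGroup I).

(* the reduced form of a w, when w is reduced *)
Definition push a w : seq (letter I) :=
  if w is b :: w' then if b == linv a then w' else a :: w else [:: a].

Lemma linvK : involutive (@linv I).
Proof. by case=> i b; rewrite /linv /= negbK. Qed.

Lemma push_reduced a w : reduced w -> reduced (push a w).
Proof.
case: w => [|b w] //= bw; case: ifP => [_|/negbT ba /=]; last by rewrite ba.
exact: path_sorted bw.
Qed.

Lemma pushK a w : reduced w -> push (linv a) (push a w) = w.
Proof.
case: w => [|b w] /=; first by rewrite linvK eqxx.
case: eqP => [-> |_ _]; last by rewrite /= linvK eqxx.
by case: w => [|c w] //= /andP[/negPf-> _].
Qed.

Lemma foldr_push_reduced w w' : reduced w' -> reduced (foldr push w' w).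
Proof. by move=> w'P; elim: w => //= a w; apply: push_reduced. Qed.

Lemma foldr_push_push a w w' : reduced w -> reduced w' ->
  foldr push w' (push a w) = push a (foldr push w' w).
Proof.
case: w => [|b w] //= bw w'P; case: eqP => // ->.
by rewrite -{1}[a]linvK pushK// foldr_push_reduced.
Qed.

Lemma foldr_push_nil w : reduced w -> foldr push [::] w = w.
Proof.
elim: w => //= a w IHw aw.
have /IHw-> : reduced w by exact: path_sorted aw.
by case: w aw {IHw} => //= b w /andP[/negPf->].
Qed.

Definition fgone : freeGroup I := @FreeGroup I [::] isT.

(* concatenation followed by reduction *)
Definition fgmul x y : freeGroup I :=
  FreeGroup (foldr_push_reduced x (fgreduced y)).

Lemma inv_reduced w : reduced w -> reduced (rev (map (@linv I) w)).
Proof.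
rewrite /reduced rev_sorted sorted_map; apply: sub_sorted => a b /=.
by rewrite linvK eq_sym.
Qed.

Definition fginv x : freeGroup I := FreeGroup (inv_reduced (fgreduced x)).

Lemma fgmulA : associative fgmul.
Proof.
move=> x y z; apply: val_inj => /=; case: x => w wP /= {wP}.
elim: w => //= a w ->; rewrite foldr_push_push//.
  exact: foldr_push_reduced (fgreduced y).
exact: fgreduced z.
Qed.

Lemma fgmul1x : left_id fgone fgmul.
Proof. by move=> x; apply: val_inj. Qed.

Lemma fgmulx1 : right_id fgone fgmul.
Proof. by move=> x; apply: val_inj => /=; rewrite foldr_push_nil// fgreduced. Qed.

Lemma fgmulVx : left_inverse fgone fginv fgmul.
Proof.
case=> w wP; apply: val_inj => /=; elim: w wP => //= a w IHw aw.
have rw : reduced w by exact: path_sorted aw.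
by rewrite rev_cons -cats1 foldr_cat /= linvK eqxx IHw.
Qed.

Lemma fgmulxV : right_inverse fgone fginv fgmul.
Proof.
have fginvK x : fginv (fginv x) = x.
  by apply: val_inj; rewrite /= map_rev revK mapK//; exact: linvK.
by move=> x; rewrite -{1}[x]fginvK fgmulVx.
Qed.

HB.instance Definition _ := isGroup.Build (freeGroup I)
  fgmulA fgmul1x fgmulx1 fgmulVx fgmulxV.
HB.instance Definition _ := isPointed.Build (freeGroup I) 1%g.

Definition fgletter a : freeGroup I := @FreeGroup I [:: a] isT.

End FreeGroup.

Record boundary (I : finType) := Boundary {
  bword :> nat -> letter I ;
  breduced : forall n, bword n.+1 != linv (bword n) }.

HB.instance Definition _ (I : finType) := gen_eqMixin (boundary I).
HB.instance Definition _ (I : finType) := gen_choiceMixin (boundary I).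

Section Boundary.
Variable I : finType.
Implicit Types (a b : letter I) (x y : freeGroup I) (w : boundary I).

Definition cylinder x : set (boundary I) :=
  [set w | forall n, (n < size x)%N -> nth (w n) x n = w n].

Lemma prefix_reduced w n : reduced (mkseq w n).
Proof.
case: n => // n; apply/(sortedP (w 0%N)) => i.
rewrite size_mkseq => ltin; rewrite !nth_mkseq ?(ltnW ltin)//.
exact: breduced.
Qed.

Definition bprefix w n : freeGroup I := FreeGroup (prefix_reduced w n).

Lemma cylinder_bprefix w n w' :
  cylinder (bprefix w n) w' <-> forall k, (k < n)%N -> w k = w' k.
Proof.
rewrite /cylinder /= size_mkseq; split=> ww' k kn.
  by rewrite -ww'// nth_mkseq.
by rewrite nth_mkseq// ww'.
Qed.

Lemma bprefix_cylinder x w : cylinder x w -> x = bprefix w (size x).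
Proof.
move=> xw; apply/val_inj/(@eq_from_nth _ (w 0%N)); rewrite /= ?size_mkseq// => i ix.
by rewrite nth_mkseq// -[RHS]xw//; apply: set_nth_default.
Qed.

Let cylinder_cover : \bigcup_(x in [set: freeGroup I]) cylinder x = setT.
Proof. by apply/seteqP; split=> // w _; exists 1%g. Qed.

Let cylinder_join x y w : [set: freeGroup I] x -> [set: freeGroup I] y ->
  cylinder x w -> cylinder y w ->
  exists z, [/\ [set: freeGroup I] z, cylinder z w &
                cylinder z `<=` cylinder x `&` cylinder y].
Proof.
move=> _ _ /bprefix_cylinder-> /bprefix_cylinder->.
exists (bprefix w (maxn (size x) (size y))); split=> //.
  exact/cylinder_bprefix.
move=> w' /cylinder_bprefix ww'; split; apply/cylinder_bprefix => k kn;
  by apply: ww'; rewrite leq_max kn ?orbT.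
Qed.

HB.instance Definition _ :=
  isBaseTopological.Build (boundary I) cylinder_cover cylinder_join.

Lemma open_cylinder x : open (cylinder x).
Proof. by exists [set x] => //; rewrite bigcup_set1. Qed.

Lemma nbhs_bprefix w (A : set (boundary I)) :
  nbhs w A <-> exists n, cylinder (bprefix w n) `<=` A.
Proof.
split=> [|[n nA]].
  rewrite nbhsE => -[B [[D _ <-] [x Dx xw]] BA].
  exists (size x); rewrite -(bprefix_cylinder xw) => w' xw'.
  by apply: BA; exists x.
rewrite nbhsE; exists (cylinder (bprefix w n)) => //; split.
  exact: open_cylinder.
exact/cylinder_bprefix.
Qed.

Definition bpush_word a (w : nat -> letter I) : nat -> letter I :=
  if w 0%N == linv a then fun n => w n.+1 else
  fun n => if n is m.+1 then w m else a.

Lemma bpush_reduced a w n : bpush_word a w n.+1 != linv (bpush_word a w n).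
Proof.
rewrite /bpush_word; case: ifP => [_|/negbT wa]; first exact: breduced.
by case: n => //= n; exact: breduced.
Qed.

(* the reduced form of a w *)
Definition bpush a w : boundary I := Boundary (bpush_reduced a w).

(* left multiplication followed by reduction, one letter of x at a time *)
Definition bact x w : boundary I := foldr bpush w x.

Lemma boundary_eq w w' : bword w =1 bword w' -> w = w'.
Proof.
case: w w' => [w wP] [w' w'P] /= /funext ww'; case: _ / ww' in w'P *.
by congr Boundary; exact: Prop_irrelevance.
Qed.

Lemma bpushK a w : bpush (linv a) (bpush a w) = w.
Proof.
apply: boundary_eq => n; rewrite /= /bpush_word linvK.
case: (eqVneq (w 0%N) (linv a)) => [wa|_]; last by rewrite eqxx.
have := breduced w 0; rewrite wa linvK => /negPf->.
by case: n.
Qed.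

Lemma bact1 w : bact 1%g w = w.
Proof. by []. Qed.

Lemma bactM x y w : bact (x * y)%g w = bact x (bact y w).
Proof.
rewrite /bact /=; elim: (fgword x) => //= a s <-.
case: (foldr _ _ s) => //= b s'; case: eqP => //= ->.
by rewrite -{1}[a]linvK bpushK.
Qed.

Lemma continuous_bpush a : continuous (bpush a).
Proof.
move=> w A /nbhs_bprefix[n nA]; apply/nbhs_bprefix; exists n.+1 => w'.
move=> /cylinder_bprefix ww'; apply/nA/cylinder_bprefix => k kn.
rewrite /= /bpush_word -ww'//; case: ifP => _; first exact: ww'.
by case: k kn => // k kn; apply: ww'; rewrite ltnW// ltnW.
Qed.

Lemma continuous_bact x : continuous (bact x).
Proof.
rewrite /bact; elim: (fgword x) => /= [w|a s IHs w]; first exact: cvg_id.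
exact: continuous_comp (IHs w) (@continuous_bpush a _).
Qed.

End Boundary.

HB.instance Definition _ (R : realType) := NormedModule.copy R[i] R[i]^o.

Section ContinuousFunctions.
Variables (R : realType) (X : topologicalType).
Implicit Types F G : continuousType X R[i].

Lemma continuous_lin (a : R[i]) F G : continuous (fun w => a * F w + G w).
Proof.
move=> w; apply: cvgD; last exact: cts_fun.
by apply: cvgM; [exact: cvg_cst|exact: cts_fun].
Qed.

Definition clin a F G : continuousType X R[i] := mkcts (@continuous_lin a F G).

Lemma continuous_mul F G : continuous (fun w => F w * G w).
Proof. by move=> w; apply: cvgM; exact: cts_fun. Qed.

Definition cmul F G : continuousType X R[i] := mkcts (@continuous_mul F G).

Lemma continuous_conj F : continuous (fun w => (F w)^* ).
Proof.
move=> w; have cF : F @ w --> F w by exact: cts_fun.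
apply: (cvg_comp _ _ cF); apply/cvgrPdist_lt => e e0; near=> z.
by rewrite -rmorphB norm_conjC; near: z; exact: cvgr_dist_lt.
Unshelve. all: end_near. Qed.

Definition cconj F : continuousType X R[i] := mkcts (@continuous_conj F).

End ContinuousFunctions.

Section BoundaryFunctions.
Variables (R : realType) (I : finType).

(* (lambda(x) G)(w) = G(x^-1 w) *)
Lemma continuous_translate (x : freeGroup I)
    (G : continuousType (boundary I) R[i]) :
  continuous (fun w => G (bact x^-1%g w)).
Proof.
move=> w; apply: continuous_comp; first exact: continuous_bact.
exact: cts_fun.
Qed.

Definition translate x G : continuousType (boundary I) R[i] :=
  mkcts (@continuous_translate x G).

Lemma continuous_indic_cylinder (x : freeGroup I) :
  continuous (\1_(cylinder x) : boundary I -> R[i]).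
Proof.
move=> w A /= wA; apply/nbhs_bprefix; exists (size x) => w'.
move=> /cylinder_bprefix ww' /=.
suff -> : \1_(cylinder x) w' = \1_(cylinder x) w :> R[i].
  exact: nbhs_singleton wA.
rewrite !indicE; congr (_%:R); congr nat_of_bool; apply/idP/idP;
  rewrite !inE => xw k kx; have := xw k kx; rewrite ww'// => <-;
  exact: set_nth_default.
Qed.

Definition cind_cylinder x : continuousType (boundary I) R[i] :=
  mkcts (@continuous_indic_cylinder x).

End BoundaryFunctions.

(* The norm takes its (real) values in R[i]; inner is linear on the left. *)
HB.mixin Record CompleteNormedModule_isHilbert (R : realType) H
    & CompleteNormedModule R[i] H := {
  inner : {dot H for (@Num.conj R[i])} ;
  inner_norm : forall u : H, inner u u = `|u| ^+ 2 ;
  hilbert_separable : exists2 D : set H, countable D & dense D }.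

#[short(type="hilbertType")]
HB.structure Definition Hilbert (R : realType) :=
  {H of CompleteNormedModule R[i] H & CompleteNormedModule_isHilbert R H}.

(* The orthogonal direct sum; an alias, because the product of two normed
   modules carries the max norm. *)
Definition hsum (R : realType) (H1 H2 : hilbertType R) : Type := (H1 * H2)%type.

HB.instance Definition _ (R : realType) (H1 H2 : hilbertType R) :=
  GRing.Lmodule.copy (hsum H1 H2) (H1 * H2)%type.

Section HilbertSum.
Variables (R : realType) (H1 H2 : hilbertType R).
Implicit Types u v : hsum H1 H2.

Definition hsum_inner u v : R[i] := inner u.1 v.1 + inner u.2 v.2.

Definition hsum_norm u : R[i] := sqrtC (`|u.1| ^+ 2 + `|u.2| ^+ 2).

Let pyth_ge0 (a b : R[i]) : 0 <= a -> 0 <= b -> 0 <= a ^+ 2 + b ^+ 2.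
Proof. by move=> a0 b0; rewrite addr_ge0// exprn_ge0. Qed.

Let hsum_norm_sqr u : hsum_norm u ^+ 2 = `|u.1| ^+ 2 + `|u.2| ^+ 2.
Proof. exact: sqrtCK. Qed.

Let hsum_norm_ge0 u : 0 <= hsum_norm u.
Proof. by rewrite sqrtC_ge0 pyth_ge0. Qed.

Let minkowski (a b c d : R[i]) : 0 <= a -> 0 <= b -> 0 <= c -> 0 <= d ->
  sqrtC ((a + c) ^+ 2 + (b + d) ^+ 2) <=
  sqrtC (a ^+ 2 + b ^+ 2) + sqrtC (c ^+ 2 + d ^+ 2).
Proof.
move=> a0 b0 c0 d0.
set s := sqrtC (a ^+ 2 + b ^+ 2); set t := sqrtC (c ^+ 2 + d ^+ 2).
have s0 : 0 <= s by rewrite sqrtC_ge0 pyth_ge0.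
have t0 : 0 <= t by rewrite sqrtC_ge0 pyth_ge0.
have s2 : s ^+ 2 = a ^+ 2 + b ^+ 2 by exact: sqrtCK.
have t2 : t ^+ 2 = c ^+ 2 + d ^+ 2 by exact: sqrtCK.
have cs : a * c + b * d <= s * t.
  rewrite -(@ler_pXn2r _ 2)// ?nnegrE ?addr_ge0 ?mulr_ge0//.
  rewrite exprMn s2 t2 -subr_ge0.
  have -> : (a ^+ 2 + b ^+ 2) * (c ^+ 2 + d ^+ 2) - (a * c + b * d) ^+ 2 =
            (a * d - b * c) ^+ 2 by ring.
  by rewrite real_exprn_even_ge0// rpredB ?ger0_real ?mulr_ge0.
rewrite -(@ler_pXn2r _ 2)// ?nnegrE ?sqrtC_ge0 ?pyth_ge0 ?addr_ge0//.
rewrite sqrtCK (sqrrD s t) s2 t2 -subr_ge0.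
have -> : a ^+ 2 + b ^+ 2 + s * t *+ 2 + (c ^+ 2 + d ^+ 2) -
          ((a + c) ^+ 2 + (b + d) ^+ 2) = (s * t - (a * c + b * d)) *+ 2 by ring.
by rewrite mulrn_wge0// subr_ge0.
Qed.

Let hsum_ler_normD u v : hsum_norm (u + v) <= hsum_norm u + hsum_norm v.
Proof.
apply: le_trans (minkowski _ _ _ _) => //.
rewrite ler_sqrtC ?qualifE/= ?pyth_ge0 ?addr_ge0//.
by apply: lerD; rewrite ler_pXn2r ?nnegrE ?addr_ge0// ler_normD.
Qed.

Let hsum_normZ (a : R[i]) u : hsum_norm (a *: u) = `|a| * hsum_norm u.
Proof.
rewrite /hsum_norm /= !normrZ !exprMn -mulrDr sqrtCM ?qualifE/= ?exprn_ge0 ?pyth_ge0//.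
by rewrite sqrCK.
Qed.

Let hsum_norm0_eq0 u : hsum_norm u = 0 -> u = 0.
Proof.
move/eqP; rewrite sqrtC_eq0 paddr_eq0 ?exprn_ge0// !expf_eq0 /= !normr_eq0.
by case: u => u1 u2 /= /andP[/eqP-> /eqP->].
Qed.

HB.instance Definition _ := Lmodule_isNormed.Build R[i] (hsum H1 H2)
  hsum_ler_normD hsum_normZ hsum_norm0_eq0.

Lemma hsum_normE u : `|u| = sqrtC (`|u.1| ^+ 2 + `|u.2| ^+ 2).
Proof. by []. Qed.

Lemma hsum_norm_fst u : `|u.1| <= `|u|.
Proof.
rewrite -(@ler_pXn2r _ 2)// ?nnegrE// hsum_normE sqrtCK.
by rewrite lerDl exprn_ge0.
Qed.

Lemma hsum_norm_snd u : `|u.2| <= `|u|.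
Proof.
rewrite -(@ler_pXn2r _ 2)// ?nnegrE// hsum_normE sqrtCK.
by rewrite lerDr exprn_ge0.
Qed.

Lemma hsum_norm_le u : `|u| <= `|u.1| + `|u.2|.
Proof.
rewrite -(@ler_pXn2r _ 2)// ?nnegrE ?addr_ge0// hsum_normE sqrtCK.
by rewrite sqrrD -addrA lerD2l lerDr mulrn_wge0// mulr_ge0.
Qed.

Lemma cvg_hsum (T : Type) (F : set_system T) (f : T -> hsum H1 H2) u :
  Filter F -> (fun t => (f t).1) @ F --> u.1 ->
  (fun t => (f t).2) @ F --> u.2 -> f @ F --> u.
Proof.
move=> FF /cvgrPdist_lt f1 /cvgrPdist_lt f2; apply/cvgrPdist_lt => e e0.
have e20 : 0 < e / 2 by rewrite divr_gt0.
near=> t; apply: le_lt_trans (hsum_norm_le _) _; rewrite [e]splitr ltrD//=.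
  by near: t; exact: f1.
by near: t; exact: f2.
Unshelve. all: end_near. Qed.

Lemma continuous_hsum_fst : continuous (fun u => u.1).
Proof.
move=> u A /nbhs_ballP[e e0 eA]; apply/nbhs_ballP; exists e => // v uv.
by apply: eA; move: uv; rewrite -!ball_normE; exact: le_lt_trans (hsum_norm_fst (u - v)).
Qed.

Lemma continuous_hsum_snd : continuous (fun u => u.2).
Proof.
move=> u A /nbhs_ballP[e e0 eA]; apply/nbhs_ballP; exists e => // v uv.
by apply: eA; move: uv; rewrite -!ball_normE; exact: le_lt_trans (hsum_norm_snd (u - v)).
Qed.

Let hsum_complete (F : set_system (hsum H1 H2)) :
  ProperFilter F -> cauchy F -> cvg F.
Proof.
move=> FF /cauchy_ballP Fc.
have c1 : cvg ((fun u => u.1) @ F).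
  apply: cauchy_cvg; apply/cauchy_ballP => e e0; have := Fc _ e0.
  rewrite !near_simpl => -[[A B] /= [FA FB] AB].
  exists ((fun u => u.1) @` A, (fun u => u.1) @` B) => /=.
    by split; [apply: filterS FA|apply: filterS FB] => u ?; exists u.
  move=> [_ _] /= [[u Au <-] [v Bv <-]]; have := AB (u, v) (conj Au Bv).
  by rewrite -!ball_normE /=; apply: le_lt_trans; exact: hsum_norm_fst (u - v).
have c2 : cvg ((fun u => u.2) @ F).
  apply: cauchy_cvg; apply/cauchy_ballP => e e0; have := Fc _ e0.
  rewrite !near_simpl => -[[A B] /= [FA FB] AB].
  exists ((fun u => u.2) @` A, (fun u => u.2) @` B) => /=.
    by split; [apply: filterS FA|apply: filterS FB] => u ?; exists u.
  move=> [_ _] /= [[u Au <-] [v Bv <-]]; have := AB (u, v) (conj Au Bv).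
  by rewrite -!ball_normE /=; apply: le_lt_trans; exact: hsum_norm_snd (u - v).
apply/cvg_ex; exists (lim ((fun u => u.1) @ F), lim ((fun u => u.2) @ F)).
exact: (@cvg_hsum _ F id).
Qed.

HB.instance Definition _ := Uniform_isComplete.Build (hsum H1 H2) hsum_complete.

Let hsum_inner_bilinear :
  bilinear_for ( *%R : GRing.Scale.law R[i] R[i])
    (Num.conj \; *%R : GRing.Scale.law R[i] R[i]) hsum_inner.
Proof.
split=> [v a u u'|u a v v'] /=; rewrite /hsum_inner /=.
  by rewrite !linearPl /= mulrDr addrACA.
by rewrite !linearPr /= mulrDr addrACA.
Qed.

HB.instance Definition _ :=
  bilinear_isBilinear.Build R[i] _ _ _ _ _ hsum_inner hsum_inner_bilinear.

Let hsum_inner_herm u v :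
  hsum_inner u v = (-1) ^+ false * Num.conj (hsum_inner v u).
Proof.
by rewrite /hsum_inner rmorphD mulrDr -!(hermC (@inner _ _)).
Qed.

HB.instance Definition _ :=
  isHermitianSesquilinear.Build R[i] _ _ _ hsum_inner hsum_inner_herm.

Let hsum_inner_norm u : hsum_inner u u = `|u| ^+ 2.
Proof. by rewrite /hsum_inner !inner_norm hsum_normE sqrtCK. Qed.

Let hsum_inner_gt0 u : u != 0 -> 0 < hsum_inner u u.
Proof. by move=> u0; rewrite hsum_inner_norm exprn_gt0// normr_gt0. Qed.

HB.instance Definition _ := isDotProduct.Build R[i] _ hsum_inner hsum_inner_gt0.

Let hsum_separable : exists2 D : set (hsum H1 H2), countable D & dense D.
Proof.
have [D1 cD1 dD1] := @hilbert_separable _ H1.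
have [D2 cD2 dD2] := @hilbert_separable _ H2.
exists (D1 `*` D2); first exact: countableX.
move=> O [u Ou]; rewrite openE => /(_ _ Ou); rewrite /interior -nbhs_ballE.
move=> -[e /= e0 eO]; have e20 : 0 < e / 2 by rewrite divr_gt0.
have [|x [ux Dx]] := dD1 (ball u.1 (e / 2)) _ (ball_open _ _).
  by exists u.1; exact: ballxx.
have [|y [uy Dy]] := dD2 (ball u.2 (e / 2)) _ (ball_open _ _).
  by exists u.2; exact: ballxx.
exists (x, y); split=> //; apply: eO; rewrite -ball_normE /=.
move: ux uy; rewrite -!ball_normE /= => ux uy.
by apply: le_lt_trans (hsum_norm_le _) _; rewrite [e]splitr ltrD.
Qed.

HB.instance Definition _ := CompleteNormedModule_isHilbert.Build R
  (hsum H1 H2) hsum_inner_norm hsum_separable.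

End HilbertSum.

Section Operators.
Variable R : realType.

(* For bounded linear T, such a w exists and is unique. *)
Definition adjoint (H1 H2 : hilbertType R) (T : H1 -> H2) (v : H2) : H1 :=
  xget 0 [set w | forall u, inner (T u) v = inner u w].

Definition compression (H1 H2 : hilbertType R) (T : H1 -> H2) (S : H2 -> H2) :
  H1 -> H1 := fun v => adjoint T (S (T v)).

Definition is_unitary (H1 H2 : hilbertType R) (J : {linear H1 -> H2}) : Prop :=
  (forall u v, inner (J u) (J v) = inner u v) /\ forall y, exists u, J u = y.

Definition linear_subspace (H : hilbertType R) (V : set H) : Prop :=
  V 0 /\ forall (a : R[i]) u v, V u -> V v -> V (a *: u + v).

Definition closed_span (H : hilbertType R) (S : set H) : set H :=
  closure (smallest (@linear_subspace H) S).

Definition orthonormal_basis (H : hilbertType R) (B : set H) : Prop :=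
  [/\ forall e, B e -> inner e e = 1,
      forall e f, B e -> B f -> e <> f -> inner e f = 0 &
      closed_span B = setT].

(* For bounded linear T, the sum does not depend on the orthonormal basis B, so
   that the infimum only selects its common value. *)
Definition hs_norm (H1 H2 : hilbertType R) (T : H1 -> H2) : \bar R :=
  ereal_inf [set sqrte (\esum_(e in B) (complex.Re `|T e| ^+ 2)%:E)
            | B in @orthonormal_basis H1].

End Operators.

(* Surjectivity of the operators follows from the homomorphism property. *)
Record unirep (R : realType) (G : groupType) (H : hilbertType R) := Unirep {
  urep :> G -> {linear H -> H} ;
  urep_isometry : forall x u v, inner (urep x u) (urep x v) = inner u v ;
  urep1 : forall v, urep 1%g v = v ;
  urepM : forall x y v, urep (x * y)%g v = urep x (urep y v) }.

(* The identity crep_alg 1 = id is not imposed; it holds as soon as the space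
   is the closed span of the vectors crep_alg F v, hence for every boundary
   realization. *)
Record crossrep (R : realType) (I : finType) (H : hilbertType R) := Crossrep {
  crep_grp :> unirep (freeGroup I) H ;
  crep_alg : continuousType (boundary I) R[i] -> {linear H -> H} ;
  crep_bounded : forall F, continuous (crep_alg F) ;
  crep_lin : forall a F G v,
    crep_alg (clin a F G) v = a *: crep_alg F v + crep_alg G v ;
  crep_mul : forall F G v,
    crep_alg (cmul F G) v = crep_alg F (crep_alg G v) ;
  crep_star : forall F u v,
    inner (crep_alg F u) v = inner u (crep_alg (cconj F) v) ;
  crep_cov : forall x F v,
    crep_grp x (crep_alg F (crep_grp x^-1%g v)) = crep_alg (translate x F) v }.

Section Representations.
Variables (R : realType) (I : finType).

Definition invariant_subspace (H : hilbertType R) (T : H -> H) (V : set H) :=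
  forall v, V v -> V (T v).

Definition unirep_irreducible (G : groupType) (H : hilbertType R)
    (pi : unirep G H) : Prop :=
  (exists v : H, v <> 0) /\
  forall V : set H, linear_subspace V -> closed V ->
    (forall x, invariant_subspace (pi x) V) -> V = [set 0] \/ V = setT.

Definition crossrep_irreducible (H : hilbertType R) (pi : crossrep I H) :=
  (exists v : H, v <> 0) /\
  forall V : set H, linear_subspace V -> closed V ->
    (forall x, invariant_subspace (pi x) V) ->
    (forall F, invariant_subspace (crep_alg pi F) V) ->
    V = [set 0] \/ V = setT.

Definition intertwines (H1 H2 : hilbertType R) (pi1 : crossrep I H1)
    (pi2 : crossrep I H2) (J : H1 -> H2) : Prop :=
  (forall x v, J (pi1 x v) = pi2 x (J v)) /\
  (forall F v, J (crep_alg pi1 F v) = crep_alg pi2 F (J v)).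

Definition crossrep_equiv (H1 H2 : hilbertType R) (pi1 : crossrep I H1)
    (pi2 : crossrep I H2) : Prop :=
  exists J : {linear H1 -> H2}, is_unitary J /\ intertwines pi1 pi2 J.

Definition boundary_realization (H H' : hilbertType R)
    (pi : unirep (freeGroup I) H) (pi' : crossrep I H')
    (iota : {linear H -> H'}) : Prop :=
  [/\ forall v, `|iota v| = `|v|,
      forall x v, iota (pi x v) = pi' x (iota v) &
      closed_span [set w | exists F v, w = crep_alg pi' F (iota v)] = setT].

Definition perfect_realization (H H' : hilbertType R)
    (pi : unirep (freeGroup I) H) (pi' : crossrep I H')
    (iota : {linear H -> H'}) : Prop :=
  boundary_realization pi pi' iota /\ bijective iota.

Definition imperfect_realization (H H' : hilbertType R)
    (pi : unirep (freeGroup I) H) (pi' : crossrep I H')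
    (iota : {linear H -> H'}) : Prop :=
  boundary_realization pi pi' iota /\ ~ bijective iota.

Definition realization_equiv (H H1 H2 : hilbertType R)
    (pi1 : crossrep I H1) (iota1 : H -> H1)
    (pi2 : crossrep I H2) (iota2 : H -> H2) : Prop :=
  exists J : {linear H1 -> H2},
    [/\ is_unitary J, intertwines pi1 pi2 J & forall v, J (iota1 v) = iota2 v].

End Representations.

Section SumMap.
Variables (R : realType) (H1 H2 : hilbertType R).
Variables (f1 : {linear H1 -> H1}) (f2 : {linear H2 -> H2}).

Definition hsum_map (u : hsum H1 H2) : hsum H1 H2 := (f1 u.1, f2 u.2).

Let hsum_map_linear : linear hsum_map.
Proof. by move=> a u v; rewrite /hsum_map /= !linearP. Qed.

HB.instance Definition _ := GRing.isLinear.Build R[i] (hsum H1 H2)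
  (hsum H1 H2) *:%R hsum_map hsum_map_linear.

Lemma continuous_hsum_map :
  continuous f1 -> continuous f2 -> continuous hsum_map.
Proof.
move=> c1 c2 u; apply: (@cvg_hsum _ _ _ _ (nbhs u) hsum_map (hsum_map u)).
  apply: (@cvg_comp _ _ _ (fun v : hsum H1 H2 => v.1) f1 (nbhs u) (nbhs u.1)).
    exact: continuous_hsum_fst.
  exact: c1.
apply: (@cvg_comp _ _ _ (fun v : hsum H1 H2 => v.2) f2 (nbhs u) (nbhs u.2)).
  exact: continuous_hsum_snd.
exact: c2.
Qed.

End SumMap.

Section SumRep.
Variables (R : realType) (I : finType) (H1 H2 : hilbertType R).
Variables (pi1 : crossrep I H1) (pi2 : crossrep I H2).

Let sum_grp x : {linear hsum H1 H2 -> hsum H1 H2} := hsum_map (pi1 x) (pi2 x).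

Let sum_alg F : {linear hsum H1 H2 -> hsum H1 H2} :=
  hsum_map (crep_alg pi1 F) (crep_alg pi2 F).

Let sum_isometry x u v : inner (sum_grp x u) (sum_grp x v) = inner u v.
Proof. by congr (_ + _); exact: urep_isometry. Qed.

Let sum_grp1 v : sum_grp 1%g v = v.
Proof. by rewrite /= /hsum_map !urep1; case: v. Qed.

Let sum_grpM x y v : sum_grp (x * y)%g v = sum_grp x (sum_grp y v).
Proof. by rewrite /= /hsum_map !urepM. Qed.

Definition sum_unirep : unirep (freeGroup I) (hsum H1 H2) :=
  Unirep sum_isometry sum_grp1 sum_grpM.

Let sum_bounded F : continuous (sum_alg F).
Proof. by apply: continuous_hsum_map; exact: crep_bounded. Qed.

Let sum_lin a F G v : sum_alg (clin a F G) v = a *: sum_alg F v + sum_alg G v.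
Proof. by rewrite /= /hsum_map !crep_lin. Qed.

Let sum_mul F G v : sum_alg (cmul F G) v = sum_alg F (sum_alg G v).
Proof. by rewrite /= /hsum_map !crep_mul. Qed.

Let sum_star F u v :
  inner (sum_alg F u) v = inner u (sum_alg (cconj F) v).
Proof. by congr (_ + _); exact: crep_star. Qed.

Let sum_cov x F v :
  sum_unirep x (sum_alg F (sum_unirep x^-1%g v)) = sum_alg (translate x F) v.
Proof. by rewrite /= /hsum_map !crep_cov. Qed.

Definition sum_crossrep : crossrep I (hsum H1 H2) :=
  Crossrep sum_bounded sum_lin sum_mul sum_star sum_cov.

End SumRep.

Definition weighted_sum (R : realType) (H H1 H2 : hilbertType R) (t1 t2 : R)
    (iota1 : H -> H1) (iota2 : H -> H2) (v : H) : hsum H1 H2 :=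
  ((Num.sqrt t1)%:C%C *: iota1 v, (Num.sqrt t2)%:C%C *: iota2 v).

(* Main.v *)
Require Import Defs.
From HB Require Import structures.
From mathcomp Require Import all_boot all_order all_algebra.
From mathcomp Require Import sesquilinear complex ring lra zify.
From mathcomp Require Import all_classical all_reals all_analysis.

Set Implicit Arguments.
Unset Strict Implicit.
Unset Printing Implicit Defensive.

Import Order.TTheory GRing.Theory Num.Theory.
Import numFieldNormedType.Exports.

Local Open Scope classical_set_scope.
Local Open Scope ring_scope.

(** Transport both boundary structures to [H]: [P w] and [Q w] are the operators of the indicator of the
    cylinder of [w] in the two perfect realizations. By hypothesis [L = \sum_a P a (1 - Q a) P a] has
    finite trace. The Fejer means of [D_k = \sum_(|x| = k) P x Q x] converge weakly to an intertwiner of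
    two inequivalent irreducible systems, hence to 0; as the Hilbert-Schmidt norms of
    [(\sum_(m < n) D_(j + m)) (1 - Q a) P a] are governed by these means, the averages
    [n^-1 \sum_(m < n) D_(j + m)] tend to 0 strongly, uniformly in [j].

    Let [T] intertwine [pi] with a third realization, with cylinder projections [P'], and put
    [B w = T^* P' w T]. If [|x| = p + q + 1], comparing [tr (B (x|p+1) x L x^-1)] with the same expression
    for [x^-1] and [q] gives an identity whose sum over [x], averaged over [p] and [q], becomes
    [Re tr (T^* (Phi + Psi) L) = tr (T^* T L)]. Here [Phi] and [Psi] are limits of means of
    [\sum_(|z| = j) P' z T P z] and [\sum_(|z| = j) P' z T Q z], so they intertwine [P], respectively [Q],
    with [P'].

    For a projection [T] commuting with [pi] and [P' = P], Schur's lemma makes [Phi] a scalar and [Psi] zero,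
    and the identity for [T] and [1 - T] forces [T = 0] or [T = 1]. For an isometry [T], Schur's lemma
    makes [Phi] and [Psi] multiples of isometries with orthogonal ranges, and the identity then yields
    [T = Phi + Psi]. *)

(** * Norms and inner products *)

(** The finite trace condition makes each [(1 - Q a) P a], the sum of the [Q b P a] with [b <> a],
    Hilbert-Schmidt. [L] is the sum of their squared moduli, so [tr (M L)] is expressed by
    Hilbert-Schmidt pairings alone. The trace identity contains [L] twice: what is compared is
    [tr (B x L x^-1 L)]. The inner copy is spread out by the sum over [x]: the conjugates [x L x^-1]
    with [|x| = k] add up to [2], one unit from the [P x] and one from the [Q x], plus terms that
    vanish in the mean. The outer copy stays as a weight. The obstacle lies in these error terms: in
    them a factor depending on [p] stands to the left of [D_(p + q + 1)], and weak convergence does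
    not pass to such products. Averaging over [q] first leaves a window of levels starting at
    [p + 1]; hence the need for strong decay, uniform in the starting level. It is available because
    the pairing of [D_j (1 - Q a) P a] with [D_k (1 - Q a) P a], summed over [a], depends only on
    [k - j], as for a stationary sequence. Weak limits along an ultrafilter exist without passing to
    subsequences. *)

Section RealNorm.
Variable R : realType.
Local Notation C := R[i].

(** Norms take values in [R[i]]; the real part makes them accessible to the order of [R] and to
    [lra] and [nra]. *)
Definition nr (V : normedZmodType C) (u : V) : R := complex.Re `|u|.

Lemma natSinv_small (e : R) : 0 < e ->
  exists N, forall n, (N <= n)%N -> n.+1%:R^-1 < e.
Proof.
move=> e0; have [N _ hN] := near_infty_natSinv_lt (PosNum e0).
by exists N => n /hN.
Qed.

Lemma le_from_sqr (a b : R) : 0 <= b -> a ^+ 2 <= b ^+ 2 -> a <= b.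
Proof.
move=> b0; case: (lerP a 0) => [a0 _|a0]; first exact: le_trans b0.
by rewrite ler_pXn2r ?nnegrE// ltW.
Qed.

Section NormedZmod.
Variable V : normedZmodType C.
Implicit Types u v : V.

Lemma nrE u : `|u| = (nr u)%:C%C.
Proof. by rewrite /nr; have := normr_ge0 u; case: (`|u|) => a b /=; rewrite lecE /= => /andP[/eqP -> _]. Qed.

Lemma nr_ge0 u : 0 <= nr u.
Proof. by rewrite -lecR -nrE; exact: normr_ge0. Qed.

Lemma nr0 : nr (0 : V) = 0.
Proof. by rewrite /nr normr0. Qed.

Lemma nr_eq0 u : (nr u == 0) = (u == 0).
Proof. by rewrite -(inj_eq (@complexI R)) -nrE normr_eq0. Qed.

Lemma nrD u v : nr (u + v) <= nr u + nr v.
Proof. by rewrite -lecR rmorphD /= -!nrE ler_normD. Qed.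

Lemma nrN u : nr (- u) = nr u.
Proof. by rewrite /nr normrN. Qed.

Lemma nrB u v : nr (u - v) = nr (v - u).
Proof. by rewrite -nrN opprB. Qed.

Lemma nrB_le u v : nr (u - v) <= nr u + nr v.
Proof. by rewrite -[nr v]nrN; exact: nrD. Qed.

Lemma nr_triB u v w : nr (u - w) <= nr (u - v) + nr (v - w).
Proof. by apply: le_trans (nrD _ _); rewrite addrA subrK. Qed.

Lemma nr_sum (I : Type) (r : seq I) (P : pred I) (F : I -> V) :
  nr (\sum_(i <- r | P i) F i) <= \sum_(i <- r | P i) nr (F i).
Proof.
elim/big_rec2: _ => [|i x y _ IH]; first by rewrite nr0.
by apply: le_trans (nrD _ _) _; rewrite lerD2l.
Qed.

Lemma nr_le0 u : nr u <= 0 -> u = 0.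
Proof. by move=> u0; apply/eqP; rewrite -nr_eq0 eq_le u0 nr_ge0. Qed.

Lemma nr_small0 u : (forall e : R, 0 < e -> nr u <= e) -> u = 0.
Proof.
move=> h; apply: nr_le0; apply/ler_addgt0Pl => e e0; rewrite addr0; exact: h.
Qed.

End NormedZmod.

Lemma nrM (a b : C) : nr (a * b) = nr a * nr b.
Proof. by apply: (@complexI R); rewrite rmorphM /= -!nrE normrM. Qed.

Lemma nr_conj (a : C) : nr a^* = nr a.
Proof. by rewrite /nr norm_conjC. Qed.

Lemma nrC (a : R) : nr (a%:C%C : C) = `|a|.
Proof.
rewrite /nr normc_def /= expr0n /= addr0; exact: sqrtr_sqr.
Qed.

Lemma nr_nat n : nr (n%:R : C) = n%:R.
Proof. by rewrite -(rmorph_nat (real_complex R)) nrC ger0_norm. Qed.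

Lemma nrZ (V : normedModType C) (a : C) (u : V) : nr (a *: u) = nr a * nr u.
Proof. by apply: (@complexI R); rewrite rmorphM /= -!nrE normrZ. Qed.

Lemma conjR (x : R) : (x%:C%C : C)^* = x%:C%C.
Proof. by apply/eqP; rewrite eq_complex /= oppr0 !eqxx. Qed.

Lemma nr_sqr (a : C) : a * a^* = (nr a ^+ 2)%:C%C.
Proof. by rewrite rmorphXn /= -nrE normCK. Qed.

Lemma ReE (a : C) : a + a^* = (complex.Re a *+ 2)%:C%C.
Proof. by case: a => x y; apply/eqP; rewrite eq_complex /= mulr2n subrr !eqxx. Qed.

Lemma ReD (a b : C) : complex.Re (a + b) = complex.Re a + complex.Re b.
Proof. by case: a b => ? ? []. Qed.

Lemma ReN (a : C) : complex.Re (- a) = - complex.Re a.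
Proof. by case: a. Qed.

Lemma Re_conj (a : C) : complex.Re a^* = complex.Re a.
Proof. by case: a. Qed.

Lemma ReZ (x : R) (a : C) : complex.Re (x%:C%C * a) = x * complex.Re a.
Proof. by case: a => ? ? /=; rewrite mul0r subr0. Qed.

Lemma Re_le_nr (a : C) : `|complex.Re a| <= nr a.
Proof. by rewrite -lecR -nrE; exact: normc_ge_Re. Qed.

Lemma Im_le_nr (a : C) : `|complex.Im a| <= nr a.
Proof.
rewrite /nr normc_def /= -sqrtr_sqr ler_wsqrtr// lerDr; exact: sqr_ge0.
Qed.

Lemma nr_le_ReIm (a : C) : nr a <= `|complex.Re a| + `|complex.Im a|.
Proof.
have ni : nr ('i%C : C) = 1.
  by rewrite /nr normc_def /= expr0n expr1n add0r sqrtr1.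
rewrite {1}[a]complexE; apply: le_trans (nrD _ _) _.
by rewrite nrM ni mul1r !nrC.
Qed.

Section Inner.
Variable H : hilbertType R.
Implicit Types u v w : H.

Lemma innerC u v : inner u v = (inner v u)^*.
Proof. by rewrite hermC expr0 mul1r. Qed.

Lemma innerDl u v w : inner (u + v) w = inner u w + inner v w.
Proof. exact: linearDl. Qed.
Lemma innerDr u v w : inner u (v + w) = inner u v + inner u w.
Proof. exact: linearDr. Qed.
Lemma innerZl a u v : inner (a *: u) v = a * inner u v.
Proof. by rewrite linearZl. Qed.
Lemma innerZr a u v : inner u (a *: v) = a^* * inner u v.
Proof. by rewrite linearZr. Qed.
Lemma innerNl u v : inner (- u) v = - inner u v.
Proof. exact: linearNl. Qed.
Lemma innerNr u v : inner u (- v) = - inner u v.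
Proof. exact: linearNr. Qed.
Lemma innerBl u v w : inner (u - v) w = inner u w - inner v w.
Proof. by rewrite innerDl innerNl. Qed.
Lemma innerBr u v w : inner u (v - w) = inner u v - inner u w.
Proof. by rewrite innerDr innerNr. Qed.
Lemma inner0l u : inner 0 u = 0.
Proof. exact: linear0l. Qed.
Lemma inner0r u : inner u 0 = 0.
Proof. exact: linear0r. Qed.
Lemma inner_suml (J : Type) (r : seq J) (P : pred J) (F : J -> H) v :
  inner (\sum_(i <- r | P i) F i) v = \sum_(i <- r | P i) inner (F i) v.
Proof. exact: linear_sumlz. Qed.
Lemma inner_sumr (J : Type) (r : seq J) (P : pred J) (F : J -> H) v :
  inner v (\sum_(i <- r | P i) F i) = \sum_(i <- r | P i) inner v (F i).
Proof. by rewrite innerC inner_suml rmorph_sum; apply: eq_bigr => i _; rewrite [RHS]innerC. Qed.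

Lemma inner_nr u : inner u u = (nr u ^+ 2)%:C%C.
Proof. by rewrite inner_norm nrE rmorphXn. Qed.

Lemma Re_inner_nr u : complex.Re (inner u u) = nr u ^+ 2.
Proof. by rewrite inner_nr. Qed.

Lemma nr_inner_le1 u v : nr v = 1 -> nr (inner u v) <= nr u.
Proof.
move=> v1; rewrite -(@ler_pXn2r _ 2)// ?nnegrE ?nr_ge0//.
have := sqr_ge0 (nr (u - inner u v *: v)).
rewrite -Re_inner_nr innerBl !innerBr !innerZl !innerZr (innerC v u) !inner_nr v1.
rewrite expr1n mulr1 subrr subr0 [in X in _ - X]mulrC nr_sqr -rmorphB /=.
by rewrite subr_ge0.
Qed.

Lemma CS u v : nr (inner u v) <= nr u * nr v.
Proof.
have [->|v0] := eqVneq v 0; first by rewrite inner0r !nr0 mulr0.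
have nv : 0 < nr v by rewrite lt0r nr_eq0 v0 nr_ge0.
have := @nr_inner_le1 u ((nr v)^-1%:C%C *: v).
have iv : `|(nr v)^-1| = (nr v)^-1 by rewrite ger0_norm// invr_ge0 nr_ge0.
rewrite nrZ nrC iv mulVf ?gt_eqF// => /(_ erefl).
by rewrite innerZr nrM nr_conj nrC iv mulrC ler_pdivrMr.
Qed.

Lemma nrD_sqr u v :
  nr (u + v) ^+ 2 = nr u ^+ 2 + nr v ^+ 2 + complex.Re (inner u v) *+ 2.
Proof.
rewrite -!Re_inner_nr innerDl !innerDr (innerC v u) !ReD Re_conj mulr2n.
by rewrite addrACA [X in _ + X]addrC !addrA; ring.
Qed.

Lemma nrB_sqr u v :
  nr (u - v) ^+ 2 = nr u ^+ 2 + nr v ^+ 2 - complex.Re (inner u v) *+ 2.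
Proof. by rewrite nrD_sqr nrN innerNr ReN mulNrn. Qed.

Lemma inner_eq u v : (forall w, inner u w = inner v w) -> u = v.
Proof.
move=> h; apply/eqP; rewrite -subr_eq0 -nr_eq0 -sqrf_eq0 -Re_inner_nr.
by rewrite innerBl h subrr.
Qed.

Lemma nr_le_inner u (c : R) : 0 <= c ->
  (forall v, nr (inner u v) <= c * nr v) -> nr u <= c.
Proof.
move=> c0 h; have [->|u0] := eqVneq u 0; first by rewrite nr0.
have nu : 0 < nr u by rewrite lt0r nr_eq0 u0 nr_ge0.
have := h u; rewrite inner_nr nrC ger0_norm ?sqr_ge0// expr2 ler_pM2r//.
Qed.

Lemma cauchy_seq_cvg (x : nat -> H) :
  (forall e : R, 0 < e -> exists N, forall m n, (N <= m)%N -> (N <= n)%N -> nr (x m - x n) <= e) ->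
  exists l, forall e : R, 0 < e -> exists N, forall n, (N <= n)%N -> nr (l - x n) <= e.
Proof.
move=> hc.
have cx : cauchy (x @ \oo).
  apply/cauchy_ballP => e /=; rewrite ltcE => /andP[/eqP /= ime re].
  have [N hN] := hc (complex.Re e / 2) (divr_gt0 re (ltr0Sn R 1)).
  exists ([set x n | n in [set n | (N <= n)%N]], [set x n | n in [set n | (N <= n)%N]]).
    split; exists N => // n Nn /=; by exists n.
  move=> [_ _] /= [[m Nm <-] [n Nn <-]]; rewrite -ball_normE /= nrE ltcE /= ime eqxx /=.
  apply: le_lt_trans (hN _ _ Nm Nn) _; rewrite ltr_pdivrMr// ltr_pMr// ltr1n//.
have xc : cvg (x @ \oo) by exact: cauchy_cvg cx.
have [l /cvgrPdist_le hl] : exists l : H, x @ \oo --> l by exists (lim (x @ \oo)).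
exists l => e e0.
have /hl : 0 < e%:C%C :> C by rewrite ltcR.
by move=> [N _ hN]; exists N => n Nn; have := hN n Nn; rewrite nrE lecR.
Qed.

Lemma closure_approx (V : set H) w : closure V w <->
  (forall e : R, 0 < e -> exists2 v, V v & nr (w - v) <= e).
Proof.
split=> [wV e e0|h].
  have /wV[v [Vv]] : nbhs w (ball w e%:C%C) by apply: nbhsx_ballx; rewrite ltcR.
  by rewrite -ball_normE /= nrE ltcR => /ltW; exists v.
move=> B /nbhs_ballP[e /=]; rewrite ltcE => /andP[/eqP /= ime re] eB.
have [v Vv wv] := h _ (divr_gt0 re (ltr0Sn R 1)).
exists v; split=> //; apply: eB; rewrite -ball_normE /= nrE ltcE /= ime eqxx /=.
apply: le_lt_trans wv _; rewrite ltr_pdivrMr// ltr_pMr// ltr1n//.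
Qed.

Lemma closed_approx (V : set H) : closed V -> forall w,
  (forall e : R, 0 < e -> exists2 v, V v & nr (w - v) <= e) -> V w.
Proof. by move=> cV w /closure_approx; exact: cV. Qed.

Lemma approx_closed (V : set H) : (forall w,
  (forall e : R, 0 < e -> exists2 v, V v & nr (w - v) <= e) -> V w) -> closed V.
Proof. by move=> h w /closure_approx; exact: h. Qed.

(* [w] is the limit of a minimizing sequence of [nr u ^+ 2 - 2 Re (phi u)] on [V]. *)
Lemma riesz_subspace (V : set H) (phi : H -> C) (c : R) :
  linear_subspace V -> closed V -> linear_for *%R phi ->
  (forall u, nr (phi u) <= c * nr u) ->
  exists2 w, V w & forall u, V u -> phi u = inner u w.
Proof.
move=> [V0 Vl] cV lphi bphi.
pose J u := nr u ^+ 2 - complex.Re (phi u) *+ 2.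
have phiD u v : phi (u + v) = phi u + phi v by rewrite -[u]scale1r lphi scale1r mul1r.
have phi0 : phi 0 = 0 by apply: (addrI (phi 0)); rewrite -phiD !addr0.
have phiZ a u : phi (a *: u) = a * phi u by rewrite -[a *: u]addr0 lphi phi0 addr0.
have VZ a u : V u -> V (a *: u) by move=> Vu; rewrite -[a *: u]addr0; exact: Vl.
have VD u v : V u -> V v -> V (u + v) by move=> Vu Vv; rewrite -[u]scale1r; exact: Vl.
have Jlow u : - c ^+ 2 <= J u.
  rewrite /J; have := Re_le_nr (phi u); rewrite ler_norml => /andP[_ h].
  have := bphi u; have := sqr_ge0 (nr u - c); nra.
pose m := inf [set J u | u in V].
have hi : has_inf [set J u | u in V].
  by split; [exists (J 0), 0|exists (- c ^+ 2) => _ [u _ <-]].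
have mJ u : V u -> m <= J u by move=> Vu; apply: ge_inf; [case: hi|exists u].
have ap n : exists u, V u /\ J u < m + n.+1%:R^-1.
  have [] := @inf_adherent _ [set J u | u in V] n.+1%:R^-1 _ hi; first by rewrite invr_gt0.
  by move=> _ [u Vu <-] h; exists u.
have [x hx] := choice ap.
have half : nr ((2^-1)%:C%C : C) = 2^-1 by rewrite nrC ger0_norm.
(* Parallelogram law: [J] at the midpoint of [u] and [v] is at least [m], so points of [V] that
   nearly minimize [J] are close to each other. *)
have par u v : V u -> V v -> nr (u - v) ^+ 2 <= 2 * (J u + J v - 2 * m).
  move=> Vu Vv; have := mJ _ (VZ (2^-1)%:C%C _ (VD _ _ Vu Vv)).
  rewrite /J nrZ half exprMn nrB_sqr nrD_sqr phiZ ReZ phiD ReD.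
  set a := nr u ^+ 2; set b := nr v ^+ 2; set r := complex.Re (inner u v); lra.
have cx : forall e : R, 0 < e ->
    exists N, forall p n, (N <= p)%N -> (N <= n)%N -> nr (x p - x n) <= e.
  move=> e e0; have [N hN] := natSinv_small (divr_gt0 (exprn_gt0 2 e0) (ltr0Sn R 3)).
  exists N => p n Np Nn; apply: le_from_sqr; first exact: ltW.
  apply: le_trans (par _ _ (proj1 (hx p)) (proj1 (hx n))) _.
  have := proj2 (hx p); have := proj2 (hx n); have := hN p Np; have := hN n Nn.
  clear -R; move: (e ^+ 2) (p.+1%:R^-1) (n.+1%:R^-1) m (J (x n)) (J (x p)) => E b1 b2 m0 j1 j2; lra.
have [w hw] := cauchy_seq_cvg cx.
have Vw : V w.
  apply: (closed_approx cV) => e /hw[N hN]; exists (x N); first by case: (hx N).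
  exact: hN.
exists w => // v Vv.
(* Moving [x n] along [v] with coefficient [- t] times the conjugate of [d] lowers [J] by
   [t |d|^2 (2 - t |v|^2)], which is at most the distance of [J (x n)] from [m]. The choice
   [t = 1 / (1 + |v|^2)] keeps the last factor at least 1. *)
have key n : nr (inner v (x n) - phi v) ^+ 2 <= n.+1%:R^-1 * (1 + nr v ^+ 2).
  set d := inner v (x n) - phi v.
  pose t : R := (1 + nr v ^+ 2)^-1.
  have t0 : 0 < 1 + nr v ^+ 2 by rewrite ltr_wpDr ?sqr_ge0.
  have tE : t * (1 + nr v ^+ 2) = 1 by rewrite mulVf ?gt_eqF.
  have Vs : V (x n + (- (t%:C%C * d^*)) *: v) by apply: VD; [case: (hx n)|exact: VZ].
  have := mJ _ Vs; have := proj2 (hx n); rewrite /J nrD_sqr phiD ReD phiZ.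
  rewrite innerC innerZl rmorphM /= -rmorphM Re_conj nrZ nrN nrM nrC nr_conj.
  set q := complex.Re (_ * inner v _); set p := complex.Re (_ * phi v).
  have -> : p = q + t * nr d ^+ 2.
    rewrite /q /p (_ : inner v (x n) = d + phi v); last by rewrite /d subrK.
    rewrite mulrDr ReD -addrA addrCA -[LHS]addr0; congr (_ + _).
    by rewrite mulNr -mulrA (mulrC _ d) nr_sqr ReN ReZ /= addNr.
  rewrite !exprMn real_normK ?num_real//; clearbody t q; clear p.
  set D := nr d ^+ 2; set W := nr v ^+ 2 in t0 tE *; set X := nr (x n) ^+ 2.
  set P := complex.Re (phi (x n)); set e := n.+1%:R^-1.
  move=> h1 h2; have h3 : t * D * (2 - t * W) <= e by nra.
  have t1 : 0 < t by rewrite -(@pmulr_lgt0 _ (1 + W))// tE.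
  have D0 : 0 <= D by rewrite sqr_ge0.
  have tD : 0 <= t * D by rewrite mulr_ge0// ltW.
  have tW : t * W <= 1 by rewrite -tE mulrDr mulr1 lerDr ltW.
  have h4 : t * D <= e by clear -h3 tD tW; nra.
  have := ler_wpM2r (ltW t0) h4; rewrite mulrAC tE mul1r => //.
apply/eqP; rewrite eq_sym -subr_eq0; apply/eqP/nr_small0 => e e0.
have e2 : 0 < e / 2 by rewrite divr_gt0.
have v1 : 0 < 1 + nr v by rewrite ltr_wpDr ?nr_ge0.
have [N1 hN1] := hw _ (divr_gt0 e2 v1).
have v2 : 0 < 1 + nr v ^+ 2 by rewrite ltr_wpDr ?sqr_ge0.
have [N2 hN2] := natSinv_small (divr_gt0 (exprn_gt0 2 e2) v2).
pose n := maxn N1 N2.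
have -> : inner v w - phi v = inner v (w - x n) + (inner v (x n) - phi v).
  by rewrite innerBr addrA subrK.
apply: le_trans (nrD _ _) _; rewrite [e]splitr; apply: lerD.
  apply: le_trans (CS _ _) _; have := hN1 n (leq_maxl _ _).
  rewrite ler_pdivlMr//; have := nr_ge0 (w - x n); have := nr_ge0 v; nra.
apply: le_from_sqr; first exact: ltW.
apply: le_trans (key n) _.
rewrite -ler_pdivlMr//; apply: ltW; apply: hN2; exact: leq_maxr.
Qed.

End Inner.
End RealNorm.

(** * Limits along an ultrafilter and bounded operators *)

Section Ultralimit.
Variables (R : realType) (U : set_system nat).
Context {UU : UltraFilter U}.
Hypothesis Uoo : \oo `<=` U.
Local Notation C := R[i].

Definition ulim (V : normedZmodType C) (a : nat -> V) (l : V) : Prop :=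
  forall e : R, 0 < e -> U [set n | nr (a n - l) <= e].

Section NormedZmod.
Variable V : normedZmodType C.
Implicit Types (a b : nat -> V) (l m : V).

Lemma ulim_unique a l m : ulim a l -> ulim a m -> l = m.
Proof.
move=> al am; apply/eqP; rewrite -subr_eq0; apply/eqP/nr_small0 => e e0.
have e2 : 0 < e / 2 by rewrite divr_gt0.
have [n [/= h1 h2]] := filter_ex (filterI (al _ e2) (am _ e2)).
apply: le_trans (nr_triB _ (a n) _) _; rewrite [e]splitr lerD//.
by rewrite nrB.
Qed.

Lemma ulimD a b l m : ulim a l -> ulim b m -> ulim (fun n => a n + b n) (l + m).
Proof.
move=> al bm e e0; have e2 : 0 < e / 2 by rewrite divr_gt0.
apply: filterS (filterI (al _ e2) (bm _ e2)) => n [/= h1 h2].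
by rewrite opprD addrACA [e]splitr; apply: le_trans (nrD _ _) _; exact: lerD.
Qed.

Lemma ulimN a l : ulim a l -> ulim (fun n => - a n) (- l).
Proof. by move=> al e /al; apply: filterS => n /=; rewrite -opprD nrN. Qed.

Lemma ulimB a b l m : ulim a l -> ulim b m -> ulim (fun n => a n - b n) (l - m).
Proof. by move=> al /ulimN; exact: ulimD. Qed.

Lemma ulim_cst l : ulim (fun _ => l) l.
Proof. by move=> e e0; apply: filterE => n /=; rewrite subrr nr0 ltW. Qed.

Lemma ulim_sum (J : Type) (r : seq J) (P : pred J) (F : J -> nat -> V) (L : J -> V) :
  (forall i, P i -> ulim (F i) (L i)) ->
  ulim (fun n => \sum_(i <- r | P i) F i n) (\sum_(i <- r | P i) L i).
Proof.
move=> h; elim: r => [|i r IH].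
  by rewrite (_ : (fun _ => _) = fun _ => 0); [rewrite big_nil; exact: ulim_cst|apply/funext => n; rewrite big_nil].
rewrite big_cons (_ : (fun _ => _) = fun n => if P i then F i n + \sum_(j <- r | P j) F j n else \sum_(j <- r | P j) F j n); last first.
  by apply/funext => n; rewrite big_cons.
by case: ifP => // Pi; exact: ulimD (h _ Pi) IH.
Qed.

Lemma eq_ulim a b l : (forall n, a n = b n) -> ulim a l -> ulim b l.
Proof. by move=> /funext ->. Qed.

Lemma ulim_le_near a l (c : R) : ulim a l -> U [set n | nr (a n) <= c] -> nr l <= c.
Proof.
move=> al h; apply/ler_addgt0Pl => e e0.
have [n [/= hn hc]] := filter_ex (filterI (al _ e0) h).
rewrite -[l](subrK (a n)); apply: le_trans (nrD _ _) _; rewrite nrB.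
exact: lerD.
Qed.

Lemma ulim_le a l (c : R) : ulim a l -> (forall n, nr (a n) <= c) -> nr l <= c.
Proof. by move=> al h; apply: ulim_le_near al _; exact: filterE. Qed.

Lemma ulim_oo a l :
  (forall e : R, 0 < e -> exists N, forall n, (N <= n)%N -> nr (a n - l) <= e) ->
  ulim a l.
Proof. by move=> h e /h[N hN]; apply: Uoo; exists N. Qed.

End NormedZmod.

Lemma ulim0_le (V W : normedZmodType C) (a : nat -> V) (b : nat -> W) (c : R) :
  (forall n, nr (a n) <= c * nr (b n)) -> ulim b 0 -> ulim a 0.
Proof.
move=> h b0 e e0; have c1 : 0 < 1 + `|c| by rewrite ltr_wpDr.
apply: filterS (b0 _ (divr_gt0 e0 c1)) => n /=; rewrite !subr0 ler_pdivlMr// => hn.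
apply: le_trans (h n) _; apply: le_trans hn; rewrite mulrC ler_wpM2l ?nr_ge0//.
by apply: le_trans (ler_norm c) _; rewrite lerDr.
Qed.

Lemma ulimM (a : nat -> C) l c : ulim a l -> ulim (fun n => c * a n) (c * l).
Proof.
move=> al; rewrite -[c * l]add0r; apply: (@eq_ulim _ (fun n => c * (a n - l) + c * l)).
  by move=> n; rewrite -mulrDr subrK.
apply: ulimD; last exact: ulim_cst.
apply: (@ulim0_le _ _ _ (fun n => a n - l) (nr c)) => [n|]; first by rewrite nrM.
by rewrite -(subrr l); apply: ulimB => //; exact: ulim_cst.
Qed.

Lemma ulim_conj (a : nat -> C) l : ulim a l -> ulim (fun n => (a n)^*) l^*.
Proof. by move=> al e /al; apply: filterS => n /=; rewrite -rmorphB nr_conj. Qed.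

Lemma ulim_Re_ge0 (a : nat -> C) l : ulim a l ->
  U [set n | 0 <= complex.Re (a n)] -> 0 <= complex.Re l.
Proof.
move=> al h; apply/ler_addgt0Pl => e e0.
have [n [/= hn h0]] := filter_ex (filterI (al _ e0) h).
apply: le_trans h0 _; have := le_trans (Re_le_nr _) hn.
by rewrite ReD ReN ler_norml => /andP[_]; rewrite lerBlDr addrC.
Qed.

(** The image of [U] under [f] is an ultrafilter on the compact segment from [- c] to [c], hence
    converges there. *)
Let ulim_real_ex (f : nat -> R) (c : R) : (forall n, `|f n| <= c) ->
  exists l, forall e : R, 0 < e -> U [set n | `|f n - l| <= e].
Proof.
move=> h; have := @segment_compact R (- c) c; rewrite compact_ultra => hc.
have FU : UltraFilter (f @ U).
  split; first exact: fmap_proper_filter.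
  move=> G GF UG; apply/seteqP; split=> // A GA.
  have [//|nA] := in_ultra_setVsetC (f @^-1` A) UU.
  have /UG GnA : (f @ U) (~` A) by [].
  by have [x []] := filter_ex (filterI GA GnA).
have [|l [_ hl]] := hc _ FU.
  apply: (@filterE _ U _ (f @^-1` `[- c, c])) => n /=.
  by rewrite in_itv /=; have := h n; rewrite ler_norml.
exists l => e e0; have /cvgrPdist_le/(_ _ e0) := hl.
by apply: filterS => n /=; rewrite distrC.
Qed.

Lemma ulim_ex (a : nat -> C) (c : R) : (forall n, nr (a n) <= c) ->
  exists l, ulim a l.
Proof.
move=> h; have [|x hx] := @ulim_real_ex (fun n => complex.Re (a n)) c.
  by move=> n; exact: le_trans (Re_le_nr _) (h n).
have [|y hy] := @ulim_real_ex (fun n => complex.Im (a n)) c.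
  by move=> n; exact: le_trans (Im_le_nr _) (h n).
exists (x +i* y)%C => e e0; have e2 : 0 < e / 2 by rewrite divr_gt0.
apply: filterS (filterI (hx _ e2) (hy _ e2)) => n [/=]; case: (a n) => p q /= h1 h2.
by apply: le_trans (nr_le_ReIm _) _; rewrite [e]splitr lerD.
Qed.

End Ultralimit.

Section Operators.
Variable R : realType.
Local Notation C := R[i].

(** The bound is only asserted to exist, so operators with equal values are equal ([opP]) and form a
    module. Explicit bounds are tracked separately by [bnd]. *)
Record op (H1 H2 : hilbertType R) := Op {
  opf :> H1 -> H2 ;
  op_axiom : linear opf /\ exists c : R, forall u, nr (opf u) <= c * nr u }.

HB.instance Definition _ (H1 H2 : hilbertType R) := gen_eqMixin (op H1 H2).
HB.instance Definition _ (H1 H2 : hilbertType R) := gen_choiceMixin (op H1 H2).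
HB.instance Definition _ (H1 H2 : hilbertType R) (T : op H1 H2) :=
  GRing.isLinear.Build C H1 H2 *:%R (opf T) (op_axiom T).1.

Definition bnd (H1 H2 : hilbertType R) (c : R) (T : H1 -> H2) : Prop :=
  forall u, nr (T u) <= c * nr u.

Lemma opP (H1 H2 : hilbertType R) (S T : op H1 H2) : S =1 T -> S = T.
Proof.
case: S T => [f fP] [g gP] /= /funext fg; case: _ / fg in gP *.
by congr Op; exact: Prop_irrelevance.
Qed.

Lemma bnd_ex (H1 H2 : hilbertType R) (T : op H1 H2) : exists2 c : R, 0 <= c & bnd c T.
Proof.
have [c hc] := (op_axiom T).2; exists `|c| => // u.
by apply: le_trans (hc u) _; rewrite ler_wpM2r ?nr_ge0// ler_norm.
Qed.

Section Lmodule.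
Variables H1 H2 : hilbertType R.
Implicit Types S T : op H1 H2.

Let add_axiom S T : linear (fun u => S u + T u) /\
  exists c : R, forall u, nr (S u + T u) <= c * nr u.
Proof.
split=> [a u v|]; first by rewrite !linearP scalerDr addrACA.
have [c _ hc] := bnd_ex S; have [d _ hd] := bnd_ex T; exists (c + d) => u.
by apply: le_trans (nrD _ _) _; rewrite mulrDl lerD.
Qed.
Definition op_add S T := Op (add_axiom S T).

Let opp_axiom T : linear (fun u => - T u) /\ exists c : R, forall u, nr (- T u) <= c * nr u.
Proof.
split=> [a u v|]; first by rewrite linearP opprD scalerN.
by have [c _ hc] := bnd_ex T; exists c => u; rewrite nrN.
Qed.
Definition op_opp T := Op (opp_axiom T).

Let zero_axiom : linear (fun _ : H1 => 0 : H2) /\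
  exists c : R, forall u : H1, nr (0 : H2) <= c * nr u.
Proof.
split=> [a u v|]; first by rewrite scaler0 addr0.
by exists 0 => u; rewrite nr0 mul0r.
Qed.
Definition op_zero := Op zero_axiom.

Let scale_axiom (a : C) T : linear (fun u => a *: T u) /\
  exists c : R, forall u, nr (a *: T u) <= c * nr u.
Proof.
split=> [b u v|]; first by rewrite linearP scalerDr !scalerA mulrC.
have [c _ hc] := bnd_ex T; exists (nr a * c) => u.
by rewrite nrZ -mulrA ler_wpM2l ?nr_ge0.
Qed.
Definition op_scale a T := Op (scale_axiom a T).

Let op_addA : associative op_add.
Proof. by move=> S T W; apply: opP => u /=; rewrite addrA. Qed.
Let op_addC : commutative op_add.
Proof. by move=> S T; apply: opP => u /=; rewrite addrC. Qed.
Let op_add0 : left_id op_zero op_add.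
Proof. by move=> S; apply: opP => u /=; rewrite add0r. Qed.
Let op_addN : left_inverse op_zero op_opp op_add.
Proof. by move=> S; apply: opP => u /=; rewrite addNr. Qed.
HB.instance Definition _ := GRing.isZmodule.Build (op H1 H2) op_addA op_addC op_add0 op_addN.

Let op_scaleA a b T : op_scale a (op_scale b T) = op_scale (a * b) T.
Proof. by apply: opP => u /=; rewrite scalerA. Qed.
Let op_scale1 : left_id 1 op_scale.
Proof. by move=> T; apply: opP => u /=; rewrite scale1r. Qed.
Let op_scaleDr : right_distributive op_scale +%R.
Proof. by move=> a S T; apply: opP => u /=; rewrite scalerDr. Qed.
Let op_scaleDl T : {morph op_scale^~ T : a b / a + b}.
Proof. by move=> a b; apply: opP => u /=; rewrite scalerDl. Qed.
HB.instance Definition _ := GRing.Zmodule_isLmodule.Build C (op H1 H2)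
  op_scaleA op_scale1 op_scaleDr op_scaleDl.

Lemma opD S T u : (S + T) u = S u + T u. Proof. by []. Qed.
Lemma opN T u : (- T) u = - T u. Proof. by []. Qed.
Lemma opB S T u : (S - T) u = S u - T u. Proof. by []. Qed.
Lemma op0 u : (0 : op H1 H2) u = 0. Proof. by []. Qed.
Lemma opZ a T u : (a *: T) u = a *: T u. Proof. by []. Qed.
Lemma opDr T u v : T (u + v) = T u + T v. Proof. exact: linearD. Qed.
Lemma opBr T u v : T (u - v) = T u - T v. Proof. exact: linearB. Qed.
Lemma op0r T : T 0 = 0. Proof. exact: linear0. Qed.
Lemma opZr a T u : T (a *: u) = a *: T u. Proof. exact: linearZ. Qed.
Lemma op_sumr (J : Type) (r : seq J) (P : pred J) T (F : J -> H1) :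
  T (\sum_(i <- r | P i) F i) = \sum_(i <- r | P i) T (F i).
Proof. exact: linear_sum. Qed.
Lemma op_sum (J : Type) (r : seq J) (P : pred J) (F : J -> op H1 H2) u :
  (\sum_(i <- r | P i) F i) u = \sum_(i <- r | P i) F i u.
Proof. by elim/big_rec2: _ => // i x y _ <-. Qed.

End Lmodule.

Let comp_axiom (H1 H2 H3 : hilbertType R) (S : op H2 H3) (T : op H1 H2) :
  linear (fun u => S (T u)) /\ exists c : R, forall u, nr (S (T u)) <= c * nr u.
Proof.
split=> [a u v|]; first by rewrite !linearP.
have [c c0 hc] := bnd_ex S; have [d _ hd] := bnd_ex T; exists (c * d) => u.
by apply: le_trans (hc _) _; rewrite -mulrA ler_wpM2l.
Qed.
Definition op_comp H1 H2 H3 (S : op H2 H3) (T : op H1 H2) : op H1 H3 := Op (comp_axiom S T).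

Let id_axiom (H : hilbertType R) : linear (fun u : H => u) /\
  exists c : R, forall u : H, nr u <= c * nr u.
Proof. by split=> //; exists 1 => u; rewrite mul1r. Qed.
Definition op1 (H : hilbertType R) : op H H := Op (id_axiom H).

Local Notation "S ** T" := (op_comp S T) (at level 40, left associativity).

Section Composition.
Variables H1 H2 H3 H4 : hilbertType R.

Lemma compE (S : op H2 H3) (T : op H1 H2) u : (S ** T) u = S (T u).
Proof. by []. Qed.
Lemma compA (S : op H3 H4) (T : op H2 H3) (W : op H1 H2) : S ** (T ** W) = S ** T ** W.
Proof. exact: opP. Qed.
Lemma comp1l (T : op H1 H2) : op1 H2 ** T = T. Proof. exact: opP. Qed.
Lemma comp1r (T : op H1 H2) : T ** op1 H1 = T. Proof. exact: opP. Qed.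
Lemma comp0l (T : op H1 H2) : (0 : op H2 H3) ** T = 0. Proof. exact: opP. Qed.
Lemma comp0r (T : op H2 H3) : T ** (0 : op H1 H2) = 0.
Proof. by apply: opP => u /=; rewrite linear0. Qed.
Lemma compDl (S T : op H2 H3) (W : op H1 H2) : (S + T) ** W = S ** W + T ** W.
Proof. exact: opP. Qed.
Lemma compDr (W : op H2 H3) (S T : op H1 H2) : W ** (S + T) = W ** S + W ** T.
Proof. by apply: opP => u /=; rewrite linearD. Qed.
Lemma compNr (W : op H2 H3) (S : op H1 H2) : W ** (- S) = - (W ** S).
Proof. by apply: opP => u /=; rewrite linearN. Qed.
Lemma compBl (S T : op H2 H3) (W : op H1 H2) : (S - T) ** W = S ** W - T ** W.
Proof. exact: opP. Qed.
Lemma compBr (W : op H2 H3) (S T : op H1 H2) : W ** (S - T) = W ** S - W ** T.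
Proof. by rewrite compDr compNr. Qed.
Lemma compZl a (S : op H2 H3) (W : op H1 H2) : (a *: S) ** W = a *: (S ** W).
Proof. exact: opP. Qed.
Lemma compZr a (W : op H2 H3) (S : op H1 H2) : W ** (a *: S) = a *: (W ** S).
Proof. by apply: opP => u /=; rewrite linearZ. Qed.
Lemma comp_suml (J : Type) (r : seq J) (P : pred J) (F : J -> op H2 H3) (W : op H1 H2) :
  (\sum_(i <- r | P i) F i) ** W = \sum_(i <- r | P i) (F i ** W).
Proof. by apply: opP => u; rewrite op_sum compE op_sum. Qed.
Lemma comp_sumr (J : Type) (r : seq J) (P : pred J) (F : J -> op H1 H2) (W : op H2 H3) :
  W ** (\sum_(i <- r | P i) F i) = \sum_(i <- r | P i) (W ** F i).
Proof. by apply: opP => u; rewrite op_sum compE op_sum linear_sum. Qed.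

End Composition.

Section Adjoint.
Variables H1 H2 : hilbertType R.
Implicit Types S T : op H1 H2.

Lemma adj_ex (T : op H1 H2) : exists S : op H2 H1, forall u v, inner (T u) v = inner u (S v).
Proof.
have [c c0 hc] := bnd_ex T.
have ex v : exists w, forall u, inner (T u) v = inner u w.
  have [||||w _ hw] := @riesz_subspace R H1 setT (fun u => inner (T u) v) (c * nr v).
  - by split.
  - exact: closedT.
  - by move=> a u u'; rewrite linearP innerDl innerZl.
  - move=> u; apply: le_trans (CS _ _) _; rewrite mulrAC ler_wpM2r ?nr_ge0//.
  by exists w => u; exact: hw.
have [S hS] := choice ex.
have SP : linear S /\ exists c : R, forall u, nr (S u) <= c * nr u.
  split.
    move=> a u v; apply: inner_eq => w; rewrite innerC -hS [RHS]innerC.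
    by congr (_^*); rewrite !innerDr !innerZr -!hS.
  exists c => v; apply: nr_le_inner; first by rewrite mulr_ge0 ?nr_ge0.
  move=> u; rewrite innerC nr_conj -hS; apply: le_trans (CS _ _) _.
  by rewrite mulrAC ler_wpM2r ?nr_ge0.
by exists (Op SP).
Qed.

Definition adj (T : op H1 H2) : op H2 H1 := projT1 (cid (adj_ex T)).

Lemma adjE T u v : inner (T u) v = inner u (adj T v).
Proof. by rewrite /adj; case: cid. Qed.

Lemma adjE' T u v : inner (adj T u) v = inner u (T v).
Proof. by rewrite innerC -adjE -innerC. Qed.

Lemma adj_unique T (S : op H2 H1) : (forall u v, inner (T u) v = inner u (S v)) -> adj T = S.
Proof.
by move=> h; apply: opP => u; apply: inner_eq => v; rewrite adjE' innerC h -innerC.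
Qed.

Lemma bnd_adj c (T : op H1 H2) : 0 <= c -> bnd c T -> bnd c (adj T).
Proof.
move=> c0 h u; apply: nr_le_inner; first by rewrite mulr_ge0 ?nr_ge0.
move=> v; rewrite adjE'; apply: le_trans (CS _ _) _.
by rewrite mulrAC mulrC ler_wpM2r ?nr_ge0.
Qed.

Lemma adjD S T : adj (S + T) = adj S + adj T.
Proof. by apply: adj_unique => u v; rewrite !opD innerDl innerDr !adjE. Qed.
Lemma adjN T : adj (- T) = - adj T.
Proof. by apply: adj_unique => u v; rewrite !opN innerNl innerNr !adjE. Qed.
Lemma adjB S T : adj (S - T) = adj S - adj T.
Proof. by rewrite adjD adjN. Qed.
Lemma adjZ a T : adj (a *: T) = a^* *: adj T.
Proof. by apply: adj_unique => u v; rewrite !opZ innerZl innerZr conjCK !adjE. Qed.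
Lemma adj0 : adj 0 = 0.
Proof. by apply: adj_unique => u v; rewrite !op0 inner0l inner0r. Qed.
Lemma adj_sum (J : Type) (r : seq J) (P : pred J) (F : J -> op H1 H2) :
  adj (\sum_(i <- r | P i) F i) = \sum_(i <- r | P i) adj (F i).
Proof. by elim/big_rec2: _ => [|i x y _ <-]; rewrite ?adj0 ?adjD. Qed.

End Adjoint.

Lemma adjK (H1 H2 : hilbertType R) (T : op H1 H2) : adj (adj T) = T.
Proof. by apply: adj_unique => u v; rewrite adjE'. Qed.
Lemma adj1 (H : hilbertType R) : adj (op1 H) = op1 H.
Proof. exact: adj_unique. Qed.
Lemma adj_comp (H1 H2 H3 : hilbertType R) (S : op H2 H3) (T : op H1 H2) :
  adj (S ** T) = adj T ** adj S.
Proof. by apply: adj_unique => u v; rewrite !compE !adjE. Qed.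

Section Bounds.
Variables H1 H2 H3 : hilbertType R.

Lemma bnd_comp c d (S : op H2 H3) (T : op H1 H2) : 0 <= c ->
  bnd c S -> bnd d T -> bnd (c * d) (S ** T).
Proof. by move=> c0 hS hT u; apply: le_trans (hS _) _; rewrite -mulrA ler_wpM2l. Qed.

Lemma bndD c d (S T : op H1 H2) : bnd c S -> bnd d T -> bnd (c + d) (S + T).
Proof. by move=> hS hT u; apply: le_trans (nrD _ _) _; rewrite mulrDl lerD. Qed.

Lemma bndN c (T : op H1 H2) : bnd c T -> bnd c (- T).
Proof. by move=> hT u; rewrite nrN. Qed.

Lemma bndZ a c (T : op H1 H2) : bnd c T -> bnd (nr a * c) (a *: T).
Proof. by move=> hT u; rewrite nrZ -mulrA ler_wpM2l ?nr_ge0. Qed.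

Lemma bnd_sum (J : Type) (r : seq J) (P : pred J) (F : J -> op H1 H2) (c : J -> R) :
  (forall i, P i -> bnd (c i) (F i)) ->
  bnd (\sum_(i <- r | P i) c i) (\sum_(i <- r | P i) F i).
Proof.
move=> h; elim/big_rec2: _ => [u|i x y Pi hy]; first by rewrite nr0 mul0r.
exact: bndD (h _ Pi) hy.
Qed.

Lemma bndW c d (T : op H1 H2) : c <= d -> bnd c T -> bnd d T.
Proof. by move=> cd h u; apply: le_trans (h u) _; rewrite ler_wpM2r ?nr_ge0. Qed.

Lemma op_continuous (T : op H1 H2) (V : set H2) : closed V -> closed [set u | V (T u)].
Proof.
move=> cV; apply: approx_closed => w h; apply: (closed_approx cV) => e e0.
have [c c0 hc] := bnd_ex T; have c1 : 0 < 1 + c by rewrite ltr_wpDr.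
have [v Vv wv] := h _ (divr_gt0 e0 c1); exists (T v) => //.
rewrite -linearB; apply: le_trans (hc _) _; move: wv; rewrite ler_pdivlMr//.
by have := nr_ge0 (w - v); lra.
Qed.

End Bounds.

Section WeakLimit.
Variables (U : set_system nat).
Context {UU : UltraFilter U}.

Definition wlim (H1 H2 : hilbertType R) (T : nat -> op H1 H2) (S : op H1 H2) : Prop :=
  forall u v, ulim U (fun n => inner (T n u) v) (inner (S u) v).

Section Basic.
Variables H1 H2 H3 : hilbertType R.
Implicit Types T : nat -> op H1 H2.

(** Weak compactness of bounded sets: the limits of the matrix coefficients form a bounded
    sesquilinear form, which Riesz represents. Conjugation makes the functional linear in [v]. *)
Lemma wlim_ex T c : 0 <= c -> (forall n, bnd c (T n)) -> exists2 S, wlim T S & bnd c S.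
Proof.
move=> c0 h.
have bi u v n : nr (inner (T n u) v) <= c * nr u * nr v.
  by apply: le_trans (CS _ _) _; rewrite ler_wpM2r ?nr_ge0// h.
have ex u : exists w, forall v, ulim U (fun n => inner (T n u) v) (inner w v).
  have [phi hphi] := choice (fun v => ulim_ex (bi u v)).
  have [||||w _ hw] := @riesz_subspace R H2 setT (fun v => (phi v)^*) (c * nr u).
  - by split.
  - exact: closedT.
  - move=> a v v'; rewrite -[a]conjCK -rmorphM -rmorphD; congr (_^*).
    apply: (ulim_unique (hphi _)).
    apply: eq_ulim (ulimD (ulimM (a^*) (hphi v)) (hphi v')) => n.
    by rewrite innerDr innerZr conjCK.
  - by move=> v; rewrite nr_conj; exact: ulim_le (hphi v) _.
  by exists w => v; have := hphi v; rewrite -[phi v]conjCK hw// -innerC.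
have [S hS] := choice ex.
have SP : linear S /\ exists c : R, forall u, nr (S u) <= c * nr u.
  split.
    move=> a u v; apply: inner_eq => w; apply: (ulim_unique (hS _ _)).
    rewrite innerDl innerZl; apply: eq_ulim (ulimD (ulimM a (hS u w)) (hS v w)) => n.
    by rewrite linearP innerDl innerZl.
  exists c => u; apply: nr_le_inner; first by rewrite mulr_ge0 ?nr_ge0.
  by move=> v; exact: ulim_le (hS u v) _.
exists (Op SP) => // u; apply: nr_le_inner; first by rewrite mulr_ge0 ?nr_ge0.
by move=> v; exact: ulim_le (hS u v) _.
Qed.

Lemma wlim_unique T S S' : wlim T S -> wlim T S' -> S = S'.
Proof.
by move=> h h'; apply: opP => u; apply: inner_eq => v; exact: (ulim_unique (h u v) (h' u v)).
Qed.

Lemma wlimD T T' S S' : wlim T S -> wlim T' S' -> wlim (fun n => T n + T' n) (S + S').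
Proof.
move=> h h' u v; rewrite opD innerDl.
by apply: eq_ulim (ulimD (h u v) (h' u v)) => n; rewrite opD innerDl.
Qed.

Lemma wlimN T S : wlim T S -> wlim (fun n => - T n) (- S).
Proof.
move=> h u v; rewrite opN innerNl.
by apply: eq_ulim (ulimN (h u v)) => n; rewrite opN innerNl.
Qed.

Lemma wlim_cst (S : op H1 H2) : wlim (fun _ => S) S.
Proof. by move=> u v; exact: ulim_cst. Qed.

Lemma wlim_adj T S : wlim T S -> wlim (fun n => adj (T n)) (adj S).
Proof.
move=> h u v; rewrite adjE' innerC.
by apply: eq_ulim (ulim_conj (h v u)) => n; rewrite adjE' [RHS]innerC.
Qed.

Lemma wlim0 T : (forall u, ulim U (fun n => T n u) 0) -> wlim T 0.
Proof.
move=> h u v; rewrite inner0l; apply: (ulim0_le _ (h u)) => n.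
by rewrite mulrC; exact: CS.
Qed.

Lemma wlim_bnd T S c : 0 <= c -> (forall n, bnd c (T n)) -> wlim T S -> bnd c S.
Proof.
move=> c0 hc h u; apply: nr_le_inner; first by rewrite mulr_ge0 ?nr_ge0.
move=> v; apply: ulim_le (h u v) _ => n; apply: le_trans (CS _ _) _.
by rewrite ler_wpM2r ?nr_ge0// hc.
Qed.

End Basic.

Lemma wlim_compl (H1 H2 H3 : hilbertType R) (W : op H2 H3) (T : nat -> op H1 H2) S :
  wlim T S -> wlim (fun n => W ** T n) (W ** S).
Proof.
by move=> h u v; rewrite compE adjE; apply: eq_ulim (h u (adj W v)) => n; rewrite compE -adjE.
Qed.

Lemma wlim_compr (H1 H2 H3 : hilbertType R) (W : op H1 H2) (T : nat -> op H2 H3) S :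
  wlim T S -> wlim (fun n => T n ** W) (S ** W).
Proof. by move=> h u v; exact: h. Qed.

End WeakLimit.
End Operators.
Notation "S ** T" := (op_comp S T) (at level 40, left associativity) : ring_scope.

Lemma closed_eq_op (R : realType) (H1 H2 : hilbertType R) (S T : op H1 H2) :
  linear_subspace [set u | S u = T u] /\ closed [set u | S u = T u].
Proof.
split; first by split=> [|c u v /= hu hv]; rewrite /= ?op0r// !opDr !opZr hu hv.
rewrite (_ : [set u | S u = T u] = [set u | [set 0] ((S - T) u)]).
  apply: op_continuous; exact: (accessible_closed_set1 (hausdorff_accessible (@norm_hausdorff _ H2))).
apply/seteqP; split=> u /= h; first by change (S u - T u = 0); rewrite h subrr.
by apply/eqP; rewrite -subr_eq0 -opB; apply/eqP.
Qed.

(** * Schur's lemma *)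

Section Schur.
Variables (R : realType) (H : hilbertType R).
Local Notation C := R[i].
Implicit Types S T X Y Z W : op H H.

(* [pospoly X a Z]: [Z = p(X)] and [a = p(1)] for a polynomial [p] with nonnegative coefficients. *)
Inductive pospoly X : R -> op H H -> Prop :=
| pospoly0 : pospoly X 0 0
| pospolyX : pospoly X 1 X
| pospolyD a b Z W : pospoly X a Z -> pospoly X b W -> pospoly X (a + b) (Z + W)
| pospolyM a b Z W : pospoly X a Z -> pospoly X b W -> pospoly X (a * b) (Z ** W)
| pospolyZ t a Z : 0 <= t -> pospoly X a Z -> pospoly X (t * a) (t%:C%C *: Z).

Lemma pospoly_comm X a Z S : S ** X = X ** S -> pospoly X a Z -> S ** Z = Z ** S.
Proof.
move=> SX; elim=> {a Z} [||a b Z W _ hZ _ hW|a b Z W _ hZ _ hW|t a Z _ _ hZ] //.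
- by rewrite comp0l comp0r.
- by rewrite compDr compDl hZ hW.
- by rewrite compA hZ -compA hW compA.
- by rewrite compZr compZl hZ.
Qed.

Lemma pospoly_bnd X a Z : bnd 1 X -> pospoly X a Z -> 0 <= a /\ bnd a Z.
Proof.
move=> bX; elim=> {a Z} [||a b Z W _ [a0 hZ] _ [b0 hW]|a b Z W _ [a0 hZ] _ [b0 hW]|t a Z t0 _ [a0 hZ]].
- by split=> // u; rewrite nr0 mul0r.
- by [].
- by split; [exact: addr_ge0|exact: bndD].
- by split; [exact: mulr_ge0|exact: bnd_comp].
- split; first exact: mulr_ge0.
  have := @bndZ _ _ _ t%:C%C _ _ hZ; by rewrite nrC ger0_norm.
Qed.

Fixpoint sqrt_iter X n : op H H :=
  if n is m.+1 then (2^-1)%:C%C *: (X + sqrt_iter X m ** sqrt_iter X m) else 0.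

Fixpoint sqrt_iter1 n : R :=
  if n is m.+1 then 2^-1 * (1 + sqrt_iter1 m * sqrt_iter1 m) else 0.

Lemma sqrt_iter_pospoly X n : pospoly X (sqrt_iter1 n) (sqrt_iter X n).
Proof.
elim: n => [|n IH] /=; first exact: pospoly0.
by apply: pospolyZ => //; apply: pospolyD; [exact: pospolyX|exact: pospolyM].
Qed.

Lemma sqrt_iter_comm X n : X ** sqrt_iter X n = sqrt_iter X n ** X.
Proof. exact: pospoly_comm (sqrt_iter_pospoly X n). Qed.

Lemma sqrt_iter_comm2 X m n :
  sqrt_iter X m ** sqrt_iter X n = sqrt_iter X n ** sqrt_iter X m.
Proof. by apply: pospoly_comm (sqrt_iter_pospoly X n); rewrite sqrt_iter_comm. Qed.

(** The next increment is half the product of the present increment with the sum of two iterates, so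
    its coefficients stay nonnegative. For a contraction [X] the increments are therefore bounded by
    those of the scalar sequence at [X = 1], which is increasing and bounded; this gives norm
    convergence. *)
Lemma sqrt_iter_step X n :
  pospoly X (sqrt_iter1 n.+1 - sqrt_iter1 n) (sqrt_iter X n.+1 - sqrt_iter X n).
Proof.
have h2 : 0 <= 2^-1 :> R by rewrite invr_ge0.
elim: n => [|n IH].
  rewrite !subr0; exact: sqrt_iter_pospoly.
have := pospolyZ h2 (pospolyM IH (pospolyD (sqrt_iter_pospoly X n.+1) (sqrt_iter_pospoly X n))).
have <- : sqrt_iter1 n.+2 - sqrt_iter1 n.+1 = 2^-1 *
   ((sqrt_iter1 n.+1 - sqrt_iter1 n) * (sqrt_iter1 n.+1 + sqrt_iter1 n)).
  rewrite [LHS](_ : _ = 2^-1 * (1 + sqrt_iter1 n.+1 * sqrt_iter1 n.+1) - 2^-1 * (1 + sqrt_iter1 n * sqrt_iter1 n)) //; ring.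
suff -> : sqrt_iter X n.+2 - sqrt_iter X n.+1 = (2^-1)%:C%C *:
   ((sqrt_iter X n.+1 - sqrt_iter X n) ** (sqrt_iter X n.+1 + sqrt_iter X n)) by [].
rewrite [LHS](_ : _ = (2^-1)%:C%C *: (X + sqrt_iter X n.+1 ** sqrt_iter X n.+1) - (2^-1)%:C%C *: (X + sqrt_iter X n ** sqrt_iter X n)) //.
rewrite -scalerBr; congr (_ *: _).
move: (sqrt_iter_comm2 X n.+1 n); move: (sqrt_iter X n.+1) (sqrt_iter X n) => A B AB.
by rewrite compBl !compDr AB [X + _]addrC addrKA opprD addrA addrK.
Qed.

Lemma sqrt_iter1_le1 n : 0 <= sqrt_iter1 n <= 1.
Proof. elim: n => [|n] /=; [by rewrite lexx ler01|nra]. Qed.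

Lemma sqrt_iter_diff X m n : (m <= n)%N ->
  pospoly X (sqrt_iter1 n - sqrt_iter1 m) (sqrt_iter X n - sqrt_iter X m).
Proof.
elim: n => [|n IH]; first by rewrite leqn0 => /eqP ->; rewrite !subrr; exact: pospoly0.
rewrite leq_eqVlt => /orP[/eqP ->|/IH h]; first by rewrite !subrr; exact: pospoly0.
by have := pospolyD (sqrt_iter_step X n) h; rewrite !addrA !subrK.
Qed.

Lemma sqrt_iter1_cauchy (e : R) : 0 < e ->
  exists N, forall n, (N <= n)%N -> sqrt_iter1 n - sqrt_iter1 N <= e.
Proof.
move=> e0; pose E := [set sqrt_iter1 n | n in [set: nat]].
have hs : has_sup E.
  by split; [exists (sqrt_iter1 0), 0%N|exists 1 => _ [n _ <-]; have /andP[] := sqrt_iter1_le1 n].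
have [_ [N _ <-] hN] := sup_adherent e0 hs; exists N => n _.
have : sqrt_iter1 n <= sup E by apply: sup_upper_bound => //; exists n.
by move: hN; lra.
Qed.

(* The absolute value of [T] is [1 - Y] with [Y = (X + Y^2) / 2] and [X = 1 - T^2]. *)
Lemma op_abs_ex T : adj T = T -> bnd 1 T -> exists A : op H H,
  [/\ A ** A = T ** T, forall u, 0 <= complex.Re (inner (A u) u) &
      forall S, S ** T = T ** S -> S ** A = A ** S].
Proof.
move=> aT bT; pose X := op1 H - T ** T.
(* [|X u|^2 = |u|^2 - 2 |T u|^2 + |T (T u)|^2], where the last term is at most [|T u|^2]. *)
have bX : bnd 1 X.
  move=> u; rewrite mul1r; apply: le_from_sqr; first exact: nr_ge0.
  rewrite nrB_sqr !compE -adjE' aT inner_nr /=.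
  have := le_trans (bT (T u)) (ler_wpM2l ler01 (lexx _)); rewrite mul1r => h.
  have := ler_pXn2r (ltn0Sn 1) (nr_ge0 (T (T u))) (nr_ge0 (T u)); rewrite h; nra.
have [U [UU Uoo]] := ultraFilterLemma (eventually_filter : ProperFilter \oo).
have bY n : bnd 1 (sqrt_iter X n).
  have [_] := pospoly_bnd bX (sqrt_iter_pospoly X n).
  by apply: bndW; have /andP[] := sqrt_iter1_le1 n.
have [Y hY bYl] := wlim_ex ler01 bY.
have strong (e : R) : 0 < e -> exists N, forall n, (N <= n)%N -> bnd e (Y - sqrt_iter X n).
  move=> e0; have [N hN] := sqrt_iter1_cauchy e0; exists N => n Nn u.
  apply: nr_le_inner => [|v]; first by rewrite mulr_ge0 ?nr_ge0// ltW.
  rewrite opB innerBl; apply: (ulim_le_near (ulimB (hY u v) (ulim_cst _))).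
  apply: Uoo; exists n => // k /= nk.
  rewrite -innerBl; apply: le_trans (CS _ _) _; rewrite ler_wpM2r ?nr_ge0//.
  have [_] := pospoly_bnd bX (sqrt_iter_diff X nk); move/(_ u)/le_trans; apply.
  rewrite ler_wpM2r ?nr_ge0//; have := hN k (leq_trans Nn nk).
  have [] := pospoly_bnd bX (sqrt_iter_diff X Nn); lra.
have YY : 2%:R *: Y = X + Y ** Y.
  apply: opP => u; apply/eqP; rewrite -subr_eq0; apply/eqP/nr_small0 => e e0.
  pose c := 3 * nr u + nr (Y u) + 1.
  have c0 : 0 < c by have := nr_ge0 u; have := nr_ge0 (Y u); rewrite /c; lra.
  have [N hN] := strong _ (divr_gt0 e0 c0).
  have st : 2%:R *: sqrt_iter X N.+1 u = X u + sqrt_iter X N (sqrt_iter X N u).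
    rewrite -[sqrt_iter X N.+1 u]/((2^-1)%:C%C *: (X u + sqrt_iter X N (sqrt_iter X N u))).
    rewrite scalerA -(rmorph_nat (real_complex R)) -rmorphM /=.
    by rewrite mulfV ?pnatr_eq0// scale1r.
  have -> : (2%:R *: Y) u - (X + Y ** Y) u = 2%:R *: (Y - sqrt_iter X N.+1) u
      - ((Y - sqrt_iter X N) (Y u) + sqrt_iter X N ((Y - sqrt_iter X N) u)).
    rewrite !(opB, opZ, opD, compE) scalerBr st.
    move: (sqrt_iter X N) => Q; rewrite linearB /= addrA subrK.
    rewrite -[RHS]addrA -opprD; congr (_ - _).
    by rewrite -[RHS]addrA [Q _ + _]addrC subrK.
  apply: le_trans (nrB_le _ _) _; rewrite nrZ nr_nat.
  apply: le_trans (lerD (ler_wpM2l _ (hN _ (leqnSn N) u)) (nrD _ _)) _; first by [].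
  have h1 := hN _ (leqnn N) (Y u); have := bY N ((Y - sqrt_iter X N) u).
  have h2 := hN _ (leqnn N) u; rewrite mul1r => h3.
  apply: le_trans (lerD (lexx _) (lerD h1 (le_trans h3 h2))) _.
  rewrite [X in X <= _](_ : _ = e / c * (3 * nr u + nr (Y u))); last by ring.
  rewrite mulrAC ler_pdivrMr//; apply: ler_wpM2l; first exact: ltW.
  by rewrite /c lerDl.
exists (op1 H - Y); split.
- have YYE : Y ** Y = Y + Y - X by rewrite -mulr2n -scaler_nat YY addrC addKr.
  rewrite compBl !compBr comp1l comp1r comp1l YYE opprB.
  by rewrite [_ - Y in X in _ + X]addrAC addrK addrA subrK subKr.
- move=> u; rewrite opB innerBl ReD ReN inner_nr /= subr_ge0.
  apply: le_trans (ler_norm _) _; apply: le_trans (Re_le_nr _) _.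
  apply: le_trans (CS _ _) _; rewrite expr2 ler_wpM2r ?nr_ge0//.
  by have := bYl u; rewrite mul1r.
- move=> S ST; have SX : S ** X = X ** S.
    by rewrite compBr compBl comp1r comp1l compA ST -compA ST compA.
  have SY : S ** Y = Y ** S.
    apply: (wlim_unique (wlim_compl S hY)) => u v.
    apply: eq_ulim (wlim_compr S hY u v) => n.
    by rewrite (pospoly_comm SX (sqrt_iter_pospoly X n)).
  by rewrite compBr compBl comp1r comp1l SY.
Qed.

Section Irreducible.
Variable F : set (op H H).
Hypothesis irr : forall V : set H, linear_subspace V -> closed V ->
  (forall S, F S -> forall v, V v -> V (S v)) -> V = [set 0] \/ V = setT.

(** The relation makes the kernel of [T] invariant under [F], whatever [S'] is. *)
Lemma irr_ker T : (forall S, F S -> exists S', T ** S = S' ** T) ->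
  T = 0 \/ forall u, T u = 0 -> u = 0.
Proof.
move=> h; have [lV cV] := closed_eq_op T 0.
have [|||V0|VT] := irr (V := [set u | T u = 0]) => //.
- move=> S FS v /= Tv; have [S' e] := h S FS.
  by rewrite -compE e compE Tv linear0.
- by right=> u Tu; have : [set u | T u = 0] u by []; rewrite V0.
- by left; apply: opP => u; have : [set u | T u = 0] u by rewrite VT.
Qed.

(** After scaling [T] to a contraction with absolute value [A], [(A + T) (A - T) = 0]. The kernel of
    [A + T] is trivial or everything, so [T = A] or [T = - A]. *)
Lemma irr_sign T : adj T = T -> (forall S, F S -> S ** T = T ** S) ->
  (forall u, 0 <= complex.Re (inner (T u) u)) \/
  (forall u, complex.Re (inner (T u) u) <= 0).
Proof.
move=> aT cT; have [c c0 hc] := bnd_ex T; pose d := (1 + c)^-1.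
have d0 : 0 < d by rewrite invr_gt0 ltr_wpDr.
have aT' : adj (d%:C%C *: T) = d%:C%C *: T by rewrite adjZ aT conjR.
have bT' : bnd 1 (d%:C%C *: T).
  apply: (bndW (c := nr d%:C%C * c)) (@bndZ _ _ _ d%:C%C c T hc); rewrite nrC ger0_norm ?(ltW d0)// mulrC ler_pdivrMr ?ltr_wpDr//.
  by rewrite mul1r lerDr.
have [A [AA A0 cA]] := op_abs_ex aT' bT'.
have ReT u : complex.Re (inner ((d%:C%C *: T) u) u) = d * complex.Re (inner (T u) u).
  by rewrite opZ innerZl ReZ.
move: AA cA; set T' := d%:C%C *: T => AA cA.
have AT : T' ** A = A ** T' by exact: cA.
have [|h|h] := irr_ker (T := A + T').
- move=> S FS; exists S; have ST : S ** T' = T' ** S by rewrite compZr compZl cT.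
  by rewrite compDl compDr cA// ST.
- right=> u; rewrite -(@pmulr_rle0 _ d)// -ReT.
  have -> : T' u = - A u by have /(congr1 (fun S : op H H => S u))/eqP := h; rewrite opD op0 addrC addr_eq0 => /eqP.
  by rewrite innerNl ReN oppr_le0.
- left=> u; rewrite -(@pmulr_rge0 _ d)// -ReT.
  have /h/eqP : (A + T') ((A - T') u) = 0.
    rewrite -compE compDl !compBr AA AT opD !opB; move: ((T' ** T') u) ((A ** T') u) => x y.
    by rewrite addrA subrK subrr.
  by rewrite opB subr_eq0 => /eqP <-.
Qed.

Lemma form_eq0 T : adj T = T -> (forall u, complex.Re (inner (T u) u) = 0) -> T = 0.
Proof.
move=> aT h; apply: opP => u; rewrite op0; apply/eqP; rewrite -nr_eq0 -sqrf_eq0 -Re_inner_nr.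
(* Polarization: the cross terms of the form at [u + T u] are twice [|T u|^2]. *)
have := h (u + T u); rewrite opDr innerDl !innerDr !ReD !h add0r addr0.
by rewrite [inner (T (T u)) u]adjE aT -mulr2n => /eqP; rewrite mulrn_eq0.
Qed.

(** By [irr_sign] every real [l] is a lower or an upper bound of the form of [T]. With [l] at the
    largest lower bound, and just above it, both bounds meet and the form of [T - l] vanishes. *)
Lemma schur_selfadj T : adj T = T -> (forall S, F S -> S ** T = T ** S) ->
  exists c : R, T = c%:C%C *: op1 H.
Proof.
move=> aT cT; have [c c0 hc] := bnd_ex T.
have shift (l : R) : (forall u, l * nr u ^+ 2 <= complex.Re (inner (T u) u)) \/
                     (forall u, complex.Re (inner (T u) u) <= l * nr u ^+ 2).
  have [|S FS|h|h] := @irr_sign (T - l%:C%C *: op1 H).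
  - by rewrite adjB aT adjZ adj1 conjR.
  - by rewrite compBr compBl cT// compZr compZl comp1l comp1r.
  - left=> u; have := h u; rewrite opB opZ innerBl innerZl ReD ReN ReZ Re_inner_nr.
    by rewrite subr_ge0.
  - right=> u; have := h u; rewrite opB opZ innerBl innerZl ReD ReN ReZ Re_inner_nr.
    by rewrite subr_le0.
have [H0|/existsNP[w w0]] := pselect (forall u : H, u = 0).
  by exists 0; apply: opP => u; rewrite (H0 u) !linear0.
have nw : 0 < nr w ^+ 2 by rewrite exprn_gt0// lt0r nr_ge0 nr_eq0 andbT; exact/eqP.
have bT u : `|complex.Re (inner (T u) u)| <= c * nr u ^+ 2.
  apply: le_trans (Re_le_nr _) _; apply: le_trans (CS _ _) _.
  by rewrite expr2 mulrA ler_wpM2r ?nr_ge0.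
pose E := [set l | forall u, l * nr u ^+ 2 <= complex.Re (inner (T u) u)].
have hs : has_sup E.
  split; [exists (- c) => u|exists c => l /(_ w) h].
    by have := bT u; rewrite ler_norml mulNr => /andP[].
  by rewrite -(ler_pM2r nw); apply: le_trans h _; have := bT w; rewrite ler_norml => /andP[].
exists (sup E); apply/eqP; rewrite -subr_eq0; apply/eqP/form_eq0.
  by rewrite adjB aT adjZ adj1 conjR.
move=> u; rewrite opB opZ innerBl innerZl ReD ReN ReZ Re_inner_nr.
apply/eqP; rewrite subr_eq0 eq_le; apply/andP; split; apply/ler_addgt0Pr => e e0;
  have n0 : 0 < 1 + nr u ^+ 2 by [rewrite ltr_wpDr ?sqr_ge0].
- have [h|h] := shift (sup E + e / (1 + nr u ^+ 2)).
    have := sup_upper_bound hs h; rewrite gerDl => h'.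
    by have := divr_gt0 e0 n0; rewrite ltNge h'.
  apply: le_trans (h u) _; rewrite mulrDl lerD2l mulrAC ler_pdivrMr//.
  by rewrite ler_wpM2l ?(ltW e0)// lerDr.
- have [l El hl] := sup_adherent (divr_gt0 e0 n0) hs.
  have := El u; move: hl; set q := complex.Re _; set N := nr u ^+ 2.
  rewrite ltrBlDr => hl h.
  have N0 : 0 <= N by rewrite sqr_ge0.
  apply: le_trans (ler_wpM2r N0 (ltW hl)) _; rewrite mulrDl lerD// mulrAC ler_pdivrMr//.
  by rewrite ler_wpM2l ?(ltW e0)// lerDr.
Qed.

(** The self-adjoint and skew parts of [T] are treated separately. As [F] need not be closed under
    adjoints, commutation with [adj T] is asked for on its own. *)
Lemma schur T : (forall S, F S -> S ** T = T ** S) ->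
  (forall S, F S -> S ** adj T = adj T ** S) -> exists c : C, T = c *: op1 H.
Proof.
move=> cT caT.
have [|S FS|a ha] := @schur_selfadj (T + adj T).
- by rewrite adjD adjK addrC.
- by rewrite compDr compDl cT// caT.
have [|S FS|b hb] := @schur_selfadj ('i%C *: (T - adj T)).
- rewrite adjZ adjB adjK (_ : 'i%C^* = - 'i%C); last by apply/eqP; rewrite eq_complex /= oppr0 !eqxx.
  by rewrite scaleNr -scalerN opprB.
- by rewrite compZr compZl compBr compBl cT// caT.
exists (2^-1 * (a%:C%C - 'i%C * b%:C%C)).
have ii : 'i%C * 'i%C = -1 :> C by apply/eqP; rewrite eq_complex /= !mul0r !mulr1 !mulr0 addr0 sub0r oppr0 !eqxx.
rewrite -scalerA scalerBl -ha -scalerA -hb scalerA ii scaleN1r opprK.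
by rewrite [T - _]addrC addrA addrK -[T + T]mulr2n -[T *+ 2]scaler_nat scalerA mulVf ?pnatr_eq0// scale1r.
Qed.

End Irreducible.
End Schur.

(** * Systems of projections indexed by words *)

Section Projection.
Variables (R : realType) (H : hilbertType R).

Lemma proj_ex (V : set H) : linear_subspace V -> closed V ->
  exists Q : op H H, [/\ adj Q = Q, forall u, V (Q u) & forall u, V u -> Q u = u].
Proof.
move=> lV cV; have [V0 VP] := lV.
have ex u : exists w, V w /\ forall v, V v -> inner v u = inner v w.
  have [||w Vw hw] := @riesz_subspace R H V (fun v => inner v u) (nr u) lV cV.
  - by move=> a v v'; rewrite innerDl innerZl.
  - by move=> v; apply: le_trans (CS _ _) _; rewrite mulrC.
  by exists w.
have [Q hQ] := choice ex.
have un u w w' : V w -> V w' -> (forall v, V v -> inner v w = inner v w') -> w = w'.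
  move=> Vw Vw' h; apply/eqP; rewrite -subr_eq0 -nr_eq0 -sqrf_eq0 -Re_inner_nr.
  have Vd : V (w - w') by rewrite addrC -scaleN1r; exact: VP.
  by rewrite innerBr h// subrr.
have VQ u : V (Q u) by case: (hQ u).
have QE u v : V v -> inner v (Q u) = inner v u by move=> Vv; rewrite (hQ u).2.
have QP : linear Q /\ exists c : R, forall u, nr (Q u) <= c * nr u.
  split=> [a u v|].
    apply: un => // [|w Vw]; first exact: VP.
    by rewrite QE// !innerDr !innerZr !QE.
  exists 1 => u; rewrite mul1r.
  have [->|nz] := eqVneq (nr (Q u)) 0; first exact: nr_ge0.
  have n0 : 0 < nr (Q u) by rewrite lt0r nz nr_ge0.
  rewrite -(ler_pM2r n0) -expr2 -Re_inner_nr QE//.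
  by apply: le_trans (ler_norm _) _; apply: le_trans (Re_le_nr _) _; rewrite mulrC; exact: CS.
exists (Op QP); split=> //=.
- by apply: adj_unique => u v /=; rewrite -(QE v (Q u))// [RHS]innerC -(QE u (Q v))// -innerC.
- by move=> u Vu; apply: un => // v Vv; rewrite QE.
Qed.

(** Invariance of [V] under [T] gives [Q T Q = T Q]; invariance under [adj T] gives, after taking
    adjoints, [Q T Q = Q T]. *)
Lemma proj_comm (V : set H) (Q T : op H H) : adj Q = Q ->
  (forall u, V (Q u)) -> (forall u, V u -> Q u = u) ->
  (forall u, V u -> V (T u)) -> (forall u, V u -> V (adj T u)) -> Q ** T = T ** Q.
Proof.
move=> aQ VQ QV TV aTV.
have h (S : op H H) : (forall u, V u -> V (S u)) -> Q ** S ** Q = S ** Q.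
  by move=> SV; apply: opP => u; rewrite !compE QV//; exact/SV/VQ.
rewrite -[RHS]h//; have := congr1 (@adj _ _ _) (h _ aTV).
by rewrite !adj_comp !adjK !aQ compA => /esym.
Qed.

End Projection.

Lemma projection_bnd (R : realType) (H : hilbertType R) (S : op H H) :
  adj S = S -> S ** S = S -> bnd 1 S.
Proof.
move=> aS SS x; rewrite mul1r; have [->|nz] := eqVneq (nr (S x)) 0; first exact: nr_ge0.
have n0 : 0 < nr (S x) by rewrite lt0r nz nr_ge0.
rewrite -(ler_pM2r n0) -expr2 -Re_inner_nr -adjE' aS -compE SS.
by apply: le_trans (ler_norm _) _; apply: le_trans (Re_le_nr _) _; rewrite mulrC; exact: CS.
Qed.

(** * Sums over words of fixed length *)

Section Words.
Variables (A : finType) (V : zmodType).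
Implicit Types (F : seq A -> V) (k : nat).

(** All words of length [k] are summed, reduced or not: the systems below vanish on the others, and
    sums then split freely over letters. *)
Definition wsum k F : V := \sum_(t : k.-tuple A) F t.

Lemma eq_wsum k F G : (forall t, size t = k -> F t = G t) -> wsum k F = wsum k G.
Proof. by move=> h; apply: eq_bigr => t _; rewrite h ?size_tuple. Qed.

Lemma wsum0 F : wsum 0 F = F [::].
Proof.
rewrite /wsum (big_pred1 [tuple]) // => t /=.
by rewrite tuple0; apply/esym/eqP/val_inj.
Qed.

Lemma wsumS k F : wsum k.+1 F = \sum_a wsum k (fun t => F (a :: t)).
Proof.
rewrite /wsum pair_big /=.
rewrite (reindex (fun p : A * k.-tuple A => [tuple of p.1 :: p.2])) //=.
exists (fun t : k.+1.-tuple A => (thead t, [tuple of behead t])) => [[a t] _|t _] /=.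
  by rewrite theadE; congr (_, _); apply: val_inj.
by rewrite [RHS]tuple_eta; apply: val_inj.
Qed.

Lemma wsum_cat j k F : wsum (j + k) F = wsum j (fun s => wsum k (fun t => F (s ++ t))).
Proof.
elim: j F => [|j IH] F; first by rewrite wsum0.
by rewrite addSn !wsumS; apply: eq_bigr => a _; rewrite IH.
Qed.

Lemma wsum1 F : wsum 1 F = \sum_a F [:: a].
Proof. by rewrite wsumS; apply: eq_bigr => a _; rewrite wsum0. Qed.

Lemma wsum_rcons k F : wsum k.+1 F = wsum k (fun t => \sum_a F (rcons t a)).
Proof.
rewrite -addn1 wsum_cat; apply: eq_wsum => t _; rewrite wsum1.
by apply: eq_bigr => a _; rewrite cats1.
Qed.

Lemma wsum_rev k F (f : A -> A) : involutive f ->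
  wsum k F = wsum k (fun t => F (rev (map f t))).
Proof.
move=> fK; rewrite /wsum (reindex_inj (h := fun t : k.-tuple A => [tuple of rev (map f t)])) //.
move=> s t /(congr1 val) /= /(congr1 rev); rewrite !revK => /(inj_map (inv_inj fK)) h.
exact: val_inj.
Qed.

Lemma wsumD k F G : wsum k (fun t => F t + G t) = wsum k F + wsum k G.
Proof. exact: big_split. Qed.

Lemma wsumB k F G : wsum k (fun t => F t - G t) = wsum k F - wsum k G.
Proof. by rewrite /wsum big_split /= sumrN. Qed.

End Words.

(** * Cylinder projections and their covariance *)

Section Systems.
Variables (R : realType) (I : finType).
Local Notation C := R[i].
Local Notation word := (seq (letter I)).
Implicit Types (a b : letter I) (x y w : word).

Definition winv w : word := rev (map (@linv I) w).

Lemma winvK : involutive winv.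
Proof. by move=> w; rewrite /winv map_rev revK mapK//; exact: linvK. Qed.

Lemma winv_cat x y : winv (x ++ y) = winv y ++ winv x.
Proof. by rewrite /winv map_cat rev_cat. Qed.

Lemma size_winv w : size (winv w) = size w.
Proof. by rewrite size_rev size_map. Qed.

Lemma reduced_winv w : reduced (winv w) = reduced w.
Proof. by apply/idP/idP => [/inv_reduced|/inv_reduced//]; rewrite -/(winv _) -/(winv _) winvK. Qed.

Lemma wsum_winv (V : zmodType) k (F : word -> V) : wsum k F = wsum k (fun t => F (winv t)).
Proof. by apply: wsum_rev; exact: linvK. Qed.

Section OneSpace.
Variable H : hilbertType R.
Variable U : letter I -> op H H.

Definition unitary_letters : Prop :=
  forall a, adj (U a) = U (linv a) /\ U a ** U (linv a) = op1 H.

Definition Uw x : op H H := foldr (fun a T => U a ** T) (op1 H) x.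

(* [P w] stands for the operator of the indicator of the cylinder of [w], which is 0 when [w] is not
   reduced; [ps_fwd] and [ps_back] are the covariance under one letter. *)
Record psystem (P : word -> op H H) : Prop := PSystem {
  ps1 : P [::] = op1 H ;
  ps_adj : forall w, adj (P w) = P w ;
  ps_mul : forall w x, P w ** P (w ++ x) = P (w ++ x) ;
  ps_orth : forall w x, size w = size x -> w <> x -> P w ** P x = 0 ;
  ps_sum : forall w, \sum_a P (rcons w a) = P w ;
  ps_red : forall w, ~~ reduced w -> P w = 0 ;
  ps_fwd : forall a w, reduced (a :: w) -> w <> [::] -> U a ** P w = P (a :: w) ** U a ;
  ps_back : forall a, P [:: a] ** U a = U a ** (op1 H - P [:: linv a]) }.

Section Unitary.
Hypothesis uU : unitary_letters.

Lemma Uw_cat x y : Uw (x ++ y) = Uw x ** Uw y.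
Proof. by elim: x => [|a x IH] /=; rewrite ?comp1l// IH compA. Qed.

Lemma Uw1 a : Uw [:: a] = U a.
Proof. by rewrite /= comp1r. Qed.

Lemma adj_Uw x : adj (Uw x) = Uw (winv x).
Proof.
elim: x => [|a x IH]; first by rewrite adj1.
rewrite -cat1s winv_cat !Uw_cat adj_comp IH; congr (_ ** _).
by rewrite -[winv [:: a]]/[:: linv a] !Uw1; case: (uU a).
Qed.

Lemma UwV x : Uw x ** Uw (winv x) = op1 H.
Proof.
elim: x => [|a x IH]; first by rewrite /= comp1l.
rewrite -cat1s winv_cat !Uw_cat -compA [Uw x ** _]compA IH comp1l.
by rewrite -[winv [:: a]]/[:: linv a] !Uw1; case: (uU a).
Qed.

Lemma UwVl x : Uw (winv x) ** Uw x = op1 H.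
Proof. by rewrite -{2}[x]winvK UwV. Qed.

Lemma bnd_unitary (T : op H H) : adj T ** T = op1 H -> forall u, nr (T u) = nr u.
Proof.
move=> h u; apply/eqP; rewrite -(@eqrXn2 _ 2)// ?nr_ge0// -!Re_inner_nr adjE.
by rewrite -compE h.
Qed.

End Unitary.

Section OneSystem.
Variable P : word -> op H H.
Hypothesis sP : psystem P.

Lemma ps_idem w : P w ** P w = P w.
Proof. by have := ps_mul sP w [::]; rewrite cats0. Qed.

Lemma ps_mulr w x : P (w ++ x) ** P w = P (w ++ x).
Proof.
by have := congr1 (@adj _ _ _) (ps_mul sP w x); rewrite adj_comp !(ps_adj sP).
Qed.

Lemma ps_orth_cat w x t : size w = size x -> w <> x -> P w ** P (x ++ t) = 0.
Proof. by move=> s wx; rewrite -(ps_mul sP x t) compA (ps_orth sP s wx) comp0l. Qed.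

Lemma ps_orth_catr w x t : size w = size x -> w <> x -> P (x ++ t) ** P w = 0.
Proof.
by move=> s wx; apply: (can_inj (@adjK _ _ _)); rewrite adj_comp !(ps_adj sP) adj0 ps_orth_cat.
Qed.

Lemma ps_wsum w k : wsum k (fun t => P (w ++ t)) = P w.
Proof.
elim: k w => [|k IH] w; first by rewrite wsum0 cats0.
rewrite wsumS -[RHS](ps_sum sP); apply: eq_bigr => a _.
by rewrite -(IH (rcons w a)); apply: eq_wsum => t _; rewrite cat_rcons.
Qed.

Lemma ps_wsum1 k : wsum k P = op1 H.
Proof. by rewrite -(ps1 sP) -(ps_wsum [::] k). Qed.

Lemma ps_pyth k (v : word -> H) :
  nr (\sum_(t : k.-tuple (letter I)) P t (v t)) ^+ 2 =
  \sum_(t : k.-tuple (letter I)) nr (P t (v t)) ^+ 2.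
Proof.
rewrite -Re_inner_nr inner_suml.
rewrite (eq_bigr (fun t : k.-tuple _ => (nr (P t (v t)) ^+ 2)%:C%C)) => [|t _].
  by rewrite -rmorph_sum.
rewrite inner_sumr (bigD1 t)//= big1 ?addr0 ?inner_nr// => s st.
rewrite adjE (ps_adj sP) -compE ps_orth ?op0 ?inner0r ?size_tuple//.
by move=> e; case/eqP: st; exact/esym/val_inj.
Qed.

Lemma ps_bessel k u :
  \sum_(t : k.-tuple (letter I)) nr (P t u) ^+ 2 = nr u ^+ 2.
Proof. by rewrite -ps_pyth -op_sum [\sum_(i : _) _]ps_wsum1. Qed.

Lemma ps_bnd w : bnd 1 (P w).
Proof.
exact: projection_bnd (ps_adj sP w) (ps_idem w).
Qed.

Lemma ps_Uw_fwd x w : reduced (x ++ w) -> w <> [::] -> Uw x ** P w = P (x ++ w) ** Uw x.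
Proof.
move=> + w0; elim: x => [|a x IH] /= r; first by rewrite comp1l comp1r.
have r' : reduced (x ++ w) by exact: path_sorted r.
rewrite -compA IH// !compA ps_fwd//.
by case: x {IH r r'}.
Qed.

(** A boundary point lies in the cylinder of [x a] exactly when it is the translate by [x a] of a
    point that does not start with the inverse of [a]. *)
Lemma ps_Uw_back x a : reduced (rcons x a) ->
  P (rcons x a) ** Uw (rcons x a) = Uw (rcons x a) ** (op1 H - P [:: linv a]).
Proof.
rewrite -cats1 => r; rewrite Uw_cat Uw1 compA -ps_Uw_fwd// -!compA; congr (_ ** _).
exact: ps_back.
Qed.

End OneSystem.
End OneSpace.

Lemma adj_intertwiner (H H' : hilbertType R) (W : letter I -> op H H) (W' : letter I -> op H' H') (T : op H H') :
  unitary_letters W -> unitary_letters W' -> (forall a, W' a ** T = T ** W a) ->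
  forall a, adj T ** W' a = W a ** adj T.
Proof.
move=> uW uW' hT a; have [e1 _] := uW (linv a); have [e2 _] := uW' (linv a); rewrite linvK in e1 e2.
by have := congr1 (@adj _ _ _) (hT (linv a)); rewrite !adj_comp e1 e2.
Qed.

(** * Diagonal parts of an operator between two systems *)

Section Diagonal.
Variables H H' : hilbertType R.
Variables (U : letter I -> op H H) (U' : letter I -> op H' H').
Hypothesis uU : unitary_letters U.
Hypothesis uU' : unitary_letters U'.
Variables (P : word -> op H H) (P' : word -> op H' H').
Hypothesis sP : psystem U P.
Hypothesis sP' : psystem U' P'.
Variable T : op H H'.

(** Pinching of [T] by the cylinders of level [k]. For two systems on one space and [T] the
    identity, this is [D_k] of the overview. *)
Definition diag k : op H H' := wsum k (fun t => P' t ** T ** P t).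

(** The blocks have orthogonal ranges and orthogonal supports, so Pythagoras on the target meets
    Bessel on the source. *)
Lemma bnd_diag c k : 0 <= c -> bnd c T -> bnd c (diag k).
Proof.
move=> c0 hT u; apply: le_from_sqr; first by rewrite mulr_ge0 ?nr_ge0.
rewrite /diag /wsum op_sum (ps_pyth sP' k (fun t => (T ** P t) u)) exprMn -(ps_bessel sP k u) mulr_sumr.
apply: ler_sum => t _; rewrite -exprMn ler_pXn2r// ?nnegrE ?mulr_ge0 ?nr_ge0//.
by apply: le_trans (ps_bnd sP' _ _) _; rewrite mul1r; exact: hT.
Qed.

Lemma diag_Pl w k : (size w <= k)%N ->
  P' w ** diag k = wsum (k - size w) (fun t => P' (w ++ t) ** T ** P (w ++ t)).
Proof.
move=> wk; rewrite /diag -{1}(subnKC wk) wsum_cat {1}/wsum.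
rewrite (bigD1 (in_tuple w))//= compDr [X in _ + X = _](_ : _ = 0).
  rewrite addr0 /wsum comp_sumr; apply: eq_bigr => t _.
  by rewrite !compA (ps_mul sP').
rewrite comp_sumr big1// => s ws; rewrite /wsum comp_sumr big1// => t _.
rewrite !compA [P' w ** _](ps_orth_cat sP') ?comp0l ?size_tuple// => e.
by case/eqP: ws; exact/val_inj/esym.
Qed.

Lemma diag_Pr w k : (size w <= k)%N ->
  diag k ** P w = wsum (k - size w) (fun t => P' (w ++ t) ** T ** P (w ++ t)).
Proof.
move=> wk; rewrite /diag -{1}(subnKC wk) wsum_cat {1}/wsum.
rewrite (bigD1 (in_tuple w))//= compDl [X in _ + X = _](_ : _ = 0).
  rewrite addr0 /wsum comp_suml; apply: eq_bigr => t _.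
  by rewrite -!compA (ps_mulr sP).
rewrite comp_suml big1// => s ws; rewrite /wsum comp_suml big1// => t _.
rewrite -!compA [_ ** P w](ps_orth_catr sP) ?comp0r ?size_tuple// => e.
by case/eqP: ws; exact/val_inj/esym.
Qed.

Lemma diag_comm w k : (size w <= k)%N -> P' w ** diag k = diag k ** P w.
Proof. by move=> wk; rewrite diag_Pl// diag_Pr. Qed.

Hypothesis hT : forall a, U' a ** T = T ** U a.

(** Translation by [a] lengthens by one letter the words that do not start with the inverse of [a],
    and shortens the others to words that do not start with [a]. Level [k.+1] is thus carried to
    level [k.+2] inside the cylinder of [a] and to level [k] outside; [0 < k] keeps the shortened
    words nonempty. After averaging the three levels become indistinguishable, so limits intertwine
    the group. *)
Lemma diag_shift a k : (0 < k)%N ->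
  U' a ** diag k.+1 = (P' [:: a] ** diag k.+2 + (op1 H' - P' [:: a]) ** diag k) ** U a.
Proof.
move=> k0; pose F w := P' w ** T ** P w.
have F0 w : ~~ reduced w -> F w = 0 by move=> r; rewrite /F (ps_red sP r) comp0r.
have cj b w : reduced (b :: w) -> w <> [::] -> U' b ** F w = F (b :: w) ** U b.
  move=> r w0; rewrite /F !compA (ps_fwd sP')// -!compA; congr (_ ** _).
  by rewrite !compA hT -!compA (ps_fwd sP).
rewrite diag_Pl//= subn1 /= [(op1 H' - _) ** _]compBl comp1l diag_Pl//= subn1.
have h1 : wsum k (fun t => F [:: a, linv a & t]) = 0.
  by rewrite /wsum big1// => t _; apply: F0; rewrite /= eqxx.
have h2 b : b != linv a -> U' a ** wsum k (fun t => F (b :: t)) =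
    wsum k (fun t => F [:: a, b & t]) ** U a.
  move=> ba; rewrite /wsum comp_suml comp_sumr; apply: eq_bigr => t _.
  have [r|r] := boolP (reduced (b :: t)); first by apply: cj => //; rewrite /= ba.
  by rewrite !F0 ?comp0l ?comp0r//; apply: contra r => /andP[_].
(* Covariance is only given for lengthening a word, so here it is applied to the shortened word with
   the letter [linv a] and then inverted. *)
have h3 : U' a ** wsum k (fun t => F (linv a :: t)) =
    (diag k - wsum k.-1 (fun t => F (a :: t))) ** U a.
  have -> : diag k - wsum k.-1 (fun t => F (a :: t)) =
      \sum_(b | b != a) wsum k.-1 (fun t => F (b :: t)).
    by rewrite /diag -{1}(prednK k0) wsumS (bigD1 a)//= addrAC addrN add0r.
  rewrite -{1}(prednK k0) wsumS comp_sumr (bigD1 a)//= [X in X + _](_ : _ = 0).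
    rewrite add0r comp_suml; apply: eq_bigr => b ba; rewrite /wsum comp_suml comp_sumr.
    apply: eq_bigr => t _.
    have [r|r] := boolP (reduced (b :: t)); last first.
      by rewrite !F0 ?comp0l ?comp0r//; apply: contra r => /andP[_].
    have : U' (linv a) ** F (b :: t) = F [:: linv a, b & t] ** U (linv a).
      by apply: cj => //; rewrite /= linvK ba.
    move=> /(congr1 (fun S => U' a ** S ** U a)).
    have [_ e1] := uU' a; have [_ e2] := uU (linv a); rewrite linvK in e2.
    by rewrite !compA e1 comp1l -!compA e2 comp1r => ->.
  rewrite /wsum comp_sumr big1// => t _; rewrite F0 ?comp0r//=.
  by rewrite linvK eqxx.
rewrite [diag k.+1]wsumS comp_sumr (bigD1 (linv a))//= h3 wsumS [in RHS](bigD1 (linv a))//=.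
rewrite h1 add0r [RHS]compDl addrC; congr (_ + _).
by rewrite comp_suml; apply: eq_bigr => b ba; exact: h2.
Qed.

End Diagonal.

Lemma adj_diag (H H' : hilbertType R) (U : letter I -> op H H) (U' : letter I -> op H' H')
  (P : word -> op H H) (P' : word -> op H' H') (T : op H H') k :
  psystem U P -> psystem U' P' -> adj (diag P P' T k) = diag P' P (adj T) k.
Proof.
move=> sP sP'; rewrite adj_sum; apply: eq_bigr => t _.
by rewrite !adj_comp (ps_adj sP) (ps_adj sP') compA.
Qed.

End Systems.

(** * Slowly varying means and their weak limits *)

Section SlowMeans.
Variable R : realType.
Local Notation C := R[i].

(* Means along such weights do not change asymptotically when the sequence is shifted. *)
Definition slow (c : nat -> nat -> R) : Prop :=
  [/\ forall n i, 0 <= c n i, forall n i, c n i.+1 <= c n i,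
      forall n, c n 0%N <= n.+1%:R^-1 & forall n, \sum_(i < n.+1) c n i <= 1].

Definition smean (V : lmodType C) (c : nat -> nat -> R) (f : nat -> V) n : V :=
  \sum_(i < n.+1) (c n i)%:C%C *: f i.

Lemma slow_uniform : slow (fun n _ => n.+1%:R^-1).
Proof.
split=> // n.
by rewrite sumr_const card_ord -[X in X <= _]mulr_natr mulVf ?pnatr_eq0.
Qed.

(** These weights turn the double sum in [Re_window] into a single mean, see [sum_fejer]. Their
    total is about one half, which is why [slow] bounds the total weight instead of normalizing
    it. *)
Lemma slow_fejer : slow (fun n i => (n.+1 - i)%:R / n.+1%:R ^+ 2).
Proof.
have h n : 0 < n.+1%:R :> R by [].
split=> [n i|n i|n|n].
- by rewrite divr_ge0// exprn_ge0.
- by rewrite ler_pM2r ?invr_gt0 ?exprn_gt0// ler_nat subnS leq_pred.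
- by rewrite subn0 expr2 invfM mulrA mulfV ?mul1r ?gt_eqF.
- rewrite -mulr_suml ler_pdivrMr ?exprn_gt0// mul1r -natr_sum -natrX ler_nat.
  apply: (@leq_trans (\sum_(i < n.+1) n.+1)); first by apply: leq_sum => i _; rewrite leq_subr.
  by rewrite sum_nat_const card_ord.
Qed.

Lemma smean_uniform_cst (V : lmodType C) (x : V) n : smean (fun n _ => n.+1%:R^-1) (fun _ => x) n = x.
Proof.
by rewrite /smean sumr_const card_ord scalerMnl -rmorphMn /= -mulr_natr mulVf ?pnatr_eq0// scale1r.
Qed.

Section OneMean.
Variable c : nat -> nat -> R.
Hypothesis sc : slow c.
Variables H1 H2 : hilbertType R.
Implicit Types f : nat -> op H1 H2.

Lemma bnd_smean f b n : 0 <= b -> (forall i, bnd b (f i)) -> bnd b (smean c f n).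
Proof.
case: sc => c0 _ _ c1 b0 hb; apply: (bndW (c := \sum_(i < n.+1) c n i * b)).
  by rewrite -mulr_suml -[leRHS]mul1r ler_wpM2r.
apply: bnd_sum => i _; rewrite -{1}(ger0_norm (c0 n i)) -nrC; exact: bndZ.
Qed.

(** Summation by parts: as the weights decrease, the coefficients of the difference have total
    modulus twice the first weight. *)
Lemma smean_shift f b n : 0 <= b -> (forall i, bnd b (f i)) ->
  bnd (2 * n.+1%:R^-1 * b) (smean c (fun i => f i.+1) n - smean c f n).
Proof.
case: sc => c0 cm c1 _ b0 hb; rewrite /smean -sumrB.
have abel m : \sum_(i < m) ((c n i)%:C%C *: f i.+1 - (c n i)%:C%C *: f i) =
    (c n m)%:C%C *: f m - (c n 0)%:C%C *: f 0 + \sum_(i < m) (c n i - c n i.+1)%:C%C *: f i.+1.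
  elim: m => [|m IH]; first by rewrite !big_ord0 subrr addr0.
  rewrite !big_ord_recr /= IH rmorphB scalerBl /=.
  move: (\sum_(i < m) _) => S; rewrite [LHS]addrC [LHS]addrA [X in X + _]addrA subrK.
  by rewrite [RHS]addrCA [X in _ = _ + X]addrC [X in _ = _ + X]addrA subrK addrC.
rewrite abel => u.
have bz i j : 0 <= c i j by [].
apply: (@le_trans _ _ ((c n n.+1 * b + c n 0%N * b + \sum_(i < n.+1) (c n i - c n i.+1) * b) * nr u)).
  apply: bndD.
    apply: bndD; last apply: bndN.
      by rewrite -{1}(ger0_norm (c0 n n.+1)) -nrC; exact: bndZ.
    by rewrite -{1}(ger0_norm (c0 n 0%N)) -nrC; exact: bndZ.
  apply: bnd_sum => i _; have h : 0 <= c n i - c n i.+1 by rewrite subr_ge0.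
  by rewrite -{1}(ger0_norm h) -nrC; exact: bndZ.
rewrite ler_wpM2r ?nr_ge0// -mulr_suml -!mulrDl ler_wpM2r//.
have -> : \sum_(i < n.+1) (c n i - c n i.+1) = c n 0%N - c n n.+1.
  elim: n.+1 => [|m IH]; first by rewrite big_ord0 subrr.
  by rewrite big_ord_recr /= IH addrA subrK.
by have := c1 n; move: (_^-1) (c n n.+1) (c n 0%N) => x y z; lra.
Qed.

Lemma smean_compl H3 (W : op H2 H3) f n : W ** smean c f n = smean c (fun i => W ** f i) n.
Proof. by rewrite comp_sumr; apply: eq_bigr => i _; rewrite compZr. Qed.

Lemma smean_compr H3 (W : op H3 H1) f n : smean c f n ** W = smean c (fun i => f i ** W) n.
Proof. by rewrite comp_suml; apply: eq_bigr => i _; rewrite compZl. Qed.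

Lemma smeanD f g n : smean c (fun i => f i + g i) n = smean c f n + smean c g n.
Proof. by rewrite -big_split; apply: eq_bigr => i _; rewrite scalerDr. Qed.

Lemma eq_smean f g n : f =1 g -> smean c f n = smean c g n.
Proof. by move=> fg; apply: eq_bigr => i _; rewrite fg. Qed.

End OneMean.

Section WeakLimits.
Variables (U : set_system nat).
Context {UU : UltraFilter U}.
Hypothesis Uoo : \oo `<=` U.

Lemma ulim_inv (V : normedZmodType C) (a : nat -> V) (b : R) :
  (forall n, nr (a n) <= b * n.+1%:R^-1) -> ulim U a 0.
Proof.
move=> h; apply: ulim_oo => // e e0; have b1 : 0 < 1 + `|b| by rewrite ltr_wpDr.
have [N hN] := natSinv_small (divr_gt0 e0 b1); exists N => n /hN; rewrite subr0 ltr_pdivlMr// => hn.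
apply: le_trans (h n) _; apply: le_trans (ltW hn); rewrite mulrC ler_wpM2l ?invr_ge0//.
by apply: le_trans (ler_norm b) _; rewrite lerDr.
Qed.

Variable c : nat -> nat -> R.
Hypothesis sc : slow c.

Lemma wlim_near (H1 H2 : hilbertType R) (S T : nat -> op H1 H2) L :
  (forall u, ulim U (fun n => (S n - T n) u) 0) -> wlim U T L -> wlim U S L.
Proof.
move=> h hT u v.
have hS : wlim U (fun n => S n - T n + T n) L by rewrite -[L]add0r; exact: wlimD (wlim0 h) hT.
by apply: eq_ulim (hS u v) => n; rewrite subrK.
Qed.

Lemma wlim_smean_shift (H1 H2 : hilbertType R) (f : nat -> op H1 H2) b L N :
  0 <= b -> (forall i, bnd b (f i)) -> wlim U (smean c f) L ->
  wlim U (smean c (fun i => f (i + N)%N)) L.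
Proof.
move=> b0; elim: N f => [|N IH] f hb hL.
  by move=> u v; apply: eq_ulim (hL u v) => n; rewrite (@eq_smean c _ _ _ f n)// => i; rewrite addn0.
have : wlim U (smean c (fun i => f i.+1)) L.
  apply: wlim_near hL => u; apply: (@ulim_inv _ _ (2 * b * nr u)) => n.
  by apply: le_trans (smean_shift sc n b0 hb u) _; rewrite [X in X <= _](_ : _ = 2 * b * nr u * n.+1%:R^-1)//; ring.
move=> /(IH (fun i => f i.+1) (fun i => hb i.+1)) h u v; apply: eq_ulim (h u v) => n.
by rewrite (@eq_smean c _ _ _ (fun i => f (i + N.+1)%N) n)// => i; rewrite addnS.
Qed.

Variable I : finType.
Variables H H' : hilbertType R.
Variables (W : letter I -> op H H) (W' : letter I -> op H' H').
Hypothesis uW : unitary_letters W.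
Hypothesis uW' : unitary_letters W'.
Variables (P : seq (letter I) -> op H H) (P' : seq (letter I) -> op H' H').
Hypothesis sP : psystem W P.
Hypothesis sP' : psystem W' P'.
Variable T : op H H'.
Hypothesis hT : forall a, W' a ** T = T ** W a.

(** Shifting the sequence does not change the limit. Far enough out [diag_comm] holds for the given
    [w], and the three levels in [diag_shift] share one limit, so the two complementary parts
    recombine. *)
Lemma smean_diag_intertwines s S :
  wlim U (smean c (fun i => diag P P' T (i + s)%N)) S ->
  (forall w, P' w ** S = S ** P w) /\ (forall a, W' a ** S = S ** W a).
Proof.
have [b b0 hb] := bnd_ex T.
have hd i : bnd b (diag P P' T (i + s)%N) by exact: (bnd_diag sP sP').
move=> hS; have sh N := wlim_smean_shift N b0 hd hS.
split=> [w|a].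
  apply: (wlim_unique (wlim_compl (P' w) (sh (size w)))) => u v.
  apply: eq_ulim (wlim_compr (P w) (sh (size w)) u v) => n.
  rewrite smean_compl smean_compr (@eq_smean c _ _ _ (fun i => P' w ** diag P P' T (i + size w + s))) // => i.
  by rewrite (diag_comm sP sP')// addnAC leq_addl.
have -> : S ** W a = (P' [:: a] ** S + (op1 H' - P' [:: a]) ** S) ** W a.
  by rewrite -compDl addrC subrK comp1l.
(* The shifts 2, 3 and 1 are the levels [k.+1], [k.+2] and [k] of [diag_shift] for [k = i + 1 + s],
   which is positive. *)
apply: (wlim_unique (wlim_compl (W' a) (sh 2%N))) => u v.
apply: eq_ulim (wlim_compr (W a) (wlimD (wlim_compl (P' [:: a]) (sh 3)) (wlim_compl (op1 H' - P' [:: a]) (sh 1%N))) u v) => n.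
congr (inner _ v); congr (opf _ u); rewrite !smean_compl -smeanD smean_compr.
apply: eq_smean => i; have := diag_shift uW uW' sP sP' hT a (k := (i + 1 + s)%N).
by rewrite addn1 => /(_ isT); rewrite -!addSn !addn2 !addn3 => ->.
Qed.

End WeakLimits.
End SlowMeans.

(** * The Hilbert-Schmidt pairing *)

Section HilbertSchmidt.
Variables (R : realType) (H : hilbertType R).
Local Notation C := R[i].
Implicit Types (S T M : op H H) (e : nat -> H).

(* Zeros are allowed, so that finite bases are sequences as well. *)
Record onbasis e : Prop := ONBasis {
  onb_orth : forall i j, i <> j -> inner (e i) (e j) = 0 ;
  onb_unit : forall i, e i = 0 \/ inner (e i) (e i) = 1 ;
  onb_dense : forall u (d : R), 0 < d ->
    exists m (a : nat -> C), nr (u - \sum_(i < m) a i *: e i) <= d }.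

Definition hsb e (c : R) S : Prop := forall m, \sum_(i < m) nr (S (e i)) ^+ 2 <= c.

Section Parseval.
Variable e : nat -> H.
Hypothesis he : onbasis e.

Let proj m u := \sum_(i < m) inner u (e i) *: e i.

Let inner_proj m u (j : 'I_m) : inner (proj m u) (e j) = inner u (e j).
Proof.
rewrite inner_suml (bigD1 j)//= big1 ?addr0 => [|i ij].
  rewrite innerZl; have [->|->] := onb_unit he j; last by rewrite mulr1.
  by rewrite !inner0r mul0r.
by rewrite innerZl onb_orth ?mulr0// => e1; case/eqP: ij; exact: val_inj.
Qed.

Let proj_orth m u (a : nat -> C) :
  inner (u - proj m u) (\sum_(i < m) a i *: e i) = 0.
Proof.
rewrite inner_sumr big1// => i _.
by rewrite innerZr innerBl inner_proj subrr mulr0.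
Qed.

Let nr_proj m u : nr (proj m u) ^+ 2 = \sum_(i < m) nr (inner u (e i)) ^+ 2.
Proof.
rewrite -Re_inner_nr inner_sumr (eq_bigr (fun i : 'I_m => (nr (inner u (e i)) ^+ 2)%:C%C)).
  by rewrite -rmorph_sum.
by move=> i _; rewrite innerZr inner_proj mulrC nr_sqr.
Qed.

Let pyth m u : nr u ^+ 2 = nr (u - proj m u) ^+ 2 + \sum_(i < m) nr (inner u (e i)) ^+ 2.
Proof. by rewrite -nr_proj -{1}[u](subrK (proj m u)) nrD_sqr
  (proj_orth m u (fun i => inner u (e i))) mul0rn addr0. Qed.

Lemma onb_bessel m u : \sum_(i < m) nr (inner u (e i)) ^+ 2 <= nr u ^+ 2.
Proof. by rewrite (pyth m u) lerDr sqr_ge0. Qed.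

Lemma onb_parseval u (d : R) : 0 < d ->
  exists m, nr u ^+ 2 <= d + \sum_(i < m) nr (inner u (e i)) ^+ 2.
Proof.
move=> d0; have s0 : 0 < Num.sqrt d by rewrite sqrtr_gt0.
have [m [a ha]] := onb_dense he u s0; exists m; rewrite (pyth m u) lerD2r.
have -> : d = Num.sqrt d ^+ 2 by rewrite sqr_sqrtr// ltW.
apply: (@le_trans _ _ (nr (u - \sum_(i < m) a i *: e i) ^+ 2)); last first.
  by rewrite ler_pXn2r// ?nnegrE ?nr_ge0// ltW.
have -> : u - \sum_(i < m) a i *: e i = (u - proj m u) + (proj m u - \sum_(i < m) a i *: e i).
  by rewrite addrA subrK.
rewrite [leRHS]nrD_sqr.
rewrite (_ : inner (u - proj m u) _ = 0) ?mul0rn ?addr0 ?lerDl ?sqr_ge0//.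
by rewrite innerBr proj_orth subr0 /proj (proj_orth m u (fun i => inner u (e i))).
Qed.

End Parseval.

(** Parseval on one side, exchange of the double sum of the squared matrix entries, Bessel on the
    other; the error [d] pays for cutting off the Parseval sums. With two bases allowed, applying
    the lemma twice also changes the basis. *)
Lemma hsb_adj e e' c S : onbasis e -> onbasis e' -> hsb e c S -> hsb e' c (adj S).
Proof.
move=> he he' hS m.
have h (d : R) : 0 < d -> exists k, \sum_(j < m) nr (adj S (e' j)) ^+ 2 <=
    m%:R * d + \sum_(j < m) \sum_(i < k) nr (inner (adj S (e' j)) (e i)) ^+ 2.
  move=> d0; elim: m => [|m [k IH]].
    by exists 0%N; rewrite !big_ord0 mul0r addr0.
  have [k' hk'] := onb_parseval he (adj S (e' m)) d0.
  have mono (u : H) p q : (p <= q)%N ->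
      \sum_(i < p) nr (inner u (e i)) ^+ 2 <= \sum_(i < q) nr (inner u (e i)) ^+ 2.
    move=> pq; rewrite -(subnKC pq) big_split_ord /= lerDl.
    by apply: sumr_ge0 => i _; rewrite sqr_ge0.
  exists (maxn k k'); rewrite !big_ord_recr /= -natr1 mulrDl mul1r addrACA.
  apply: lerD; last by apply: le_trans hk' _; rewrite lerD2l mono// leq_maxr.
  apply: le_trans IH _; rewrite lerD2l; apply: ler_sum => j _.
  by rewrite mono// leq_maxl.
apply/ler_addgt0Pl => d d0.
have m1 : 0 < 1 + m%:R :> R by rewrite ltr_wpDr.
have [k hk] := h _ (divr_gt0 d0 m1); apply: le_trans hk _; apply: lerD.
  by rewrite mulrCA ler_piMr ?(ltW d0)// ler_pdivrMr// mul1r lerDr.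
rewrite exchange_big /=; apply: le_trans (hS k); apply: ler_sum => i _.
apply: le_trans (onb_bessel he' m _); apply: ler_sum => j _.
by rewrite adjE' innerC nr_conj.
Qed.

Variables (U : set_system nat).
Context {UU : UltraFilter U}.
Hypothesis Uoo : \oo `<=` U.
Variable e : nat -> H.
Hypothesis he : onbasis e.

Definition isHS S : Prop := exists c, hsb e c S.

(* The limit exists when [S] and [T] are Hilbert-Schmidt, see [hsP]; otherwise the value is arbitrary. *)
Definition hs S T : C := xget 0 [set l | ulim U (fun m => \sum_(i < m) inner (S (e i)) (T (e i))) l].

Lemma isHS_adj S : isHS S -> isHS (adj S).
Proof. by move=> [c hc]; exists c; exact: hsb_adj hc. Qed.

Lemma isHS_compl M S : isHS S -> isHS (M ** S).
Proof.
have [d d0 hd] := bnd_ex M; move=> [c hc]; exists (d ^+ 2 * c) => m.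
apply: le_trans (ler_wpM2l (sqr_ge0 d) (hc m)); rewrite mulr_sumr.
by apply: ler_sum => i _; rewrite -exprMn ler_pXn2r ?nnegrE ?mulr_ge0 ?nr_ge0//; exact: hd.
Qed.

Lemma isHS_compr M S : isHS S -> isHS (S ** M).
Proof.
by move=> /isHS_adj/(isHS_compl (adj M))/isHS_adj; rewrite adj_comp !adjK.
Qed.

Lemma isHS_Z a S : isHS S -> isHS (a *: S).
Proof. by move=> /(isHS_compl (a *: op1 H)); rewrite compZl comp1l. Qed.

Lemma isHS_D S T : isHS S -> isHS T -> isHS (S + T).
Proof.
move=> [c hc] [d hd]; exists (2 * c + 2 * d) => m.
apply: le_trans (lerD (ler_wpM2l _ (hc m)) (ler_wpM2l _ (hd m))) => //.
rewrite !mulr_sumr -big_split /=; apply: ler_sum => i _.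
have h : nr ((S + T) (e i)) ^+ 2 <= (nr (S (e i)) + nr (T (e i))) ^+ 2.
  by rewrite ler_pXn2r// ?nnegrE ?addr_ge0 ?nr_ge0// nrD.
by apply: le_trans h _; have := sqr_ge0 (nr (S (e i)) - nr (T (e i))); lra.
Qed.

Lemma isHS_0 : isHS 0.
Proof. by exists 0 => m; rewrite big1// => i _; rewrite op0 nr0 expr0n. Qed.

Lemma isHS_sum (J : Type) (r : seq J) (F : J -> op H H) :
  (forall j, isHS (F j)) -> isHS (\sum_(j <- r) F j).
Proof.
by move=> h; elim/big_rec: _ => [|j S _ hS]; [exact: isHS_0|exact: isHS_D].
Qed.

Lemma isHS_N S : isHS S -> isHS (- S).
Proof. by rewrite -scaleN1r; exact: isHS_Z. Qed.

Lemma hsP S T : isHS S -> isHS T ->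
  ulim U (fun m => \sum_(i < m) inner (S (e i)) (T (e i))) (hs S T).
Proof.
move=> [c hc] [d hd]; have [|l hl] := @ulim_ex R U _ (fun m => \sum_(i < m) inner (S (e i)) (T (e i))) (c + d).
  move=> m; apply: le_trans (nr_sum _ _ _) _.
  apply: le_trans (lerD (hc m) (hd m)); rewrite -big_split /=; apply: ler_sum => i _.
  apply: le_trans (CS _ _) _; have := sqr_ge0 (nr (S (e i)) - nr (T (e i))).
  by have := sqr_ge0 (nr (S (e i)) + nr (T (e i))); lra.
exact: (xgetI _ hl).
Qed.

Lemma hs_conj S T : isHS S -> isHS T -> hs T S = (hs S T)^*.
Proof.
move=> hS hT; apply: (ulim_unique (hsP hT hS)); apply: eq_ulim (ulim_conj (hsP hS hT)) => m.
by rewrite rmorph_sum; apply: eq_bigr => i _; rewrite [RHS]innerC.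
Qed.

Lemma hsDl S S' T : isHS S -> isHS S' -> isHS T -> hs (S + S') T = hs S T + hs S' T.
Proof.
move=> hS hS' hT; apply: (ulim_unique (hsP (isHS_D hS hS') hT)).
apply: eq_ulim (ulimD (hsP hS hT) (hsP hS' hT)) => m.
by rewrite -big_split; apply: eq_bigr => i _; rewrite opD innerDl.
Qed.

Lemma hsZl a S T : isHS S -> isHS T -> hs (a *: S) T = a * hs S T.
Proof.
move=> hS hT; apply: (ulim_unique (hsP (isHS_Z a hS) hT)).
apply: eq_ulim (ulimM a (hsP hS hT)) => m.
by rewrite mulr_sumr; apply: eq_bigr => i _; rewrite opZ innerZl.
Qed.

Lemma hsDr S T T' : isHS S -> isHS T -> isHS T' -> hs S (T + T') = hs S T + hs S T'.
Proof.
move=> hS hT hT'; rewrite (hs_conj (isHS_D hT hT') hS) hsDl// rmorphD /=.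
by rewrite -!hs_conj.
Qed.

Lemma hsZr a S T : isHS S -> isHS T -> hs S (a *: T) = a^* * hs S T.
Proof.
by move=> hS hT; rewrite (hs_conj (isHS_Z a hT) hS) hsZl// rmorphM /= -hs_conj.
Qed.

Lemma hsNl S T : isHS S -> isHS T -> hs (- S) T = - hs S T.
Proof. by move=> hS hT; rewrite -scaleN1r hsZl// mulN1r. Qed.

Lemma hsBl S S' T : isHS S -> isHS S' -> isHS T -> hs (S - S') T = hs S T - hs S' T.
Proof. by move=> hS hS' hT; rewrite hsDl ?hsNl//; exact: isHS_N. Qed.

Lemma hs0l T : isHS T -> hs 0 T = 0.
Proof. by move=> hT; rewrite -[X in hs X]/(0 : op H H) -(scale0r (0 : op H H)) hsZl ?mul0r//; exact: isHS_0. Qed.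

Lemma hs_suml (J : Type) (r : seq J) (F : J -> op H H) T :
  (forall j, isHS (F j)) -> isHS T ->
  hs (\sum_(j <- r) F j) T = \sum_(j <- r) hs (F j) T.
Proof.
move=> hF hT; elim: r => [|j r IH]; first by rewrite !big_nil hs0l.
by rewrite !big_cons hsDl ?IH//; exact: isHS_sum.
Qed.

Lemma hs_sumr (J : Type) (r : seq J) (F : J -> op H H) T :
  (forall j, isHS (F j)) -> isHS T ->
  hs T (\sum_(j <- r) F j) = \sum_(j <- r) hs T (F j).
Proof.
move=> hF hT; rewrite hs_conj ?hs_suml ?rmorph_sum//=; last exact: isHS_sum.
by apply: eq_bigr => j _; rewrite -hs_conj.
Qed.

Lemma hs_move M S T : hs (M ** S) T = hs S (adj M ** T).
Proof.
rewrite /hs; have -> // : (fun m => \sum_(i < m) inner ((M ** S) (e i)) (T (e i))) =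
  (fun m => \sum_(i < m) inner (S (e i)) ((adj M ** T) (e i))).
by apply/funext => m; apply: eq_bigr => i _; rewrite !compE adjE.
Qed.

Lemma hs_real S : isHS S -> hs S S = (complex.Re (hs S S))%:C%C.
Proof.
move=> hS; have := hs_conj hS hS; case: (hs S S) => x y /eqP; rewrite eq_complex /= => /andP[_].
by rewrite -addr_eq0 -mulr2n mulrn_eq0 /= => /eqP ->.
Qed.

Opaque hs.

Let Re_partial S m : complex.Re (\sum_(i < m) inner (S (e i)) (S (e i))) =
  \sum_(i < m) nr (S (e i)) ^+ 2.
Proof.
elim: m => [|m IH]; first by rewrite !big_ord0.
by rewrite !big_ord_recr /= ReD IH Re_inner_nr.
Qed.

Lemma hsb_Re S : isHS S -> hsb e (complex.Re (hs S S)) S.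
Proof.
move=> hS m; rewrite -Re_partial -subr_ge0 -ReN -ReD.
apply: (ulim_Re_ge0 (ulimB (hsP hS hS) (ulim_cst _))); apply: Uoo; exists m => // k /= mk.
rewrite ReD ReN !Re_partial subr_ge0 -(subnKC mk) big_split_ord /= lerDl.
by apply: sumr_ge0 => i _; rewrite sqr_ge0.
Qed.

Lemma Re_hs_le c S : hsb e c S -> complex.Re (hs S S) <= c.
Proof.
move=> hc; have hS : isHS S by exists c.
rewrite -[c]/(complex.Re c%:C%C) -subr_ge0 -ReN -ReD.
apply: (ulim_Re_ge0 (ulimB (ulim_cst _) (hsP hS hS))); apply: filterE => m /=.
by rewrite ReD ReN Re_partial subr_ge0.
Qed.

Lemma Re_hs_ge0 S : isHS S -> 0 <= complex.Re (hs S S).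
Proof. by move=> /hsb_Re/(_ 0%N); rewrite big_ord0. Qed.

(** This is the cyclicity of the trace. For equal arguments it follows from [hsb_adj] in both
    directions; polarization with the coefficients [1] and ['i] gives the rest. *)
Lemma hs_adj S T : isHS S -> isHS T -> hs (adj T) (adj S) = hs S T.
Proof.
have diag W : isHS W -> hs (adj W) (adj W) = hs W W.
  move=> hW; have hW' := isHS_adj hW; rewrite (hs_real hW') (hs_real hW).
  suff -> : complex.Re (hs (adj W) (adj W)) = complex.Re (hs W W) by [].
  apply/eqP; rewrite eq_le; apply/andP; split; apply: Re_hs_le.
    exact: hsb_adj he he (hsb_Re hW).
  by have := hsb_adj he he (hsb_Re hW'); rewrite adjK.
have quad a W W' : isHS W -> isHS W' -> hs (W + a *: W') (W + a *: W') =
    hs W W + a^* * hs W W' + (a * hs W' W + a * (a^* * hs W' W')).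
  move=> hW hW'; have hZ := isHS_Z a hW'; have hD := isHS_D hW hZ.
  by rewrite (hsDl hW hZ hD) !(hsDr _ hW hZ)// !(hsZr a _ hW')// !(hsZl a hW')// [a^* * (a * _)]mulrCA.
move=> hS hT; have hS' := isHS_adj hS; have hT' := isHS_adj hT.
have key a : a^* * hs (adj T) (adj S) + a * hs (adj S) (adj T) = a * hs T S + a^* * hs S T.
  have := diag _ (isHS_D hT (isHS_Z a^* hS)).
  rewrite adjD adjZ conjCK (quad _ _ _ hT' hS') (quad _ _ _ hT hS) conjCK (diag _ hT) (diag _ hS).
  move: (hs T T) (hs S S) (hs (adj S) (adj T)) (hs (adj T) (adj S)) (hs S T) (hs T S) => p q x y z w h.
  apply: (addrI p); apply: (addIr (a * (a^* * q))); rewrite !addrA -[LHS]addrA h (mulrCA a).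
  by rewrite !addrA.
have ii : 'i%C^* = - 'i%C :> C by apply/eqP; rewrite eq_complex /= oppr0 !eqxx.
have := key 1; have := key 'i%C; rewrite ii rmorph1.
move: (hs (adj S) (adj T)) (hs (adj T) (adj S)) (hs S T) (hs T S) => x y z w h2 h1.
have i0 : 'i%C != 0 :> C by rewrite eq_complex /= oner_eq0 andbF.
have h3 : x - y = w - z.
  by apply: (mulfI i0); rewrite !mulrBr addrC -!mulNr h2.
have : y *+ 2 = z *+ 2.
  rewrite (_ : y *+ 2 = (1 * y + 1 * x) - (x - y)); last by ring.
  by rewrite h1 h3; ring.
by rewrite -[y *+ 2]mulr_natr -[z *+ 2]mulr_natr => /mulIf; apply; rewrite pnatr_eq0.
Qed.

Lemma hs_eq0 S : isHS S -> hs S S = 0 -> S = 0.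
Proof.
move=> hS h; have h0 i : S (e i) = 0.
  apply/eqP; rewrite -nr_eq0 -sqrf_eq0 eq_le sqr_ge0 andbT.
  have := hsb_Re hS i.+1; rewrite h big_ord_recr /=; apply: le_trans.
  by rewrite lerDr sumr_ge0// => j _; rewrite sqr_ge0.
apply: opP => u; rewrite op0; apply: nr_small0 => d d0.
have [c c0 hc] := bnd_ex S; have c1 : 0 < 1 + c by rewrite ltr_wpDr.
have [m [a ha]] := onb_dense he u (divr_gt0 d0 c1).
have -> : S u = S (u - \sum_(i < m) a i *: e i).
  by rewrite opBr op_sumr big1 ?subr0// => i _; rewrite opZr h0 scaler0.
apply: le_trans (hc _) _; move: ha; rewrite ler_pdivlMr//.
by have := nr_ge0 (u - \sum_(i < m) a i *: e i); lra.
Qed.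

Lemma nr_hs_le S i : isHS S -> nr (S (e i)) ^+ 2 <= complex.Re (hs S S).
Proof.
move=> hS; apply: le_trans (hsb_Re hS i.+1); rewrite big_ord_recr /= lerDr.
by apply: sumr_ge0 => j _; rewrite sqr_ge0.
Qed.

Let split_sum (V : zmodType) (F : nat -> V) k m : (k <= m)%N ->
  \sum_(i < m) F i = \sum_(i < k) F i + \sum_(k <= i < m) F i.
Proof. by move=> km; rewrite -!(big_mkord xpredT F); exact: big_cat_nat. Qed.

(** Weak convergence handles finitely many basis vectors; the tails of [S] and [T] are small and the
    [M n] are uniformly bounded. *)
Lemma hs_wlim (M : nat -> op H H) L S T c : 0 <= c -> (forall n, bnd c (M n)) ->
  wlim U M L -> isHS S -> isHS T -> ulim U (fun n => hs (M n ** S) T) (hs (L ** S) T).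
Proof.
move=> c0 hM hL hS hT d d0.
have tail W : isHS W -> forall r : R, 0 < r -> exists k, forall m, (k <= m)%N ->
    \sum_(k <= i < m) nr (W (e i)) ^+ 2 <= r.
  move=> [b hb] r r0; pose E := [set \sum_(i < m) nr (W (e i)) ^+ 2 | m in [set: nat]].
  have hsE : has_sup E.
    by split; [exists (\sum_(i < 0) nr (W (e i)) ^+ 2), 0%N|exists b => _ [m _ <-]].
  have [_ [k _ <-] hk] := sup_adherent r0 hsE; exists k => m km.
  have : \sum_(i < m) nr (W (e i)) ^+ 2 <= sup E by apply: sup_upper_bound => //; exists m.
  rewrite (split_sum (fun i => nr (W (e i)) ^+ 2) km).
  by move: hk; move: (\sum_(i < k) _) (\sum_(_ <= i < _) _) (sup E) => x y z; lra.
have cut (W : op H H) : bnd c W -> forall r : R, 0 < r -> forall k,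
    (forall m, (k <= m)%N -> \sum_(k <= i < m) nr (S (e i)) ^+ 2 <= r) ->
    (forall m, (k <= m)%N -> \sum_(k <= i < m) nr (T (e i)) ^+ 2 <= r) ->
    nr (hs (W ** S) T - \sum_(i < k) inner (W (S (e i))) (T (e i))) <= c * r.
  move=> hW r r0 k hk1 hk2.
  apply: (ulim_le_near (ulimB (hsP (isHS_compl W hS) hT) (ulim_cst _))).
  apply: Uoo; exists k => // m /= km.
  rewrite (split_sum (fun i => inner (W (S (e i))) (T (e i))) km).
  rewrite addrC addKr; apply: le_trans (nr_sum _ _ _) _.
  apply: (@le_trans _ _ (c * \sum_(k <= i < m) (nr (S (e i)) ^+ 2 / 2 + nr (T (e i)) ^+ 2 / 2))).
    rewrite mulr_sumr; apply: ler_sum => i _; apply: le_trans (CS _ _) _.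
    apply: le_trans (ler_wpM2r (nr_ge0 _) (hW _)) _; rewrite -mulrA ler_wpM2l//.
    by have := sqr_ge0 (nr (S (e i)) - nr (T (e i))); lra.
  rewrite ler_wpM2l// big_split /= -!mulr_suml.
  by have := hk1 m km; have := hk2 m km; lra.
have bL : bnd c L by exact: wlim_bnd hM hL.
have c1 : 0 < 1 + c by rewrite ltr_wpDr.
(* Each of the two tails then costs at most [d / 4], leaving [d / 2] for the finite part; [1 + c]
   cannot vanish. *)
pose r := d / (4 * (1 + c)).
have r0 : 0 < r by rewrite divr_gt0// mulr_gt0.
have cr : c * r <= d / 4.
  have -> : c * r = d / 4 * (c / (1 + c)) by rewrite /r invfM; ring.
  rewrite -[leRHS]mulr1 ler_wpM2l ?divr_ge0 ?(ltW d0)//.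
  by rewrite ler_pdivrMr// mul1r lerDr.
have [k1 hk1] := tail S hS r r0; have [k2 hk2] := tail T hT r r0.
pose k := maxn k1 k2.
have h1 m : (k <= m)%N -> \sum_(k <= i < m) nr (S (e i)) ^+ 2 <= r.
  move=> km; apply: le_trans (hk1 m (leq_trans (leq_maxl _ _) km)).
  rewrite [leRHS](big_cat_nat (n := k))//= ?leq_maxl// lerDr.
  by apply: sumr_ge0 => i _; rewrite sqr_ge0.
have h2 m : (k <= m)%N -> \sum_(k <= i < m) nr (T (e i)) ^+ 2 <= r.
  move=> km; apply: le_trans (hk2 m (leq_trans (leq_maxr _ _) km)).
  rewrite [leRHS](big_cat_nat (n := k))//= ?leq_maxr// lerDr.
  by apply: sumr_ge0 => i _; rewrite sqr_ge0.
have fin : ulim U (fun n => \sum_(i < k) inner (M n (S (e i))) (T (e i)))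
    (\sum_(i < k) inner (L (S (e i))) (T (e i))) by apply: ulim_sum => i _; exact: hL.
apply: filterS (fin _ (divr_gt0 d0 (ltr0Sn R 1))) => n /= hn.
have a1 := cut (M n) (hM n) r r0 k h1 h2; have a2 := cut L bL r r0 k h1 h2.
move: a1 a2 hn; move: (hs (M n ** S) T) (hs (L ** S) T) => x y.
move: (\sum_(i < k) _) (\sum_(i < k) _) => q p a1 a2 hn.
have := nr_triB p q y; rewrite (nrB q y) => t2; have := nr_triB x p y.
move: a1 a2 hn t2 cr; move: (nr (x - p)) (nr (y - q)) (nr (p - q)) (nr (p - y)) (nr (x - y)) (c * r).
by clear -R; move=> *; lra.
Qed.

End HilbertSchmidt.

(** * Intertwiners of systems *)

Section Commutants.
Variables (R : realType) (I : finType) (H : hilbertType R).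
Local Notation C := R[i].
Local Notation word := (seq (letter I)).
Variable W : letter I -> op H H.
Hypothesis uW : unitary_letters W.

Definition sys_irreducible (P : word -> op H H) : Prop :=
  forall V : set H, linear_subspace V -> closed V ->
    (forall a u, V u -> V (W a u)) -> (forall w u, V u -> V (P w u)) ->
    V = [set 0] \/ V = setT.

Lemma comm_adj (Z : op H H) : (forall a, W a ** Z = Z ** W a) ->
  forall a, W a ** adj Z = adj Z ** W a.
Proof.
by move=> h a; rewrite (adj_intertwiner uW uW h).
Qed.

Lemma sys_schur_selfadj (P : word -> op H H) T : sys_irreducible P ->
  adj T = T -> (forall a, W a ** T = T ** W a) -> (forall w, P w ** T = T ** P w) ->
  exists c : R, T = c%:C%C *: op1 H.
Proof.
move=> irr aT hW hP.
apply: (@schur_selfadj _ _ [set S | (exists a, S = W a) \/ (exists w, S = P w)]) => //.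
  by move=> V lV cV h; apply: irr => // [a|w] u Vu; apply: h => //; [left; exists a|right; exists w].
by move=> S [[a ->]|[w ->]].
Qed.

Lemma adj_comp_ge0 (H' : hilbertType R) (Z : op H H') c :
  adj Z ** Z = c%:C%C *: op1 H -> forall u, nr (Z u) ^+ 2 = c * nr u ^+ 2.
Proof.
move=> h u; rewrite -!Re_inner_nr adjE -compE h opZ innerC innerZl rmorphM /=.
by rewrite conjR ReZ Re_conj.
Qed.

(** By Schur's lemma [adj Z ** Z] and [Z ** adj Z] are scalars, so a nonzero [Z] could be rescaled
    to a unitary equivalence, which the hypothesis on [J] excludes. *)
Lemma sys_intertwiner0 (P Q : word -> op H H) (Z : op H H) : psystem W P -> psystem W Q ->
  sys_irreducible P -> sys_irreducible Q ->
  (forall J : op H H, adj J ** J = op1 H -> J ** adj J = op1 H ->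
    (forall a, W a ** J = J ** W a) -> (forall w, P w ** J = J ** Q w) -> False) ->
  (forall a, W a ** Z = Z ** W a) -> (forall w, P w ** Z = Z ** Q w) -> Z = 0.
Proof.
move=> sP sQ iP iQ ineq hW hZ.
have hW' := comm_adj hW.
have hZ' w : Q w ** adj Z = adj Z ** P w.
  by have := congr1 (@adj _ _ _) (hZ w); rewrite !adj_comp (ps_adj sP) (ps_adj sQ) => ->.
have [||a|w|c hc] := @sys_schur_selfadj Q (adj Z ** Z) => //.
- by rewrite adj_comp adjK.
- by rewrite compA hW' -!compA hW.
- by rewrite compA hZ' -!compA hZ.
have [||a|w|d hd] := @sys_schur_selfadj P (Z ** adj Z) => //.
- by rewrite adj_comp adjK.
- by rewrite compA hW -!compA hW'.
- by rewrite compA hZ -!compA hZ'.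
have [->//|Z0] := pselect (Z = 0); exfalso.
have [u u0] : exists u, Z u <> 0.
  by apply/existsNP => h; apply: Z0; apply: opP => u; rewrite h.
(* Both scalars are read off from [Z ** adj Z ** Z], at a vector that [Z] does not kill. *)
have cd : c = d.
  have := compA Z (adj Z) Z; rewrite hc hd compZr compZl comp1l comp1r => /(congr1 (fun S : op H H => S u)).
  rewrite !opZ => /eqP; rewrite -subr_eq0 -scalerBl -rmorphB scaler_eq0 => /orP[|/eqP//].
  by rewrite -nr_eq0 nrC normr_eq0 subr_eq0 => /eqP.
have c0 : 0 < c.
  have h := adj_comp_ge0 hc u.
  have : 0 < nr (Z u) ^+ 2 by rewrite exprn_gt0// lt0r nr_ge0 nr_eq0 andbT; exact/eqP.
  rewrite h => h'; rewrite ltNge; apply/negP => c0.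
  by have := mulr_le0_ge0 c0 (sqr_ge0 (nr u)); rewrite leNgt h'.
pose s := (Num.sqrt c)^-1.
have ss : s * s * c = 1 by rewrite /s -invfM -expr2 sqr_sqrtr ?(ltW c0)// mulVf ?gt_eqF.
have sc : s%:C%C * s%:C%C * c%:C%C = 1 :> C by rewrite -!rmorphM ss.
apply: (ineq (s%:C%C *: Z)).
- by rewrite adjZ conjR compZl compZr hc !scalerA sc scale1r.
- by rewrite adjZ conjR compZl compZr hd -cd !scalerA sc scale1r.
- by move=> a; rewrite compZr compZl hW.
- by move=> w; rewrite compZr compZl hZ.
Qed.

End Commutants.

(** * Conjugating cylinder projections by group elements *)

Section Conjugation.
Variables (R : realType) (I : finType) (H : hilbertType R).
Local Notation word := (seq (letter I)).
Variable W : letter I -> op H H.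
Hypothesis uW : unitary_letters W.
Variable P : word -> op H H.
Hypothesis sP : psystem W P.

Lemma ps_compl a : op1 H - P [:: a] = \sum_(b | b != a) P [:: b].
Proof. by rewrite -(ps1 sP) -(ps_sum sP [::]) (bigD1 a)//= addrAC addrN add0r. Qed.

Lemma ps_compl_mul a w : (op1 H - P [:: a]) ** P w =
  if w is b :: _ then (if b == a then 0 else P w) else op1 H - P [:: a].
Proof.
case: w => [|b w]; first by rewrite (ps1 sP) comp1r.
rewrite compBl comp1l; case: eqP => [->|ba].
  by rewrite (ps_mul sP [:: a] w) subrr.
by rewrite (ps_orth_cat sP (w := [:: a]) (x := [:: b]) w) ?subr0// => -[e]; apply: ba.
Qed.

Lemma adj_ps_compl a : adj (op1 H - P [:: a]) = op1 H - P [:: a].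
Proof. by rewrite adjB adj1 (ps_adj sP). Qed.

Lemma ps_compl_idem a : (op1 H - P [:: a]) ** (op1 H - P [:: a]) = op1 H - P [:: a].
Proof. by rewrite compBr comp1r ps_compl_mul eqxx subr0. Qed.

Lemma ps_mul_compl a w : P w ** (op1 H - P [:: a]) =
  if w is b :: _ then (if b == a then 0 else P w) else op1 H - P [:: a].
Proof.
apply: (can_inj (@adjK _ _ _)); rewrite adj_comp adj_ps_compl (ps_adj sP) ps_compl_mul.
by case: w => [|b w]; [rewrite adj_ps_compl|case: ifP; rewrite ?adj0 ?(ps_adj sP)].
Qed.

(** The complement on the right removes the words [w] that start with the inverse of [c]. For these
    the concatenation is not reduced and the left side vanishes too, so no condition on [w]
    remains. *)
Lemma ps_conj x c w : reduced (rcons x c) ->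
  P (rcons x c ++ w) ** Uw W (rcons x c) =
  Uw W (rcons x c) ** ((op1 H - P [:: linv c]) ** P w).
Proof.
move=> r; rewrite ps_compl_mul; case: w => [|b w].
  by rewrite cats0; exact: ps_Uw_back.
have [r'|r'] := boolP (reduced (rcons x c ++ b :: w)).
  have -> : (b == linv c) = false.
    apply/negbTE; move: r'; rewrite /reduced -cats1 -catA /= -cat_rcons.
    case: x {r} => [|d x] /=; first by case/andP.
    by rewrite cat_path => /andP[_]; rewrite last_rcons => /= /andP[].
  by rewrite (ps_Uw_fwd sP).
rewrite (ps_red sP r') comp0l; case: eqP => [_|bc]; first by rewrite comp0r.
suff r2 : ~~ reduced (b :: w) by rewrite (ps_red sP r2) comp0r.
apply: contra r' => r2; move: r; rewrite /reduced.
case: x => [|d x] /=; first by move=> _; move/eqP: bc => ->.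
by rewrite cat_path last_rcons => -> /=; move/eqP: bc => -> /=.
Qed.

Lemma ps_conjV x a : reduced (rcons (winv x) a) ->
  P [:: a] ** Uw W x = Uw W x ** P (rcons (winv x) a).
Proof.
rewrite -cats1 => r; have := ps_Uw_fwd sP r (fun e => ltac:(discriminate e)).
move=> /(congr1 (fun S => Uw W x ** S ** Uw W x)).
by rewrite !compA (UwV uW) comp1l -!compA (UwVl uW) comp1r => ->.
Qed.

End Conjugation.

(** * Strong decay of diagonal means *)

Opaque op_comp adj hs.

Section StrongMean.
Variables (R : realType) (I : finType) (H : hilbertType R).
Local Notation C := R[i].
Local Notation word := (seq (letter I)).
Variable W : letter I -> op H H.
Hypothesis uW : unitary_letters W.
Variables P Q : word -> op H H.
Hypothesis sP : psystem W P.
Hypothesis sQ : psystem W Q.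
Variable U : set_system nat.
Context {UU : UltraFilter U}.
Hypothesis Uoo : \oo `<=` U.
Variable e : nat -> H.
Hypothesis he : onbasis e.

(** The operator [L] of the overview is the sum of the [adj (cross a) ** cross a]; Hilbert-Schmidt
    bounds for [cross a] thus stand for its finite trace. *)
Definition cross a : op H H := (op1 H - Q [:: a]) ** P [:: a].
Hypothesis hX : forall a, isHS e (cross a).

Let D k := diag Q P (op1 H) k.
Let Hs := hs U e.

Lemma diag_tail z i : P z ** D (size z + i) = wsum i (fun t => P (z ++ t) ** Q (z ++ t)).
Proof.
rewrite /D (diag_Pl Q sP) ?leq_addr// addKn.
by apply: eq_wsum => t _; rewrite comp1r.
Qed.

Lemma hs_compr (M S T : op H H) : isHS e S -> isHS e T -> Hs (S ** M) T = Hs S (T ** adj M).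
Proof.
move=> hS hT; rewrite /Hs -(hs_adj Uoo he hS (isHS_compr he _ hT)) adj_comp adjK.
rewrite -(hs_adj Uoo he (isHS_compr he _ hS) hT) adj_comp.
by rewrite [RHS]hs_move.
Qed.

(** Right multiplication by the projections [P (w ++ s)] splits [S ** P w] and [T ** P w] into parts
    that are mutually orthogonal for the pairing. *)
Lemma hs_ps_sum (S T : op H H) w k : isHS e (S ** P w) -> isHS e (T ** P w) ->
  wsum k (fun s => Hs (S ** P (w ++ s)) (T ** P (w ++ s))) = Hs (S ** P w) (T ** P w).
Proof.
move=> hS hT.
have h s : Hs (S ** P (w ++ s)) (T ** P (w ++ s)) = Hs (S ** P w ** P (w ++ s)) (T ** P w).
  have e1 (M : op H H) : M ** P (w ++ s) = M ** P w ** P (w ++ s) by rewrite -compA (ps_mul sP).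
  rewrite (e1 S) (e1 T) (hs_compr _ hS (isHS_compr he _ hT)) (hs_compr _ hS hT) (ps_adj sP).
  by rewrite -[_ ** P (w ++ s) ** P (w ++ s)]compA (ps_idem sP).
rewrite (eq_wsum (G := fun s => Hs (S ** P w ** P (w ++ s)) (T ** P w))) => [|s _]; last exact: h.
rewrite /wsum -hs_suml// => [|s]; last exact: isHS_compr.
by rewrite -comp_sumr [\sum_(i : _) _](ps_wsum sP w k) -compA (ps_idem sP).
Qed.

Let VU x : adj (Uw W x) ** Uw W x = op1 H.
Proof. by rewrite (adj_Uw uW) (UwVl uW). Qed.

Let UV x : Uw W x ** adj (Uw W x) = op1 H.
Proof. by rewrite (adj_Uw uW) (UwV uW). Qed.

Let conj_mul x (S T : op H H) :
  Uw W x ** S ** adj (Uw W x) ** (Uw W x ** T ** adj (Uw W x)) = Uw W x ** (S ** T) ** adj (Uw W x).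
Proof. by rewrite !compA -[_ ** adj _ ** Uw W x]compA VU comp1r. Qed.

Lemma hs_unitary x (S T : op H H) : isHS e S -> isHS e T ->
  Hs (Uw W x ** S ** adj (Uw W x)) (Uw W x ** T ** adj (Uw W x)) = Hs S T.
Proof.
move=> hS hT; have hS' := isHS_compl (Uw W x) hS; have hT' := isHS_compl (Uw W x) hT.
rewrite (hs_compr _ hS' (isHS_compr he _ hT')) adjK -[_ ** adj (Uw W x) ** _]compA VU comp1r.
by rewrite /Hs hs_move compA VU comp1l.
Qed.

(** What becomes of the pairing at a prefix [z] after conjugation by [z]: [v] is the word of
    [z^-1 a], and its first letter [t] is the inverse of the last letter of [z]. *)
Let k_term i (v : word) : C := if v is t :: _ then
  Hs ((op1 H - P [:: t]) ** (op1 H - Q [:: t]) ** P v)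
     ((op1 H - P [:: t]) ** D i ** (op1 H - Q [:: t]) ** P v) else 0.

Let isHS_k t v : isHS e ((op1 H - Q [:: t]) ** P (t :: v)).
Proof. by rewrite -[t :: v]cat1s -(ps_mul sP) compA; exact: (isHS_compr he _ (hX t)). Qed.

(** Since [z] does not start with [a], the factor [1 - Q a] of [cross a] is absorbed by
    [Q (z ++ w)]. All other factors are conjugates under [z], and the pairing is invariant under
    unitary conjugation. *)
Lemma hs_diag_cross i k a z : size z = k.+1 -> reduced (linv a :: z) ->
  Hs (P z ** Q z ** cross a) (wsum i (fun t => P (z ++ t) ** Q (z ++ t)) ** cross a) =
  k_term i (winv (linv a :: z)).
Proof.
case/lastP: z => [//|z' c] _ r; set z := rcons z' c in r *.
have rz : reduced z by exact: path_sorted r.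
have vE : winv (linv a :: z) = linv c :: rcons (winv z') a.
  by rewrite /winv /= rev_cons linvK map_rcons rev_rcons.
have vE' : winv (linv a :: z) = rcons (winv z) a by rewrite /winv /= rev_cons linvK.
have rv : reduced (rcons (winv z) a) by rewrite -vE' reduced_winv.
have UU1 := UV z.
have hPw w : P (z ++ w) = Uw W z ** ((op1 H - P [:: linv c]) ** P w) ** adj (Uw W z).
  by rewrite -(ps_conj sP)// -compA UU1 comp1r.
have hQw w : Q (z ++ w) = Uw W z ** (Q w ** (op1 H - Q [:: linv c])) ** adj (Uw W z).
  have := congr1 (@adj _ _ _) (ps_conj sQ w rz); rewrite !adj_comp (adj_ps_compl sQ) !(ps_adj sQ).
  by move/(congr1 (fun S => Uw W z ** S)); rewrite !compA UU1 comp1l.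
have hPa : P [:: a] = Uw W z ** P (rcons (winv z) a) ** adj (Uw W z).
  by rewrite -(ps_conjV uW sP)// -compA UU1 comp1r.
have Qa w : Q (z ++ w) ** (op1 H - Q [:: a]) = Q (z ++ w).
  rewrite (ps_mul_compl sQ); move: r; rewrite /z; case: (z') => [|b s] /=.
    by rewrite linvK => /andP[/negbTE ->].
  by rewrite linvK => /andP[/negbTE ->].
have PQ w : P (z ++ w) ** Q (z ++ w) ** cross a = Uw W z **
    ((op1 H - P [:: linv c]) ** (P w ** Q w) ** (op1 H - Q [:: linv c]) ** P (rcons (winv z) a)) ** adj (Uw W z).
  rewrite /cross compA -[_ ** _ ** (op1 H - _)]compA Qa hPw hQw hPa.
  by rewrite !conj_mul !compA.
have -> : k_term i (winv (linv a :: z)) =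
    Hs ((op1 H - P [:: linv c]) ** (op1 H - Q [:: linv c]) ** P (rcons (winv z) a))
       ((op1 H - P [:: linv c]) ** D i ** (op1 H - Q [:: linv c]) ** P (rcons (winv z) a)).
  by rewrite -vE' vE.
have -> : wsum i (fun t => P (z ++ t) ** Q (z ++ t)) ** cross a = Uw W z **
    ((op1 H - P [:: linv c]) ** D i ** (op1 H - Q [:: linv c]) ** P (rcons (winv z) a)) ** adj (Uw W z).
  rewrite /D /diag /wsum comp_sumr !(comp_suml, comp_sumr); apply: eq_bigr => t _.
  by rewrite PQ comp1r.
have := PQ [::]; rewrite cats0 => ->; rewrite (ps1 sP) (ps1 sQ) !comp1r.
have hv : isHS e ((op1 H - Q [:: linv c]) ** P (rcons (winv z) a)) by rewrite -vE' vE; exact: isHS_k.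
by rewrite hs_unitary// -compA; apply: isHS_compl.
Qed.

Let d i := \sum_t Hs ((op1 H - P [:: t]) ** cross t) (D i ** cross t).

(* Conjugation by a prefix reduces the left-hand side to words of length one, so it depends only on
   the difference of the two lengths. *)
Lemma cross_sum k i :
  \sum_a Hs (D k.+1 ** cross a) (D (k.+1 + i) ** cross a) = d i.
Proof.
have step a z : size z = k.+1 -> Hs (P z ** Q z ** cross a) (D (k.+1 + i) ** cross a) =
    k_term i (winv (linv a :: z)).
  (* The projection [P z] moves across the pairing and cuts the second argument down to its block at
     [z]. *)
  move=> sz; have -> : Hs (P z ** Q z ** cross a) (D (k.+1 + i) ** cross a) =
      Hs (P z ** Q z ** cross a) (wsum i (fun t => P (z ++ t) ** Q (z ++ t)) ** cross a).
    by rewrite -{1}(ps_idem sP z) -!compA /Hs hs_move (ps_adj sP) !compA -sz diag_tail.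
  have [r|r] := boolP (reduced (linv a :: z)); first exact: hs_diag_cross sz r.
  have -> : k_term i (winv (linv a :: z)) = 0.
    have := r; rewrite -reduced_winv; case: (winv _) => [//|t v] r'.
    by rewrite /k_term (ps_red sP r') !comp0r /Hs hs0l//; exact: isHS_0.
  suff -> : P z ** Q z ** cross a = 0 by rewrite /Hs hs0l//; exact: isHS_compl.
  case: z sz r => [//|b z] _ /=; rewrite linvK negb_and negbK => /orP[/eqP <-|r].
    by rewrite /cross compA -[_ ** _ ** (op1 H - _)]compA (ps_mul_compl sQ) eqxx comp0r comp0l.
  by rewrite (ps_red sP (w := b :: z)) ?comp0l.
have -> : \sum_a Hs (D k.+1 ** cross a) (D (k.+1 + i) ** cross a) =
    \sum_a wsum k.+1 (fun z => k_term i (winv (linv a :: z))).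
  apply: eq_bigr => a _; rewrite {1}/D /diag /wsum comp_suml /Hs hs_suml.
  - by apply: eq_bigr => z _; rewrite comp1r -/Hs step ?size_tuple.
  - by move=> z; rewrite comp1r; exact: isHS_compl.
  - exact: isHS_compl.
(* The words [linv a :: z] run over all words of length [k.+2]. After inverting them, [hs_ps_sum]
   sums over all letters but the first, and [k] disappears. *)
rewrite (reindex_inj (inv_inj (@linvK I))) /=.
rewrite (eq_bigr (fun a => wsum k.+1 (fun z => k_term i (winv (a :: z))))); last by move=> a _; rewrite linvK.
rewrite -(wsumS k.+1 (fun x => k_term i (winv x))) -(wsum_winv k.+2 (k_term i)) wsumS.
apply: eq_bigr => t _.
have h1 := isHS_k t [::].
rewrite (hs_ps_sum (S := (op1 H - P [:: t]) ** (op1 H - Q [:: t])) (T := (op1 H - P [:: t]) ** D i ** (op1 H - Q [:: t])) (w := [:: t])).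
- have key (A M : op H H) : adj A = A -> A ** A = A -> Hs (A ** cross t) (A ** (M ** cross t)) = Hs (A ** cross t) (M ** cross t).
    by move=> aA AA; rewrite -{2}aA /Hs -hs_move compA AA.
  by rewrite -!compA -/(cross t) key ?(adj_ps_compl sP) ?(ps_compl_idem sP).
- by rewrite -compA; exact: isHS_compl.
- by rewrite -compA; exact: isHS_compl.
Qed.

Definition window j n : op H H := \sum_(m < n) D (j + m).

(** By [cross_sum], appending the level [n] to the window adds [d 0] and twice the real part of
    [d 1 + ... + d n] to the squared norm. As [d 0] has nonnegative real part, this is at most twice
    the full partial sum. *)
Lemma Re_window j n :
  complex.Re (\sum_a Hs (window j.+1 n ** cross a) (window j.+1 n ** cross a)) <=
  2 * complex.Re (\sum_(l < n) \sum_(i < l.+1) d i).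
Proof.
have hD k a : isHS e (D k ** cross a) by exact: isHS_compl.
have d0 : 0 <= complex.Re (d 0).
  rewrite -(cross_sum 0 0); elim/big_rec: _ => [//|a x _ hx].
  by rewrite ReD addr_ge0//; apply: Re_hs_ge0.
elim: n => [|n IH].
  rewrite big_ord0 mulr0 big1// => a _.
  by rewrite /window big_ord0 comp0l /Hs hs0l//; exact: isHS_0.
have hV a : isHS e (window j.+1 n ** cross a) by exact: isHS_compl.
have -> : \sum_a Hs (window j.+1 n.+1 ** cross a) (window j.+1 n.+1 ** cross a) =
    \sum_a Hs (window j.+1 n ** cross a) (window j.+1 n ** cross a) +
    ((\sum_(m < n) d (n - m) + (\sum_(m < n) d (n - m))^* ) + d 0).
  have -> : \sum_(m < n) d (n - m) = \sum_a Hs (window j.+1 n ** cross a) (D (j.+1 + n) ** cross a).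
    rewrite (eq_bigr (fun a => \sum_(m < n) Hs (D (j.+1 + m) ** cross a) (D (j.+1 + n) ** cross a))); last first.
      by move=> a _; rewrite /window comp_suml /Hs hs_suml.
    rewrite [RHS]exchange_big /=; apply: eq_bigr => m _.
    by rewrite -(cross_sum (j + m)) !addSn -addnA subnKC// ltnW.
  rewrite -(cross_sum (j + n) 0) addn0 rmorph_sum -!big_split /=; apply: eq_bigr => a _.
  have -> : window j.+1 n.+1 = window j.+1 n + D (j.+1 + n) by rewrite /window big_ord_recr.
  rewrite compDl /Hs hsDl//; last exact: isHS_D.
  by rewrite !hsDr// (hs_conj (hV a) (hD (j.+1 + n)%N a)) !addrA.
rewrite big_ord_recr /= !ReD Re_conj mulrDr.
have -> : \sum_(i < n.+1) d i = d 0 + \sum_(m < n) d (n - m).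
  rewrite big_ord_recl; congr (_ + _); rewrite (reindex_inj rev_ord_inj) /=.
  by apply: eq_bigr => m _; rewrite /bump add1n -subSn.
rewrite ReD; move: IH; move: (complex.Re _) (complex.Re _) (complex.Re _) (complex.Re _) d0 => x y z t; lra.
Qed.

Lemma sum_fejer (V : zmodType) (f : nat -> V) n :
  \sum_(l < n) \sum_(i < l.+1) f i = \sum_(i < n) f i *+ (n - i).
Proof.
elim: n => [|n IH]; first by rewrite !big_ord0.
rewrite big_ord_recr /= IH.
have -> : \sum_(i < n.+1) f i *+ (n.+1 - i) = \sum_(i < n.+1) (f i *+ (n - i) + f i).
  by apply: eq_bigr => i _; rewrite subSn ?mulrSr// -ltnS.
by rewrite big_split /= [in RHS]big_ord_recr /= subnn mulr0n addr0.
Qed.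

Hypothesis intertwiner0 : forall Z : op H H, (forall a, W a ** Z = Z ** W a) ->
  (forall w, P w ** Z = Z ** Q w) -> Z = 0.

Let bD k : bnd 1 (D k).
Proof. by apply: (bnd_diag sQ sP) => // u; rewrite mul1r. Qed.

Lemma wlim_diag0 c s : slow c -> wlim U (smean c (fun i => D (i + s)%N)) 0.
Proof.
move=> sc; have [Z hZ _] := wlim_ex ler01 (fun n => bnd_smean sc n ler01 (fun i => bD (i + s))).
have [h1 h2] := smean_diag_intertwines Uoo sc uW uW sQ sP (T := op1 H)
  (fun a => etrans (comp1r _) (esym (comp1l _))) hZ.
by rewrite -(intertwiner0 h2 h1).
Qed.

(** Strong decay of the window averages, uniform in their starting level [j]. *)
Definition flat u : Prop := forall eps : R, 0 < eps ->
  U [set n | forall j, nr (window j n.+1 u) <= eps * n.+1%:R].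

Lemma window_shift j s n u : nr (window j n u) <= nr (window (j + s) n u) + 2 * s%:R * nr u.
Proof.
elim: s => [|s IH]; first by rewrite addn0 mulr0 mul0r addr0.
apply: le_trans IH _.
have -> : window (j + s) n = window (j + s.+1) n + (D (j + s) - D (j + s + n)).
  rewrite /window; elim: n => [|n IH]; first by rewrite !big_ord0 addn0 subrr addr0.
  rewrite !big_ord_recr /= IH -[LHS]addrA subrK (_ : j + s.+1 + n = j + s + n.+1)%N; last by lia.
  by rewrite -[RHS]addrA; congr (_ + _); rewrite addrC subrK.
rewrite opD opB -natr1; have := nrD (window (j + s.+1) n u) (D (j + s) u - D (j + s + n) u).
have := nrB_le (D (j + s) u) (D (j + s + n) u); have := bD (j + s) u; have := bD (j + s + n) u.
rewrite !mul1r; lra.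
Qed.

(** Moving a window by [s] levels costs at most [2 s |u|], negligible against its length, so
    finitely many initial levels may be ignored. *)
Lemma flat_from s u :
  (forall eps : R, 0 < eps -> U [set n | forall j, nr (window (j + s) n.+1 u) <= eps * n.+1%:R]) ->
  flat u.
Proof.
move=> h eps e0; have e2 : 0 < eps / 2 by rewrite divr_gt0.
have m0 : 0 < 2 * s%:R * nr u + 1 by rewrite ltr_wpDl// !mulr_ge0 ?nr_ge0.
have [N hN] := natSinv_small (divr_gt0 e2 m0).
have hU : U [set n | (N <= n)%N] by apply: Uoo; exists N.
apply: filterS (filterI (h _ e2) hU) => n [/= h1 Nn] j.
apply: le_trans (window_shift j s n.+1 u) _.
have n0 : 0 < n.+1%:R :> R by [].
have := hN n Nn; rewrite ltr_pdivlMr// mulrC ltr_pdivrMr// => h2; have := h1 j; lra.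
Qed.

Lemma flat_subspace : linear_subspace flat.
Proof.
split=> [eps e0|a u v hu hv eps e0].
  by apply: filterE => n /= j; rewrite op0r nr0 mulr_ge0// ltW.
have a0 : 0 < nr a + 1 by rewrite ltr_wpDl ?nr_ge0.
have e2 : 0 < eps / 2 by rewrite divr_gt0.
apply: filterS (filterI (hu _ (divr_gt0 e2 a0)) (hv _ e2)) => n [/= h1 h2] j.
rewrite opDr opZr; apply: le_trans (nrD _ _) _; rewrite nrZ [eps]splitr mulrDl; apply: lerD (h2 j).
apply: le_trans (ler_wpM2l (nr_ge0 _) (h1 j)) _; rewrite mulrA ler_wpM2r//.
by rewrite mulrCA ler_piMr ?(ltW e2)// ler_pdivrMr// mul1r lerDl.
Qed.

Lemma flat_closed : closed flat.
Proof.
apply: approx_closed => u h eps e0; have e2 : 0 < eps / 2 by rewrite divr_gt0.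
have [v fv uv] := h _ e2; apply: filterS (fv _ e2) => n /= h1 j.
rewrite -[u](subrK v) opDr; apply: le_trans (nrD _ _) _.
rewrite [eps]splitr mulrDl; apply: lerD (h1 j).
have bw : bnd (\sum_(m < n.+1) 1) (window j n.+1) by apply: bnd_sum.
apply: le_trans (bw _) _; rewrite sumr_const card_ord mulrC.
by rewrite ler_wpM2r.
Qed.

Lemma flat_W a u : flat u -> flat (W a u).
Proof.
move=> fu; apply: (@flat_from 2) => eps e0; have e2 : 0 < eps / 2 by rewrite divr_gt0.
apply: filterS (fu _ e2) => n /= h j.
(* This is [diag_shift] for [linv a], solved for the product with [W a] on the right. It replaces a
   window by two windows, one level higher and one level lower. *)
have hD k : D k.+2 ** W a = W a ** (P [:: linv a] ** D k.+3 + (op1 H - P [:: linv a]) ** D k.+1).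
  have := diag_shift uW uW sQ sP (T := op1 H) (fun a => etrans (comp1r _) (esym (comp1l _))) (linv a) (ltn0Sn k).
  move=> /(congr1 (fun S => W a ** S ** W a)); have [_ e1] := uW a; have [_ e3] := uW (linv a).
  by rewrite linvK in e3; rewrite !compA e1 comp1l -!compA e3 comp1r.
have -> : window (j + 2) n.+1 (W a u) = W a (P [:: linv a] (window (j + 3) n.+1 u) +
    (op1 H - P [:: linv a]) (window (j + 1) n.+1 u)).
  rewrite -!compE -opD -compE; congr (opf _ u).
  rewrite /window comp_suml !comp_sumr -big_split comp_sumr; apply: eq_bigr => m _ /=.
  by rewrite !addn1 !addn2 !addn3 !addSn hD.
rewrite (bnd_unitary (T := W a)); last by have [-> _] := uW a; have [_] := uW (linv a); rewrite linvK.
apply: le_trans (nrD _ _) _; rewrite [eps]splitr mulrDl; apply: lerD.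
  by apply: le_trans (ps_bnd sP _ _) _; rewrite mul1r.
have := projection_bnd (adj_ps_compl sP (linv a)) (ps_compl_idem sP (linv a)).
by move=> hb; apply: le_trans (hb _) _; rewrite mul1r.
Qed.

Lemma flat_Q w u : flat u -> flat (Q w u).
Proof.
move=> fu; apply: (@flat_from (size w)) => eps e0; apply: filterS (fu _ e0) => n /= h j.
have -> : window (j + size w) n.+1 (Q w u) = P w (window (j + size w) n.+1 u).
  rewrite -!compE; congr (opf _ u); rewrite /window comp_suml comp_sumr; apply: eq_bigr => m _.
  by rewrite /D -(diag_comm sQ sP)// -addnA addnCA leq_addr.
by apply: le_trans (ps_bnd sP _ _) _; rewrite mul1r.
Qed.

(** The vector norm is at most a Hilbert-Schmidt norm, which [Re_window] bounds through Fejer means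
    of the [D i] paired with fixed operators. These means tend to 0 weakly, hence in the pairing by
    [hs_wlim], and the bound does not involve [j]. *)
Lemma flat_cross a i : flat (cross a (e i)).
Proof.
apply: (@flat_from 1) => eps e0.
pose F := smean (fun n i => (n.+1 - i)%:R / n.+1%:R ^+ 2 : R) D.
have hF : wlim U F 0.
  move=> u v; apply: eq_ulim (wlim_diag0 0 (@slow_fejer R) u v) => n.
  by rewrite /F /smean; congr (inner (opf _ u) v); apply: eq_bigr => l _; rewrite addn0.
have bF n : bnd 1 (F n) by apply: bnd_smean => //; exact: slow_fejer.
pose s n := \sum_t Hs ((op1 H - P [:: t]) ** cross t) (F n ** cross t).
have hs0 : ulim U s 0.
  have -> : 0 = \sum_(t : letter I) (0 : C) by rewrite big1.
  apply: ulim_sum => t _; have -> : 0 = (0 : C)^* by rewrite conjC0.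
  apply: (@eq_ulim R U _ (fun n => (Hs (F n ** cross t) ((op1 H - P [:: t]) ** cross t))^* )).
    by move=> n; rewrite -(hs_conj (isHS_compl _ (hX t)) (isHS_compl _ (hX t))).
  apply: ulim_conj; have -> : 0 = Hs (0 ** cross t) ((op1 H - P [:: t]) ** cross t).
    by rewrite comp0l /Hs hs0l//; exact: isHS_compl.
  exact: (hs_wlim Uoo ler01 bF hF (hX t) (isHS_compl _ (hX t))).
have sE n : \sum_(l < n.+1) \sum_(i < l.+1) d i = (n.+1%:R ^+ 2)%:C%C * s n.
  rewrite sum_fejer /s mulr_sumr.
  rewrite (eq_bigr (fun t => \sum_(i < n.+1) Hs ((op1 H - P [:: t]) ** cross t) (D i ** cross t) *+ (n.+1 - i))); last first.
    move=> t _; rewrite smean_compr /smean /Hs hs_sumr => [|l|]; last exact: isHS_compl.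
      rewrite mulr_sumr; apply: eq_bigr => l _; rewrite hsZr; try exact: isHS_compl.
      rewrite conjR mulrA -rmorphM /= mulrCA mulfV ?mulr1 ?expf_neq0 ?pnatr_eq0//.
      by rewrite rmorph_nat mulr_natl.
    by apply: isHS_Z; exact: isHS_compl.
  by rewrite exchange_big /=; apply: eq_bigr => l _; rewrite sumrMnl.
have e2 : 0 < eps ^+ 2 / 2 by rewrite divr_gt0// exprn_gt0.
apply: filterS (hs0 _ e2) => n /=; rewrite subr0 => h j.
have n0 : 0 <= n.+1%:R :> R by [].
apply: le_from_sqr; first by rewrite mulr_ge0// ltW.
have hw : isHS e (window (j + 1) n.+1 ** cross a) by exact: isHS_compl.
apply: le_trans (nr_hs_le Uoo i hw) _; rewrite addn1.
apply: (@le_trans _ _ (complex.Re (\sum_a Hs (window j.+1 n.+1 ** cross a) (window j.+1 n.+1 ** cross a)))).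
  rewrite (bigD1 a)//= ReD lerDl; elim/big_rec: _ => [//|b x _ hx].
  by rewrite ReD addr_ge0//; apply: (Re_hs_ge0 Uoo); exact: isHS_compl.
apply: le_trans (Re_window j n.+1) _; rewrite sE ReZ exprMn mulrCA [leRHS]mulrC ler_wpM2l ?sqr_ge0//.
have := le_trans (ler_norm _) (Re_le_nr (s n)); lra.
Qed.

(** The flat vectors form a closed subspace invariant under [W] and [Q]. If it were zero, every
    [cross a] would kill the whole basis. *)
Lemma flat_all u : sys_irreducible W Q -> (exists a, cross a <> 0) -> flat u.
Proof.
move=> iQ [a Xa].
have [||f0|->//] := iQ flat flat_subspace flat_closed.
- exact: flat_W.
- exact: flat_Q.
exfalso; apply: Xa; apply: (hs_eq0 Uoo he (hX a)).
rewrite hs_real//; have -> // : complex.Re (hs U e (cross a) (cross a)) = 0.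
apply/eqP; rewrite eq_le Re_hs_ge0// andbT; apply: Re_hs_le => // m.
rewrite big1// => i _; have := flat_cross a i; rewrite f0 => ->.
by rewrite nr0 expr0n.
Qed.

End StrongMean.

(** * The trace identity *)

Section TraceIdentity.
Variables (R : realType) (I : finType) (H H' : hilbertType R).
Local Notation C := R[i].
Local Notation word := (seq (letter I)).
Variables (W : letter I -> op H H) (W' : letter I -> op H' H').
Hypothesis uW : unitary_letters W.
Hypothesis uW' : unitary_letters W'.
Variables (P Q : word -> op H H) (P' : word -> op H' H').
Hypothesis sP : psystem W P.
Hypothesis sQ : psystem W Q.
Hypothesis sP' : psystem W' P'.
Variable U : set_system nat.
Context {UU : UltraFilter U}.
Hypothesis Uoo : \oo `<=` U.
Variable e : nat -> H.
Hypothesis he : onbasis e.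
Hypothesis hX : forall a, isHS e (cross P Q a).
Variable T : op H H'.
Hypothesis hT : forall a, W' a ** T = T ** W a.

Let Hs := hs U e.
Let X a := cross P Q a.
Let Z a := adj (X a).
Let L := \sum_a Z a ** X a.
Let B w := adj T ** P' w ** T.
Let CT := adj T ** T.
Let D k := diag Q P (op1 H) k.
Let D' k := diag P Q (op1 H) k.

(* The trace of [M L] for [L = \sum_a P a (1 - Q a) P a]. *)
Definition tau (M : op H H) : C := \sum_a Hs (M ** Z a) (Z a).

Let hZ a : isHS e (Z a).
Proof. exact: isHS_adj. Qed.

Let hMZ M a : isHS e (M ** Z a).
Proof. exact: isHS_compl. Qed.

Lemma tauD M N : tau (M + N) = tau M + tau N.
Proof. by rewrite /tau -big_split; apply: eq_bigr => a _; rewrite compDl /Hs hsDl. Qed.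

Lemma tauZ c M : tau (c *: M) = c * tau M.
Proof. by rewrite /tau mulr_sumr; apply: eq_bigr => a _; rewrite compZl /Hs hsZl. Qed.

Lemma tau0 : tau 0 = 0.
Proof. by rewrite -(scale0r (0 : op H H)) tauZ mul0r. Qed.

Lemma tau_sum (J : Type) (r : seq J) (F : J -> op H H) :
  tau (\sum_(j <- r) F j) = \sum_(j <- r) tau (F j).
Proof.
elim: r => [|j r IH]; first by rewrite !big_nil tau0.
by rewrite !big_cons tauD IH.
Qed.

Lemma tau_wlim (M : nat -> op H H) N c : 0 <= c -> (forall n, bnd c (M n)) ->
  wlim U M N -> ulim U (fun n => tau (M n)) (tau N).
Proof.
by move=> c0 hc hM; apply: ulim_sum => a _; exact: hs_wlim c0 hc hM (hZ a) (hZ a).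
Qed.

(* For reduced [x <> 1] this is the conjugate of [L] by the group element [x], see [conj_L]. *)
Definition ell x : op H H := P x - \sum_a (P (rcons x a) ** Q (rcons x a) ** P (rcons x a))
  + Q x - P x ** Q x - Q x ** P x + P x ** Q x ** P x.

Lemma ell_nred x : ~~ reduced x -> ell x = 0.
Proof.
move=> r; rewrite /ell (ps_red sP r) (ps_red sQ r) !comp0l big1 ?subrr ?addr0 ?subr0// => a _.
rewrite (ps_red sP) ?comp0l//; apply: contra r.
by case: x => //= b x; rewrite rcons_path => /andP[].
Qed.

Let VU x : adj (Uw W x) ** Uw W x = op1 H.
Proof. by rewrite (adj_Uw uW) (UwVl uW). Qed.

Let UV x : Uw W x ** adj (Uw W x) = op1 H.
Proof. by rewrite (adj_Uw uW) (UwV uW). Qed.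

Let conj_mul x (S M : op H H) :
  Uw W x ** S ** adj (Uw W x) ** (Uw W x ** M ** adj (Uw W x)) = Uw W x ** (S ** M) ** adj (Uw W x).
Proof. by rewrite !compA -[_ ** adj _ ** Uw W x]compA VU comp1r. Qed.

Let conj_letter (P0 : word -> op H H) x c a : psystem W P0 -> reduced (rcons x c) ->
  Uw W (rcons x c) ** P0 [:: a] ** adj (Uw W (rcons x c)) =
  if a == linv c then op1 H - P0 (rcons x c) else P0 (rcons (rcons x c) a).
Proof.
move=> s0 r; set z := rcons x c in r *.
have h w : P0 (z ++ w) = Uw W z ** ((op1 H - P0 [:: linv c]) ** P0 w) ** adj (Uw W z).
  by rewrite -(ps_conj s0)// -compA UV comp1r.
case: eqP => [->|ac]; last by rewrite -cats1 h (ps_compl_mul s0); move/eqP/negbTE: ac => ->.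
have := h [::]; rewrite cats0 (ps1 s0) comp1r => ->.
by rewrite compBr compBl comp1r UV subKr.
Qed.

(** Conjugation by [z] turns the summand of [L] at the inverse of the last letter into
    [(1 - P z) Q z (1 - P z)], and every other summand at [a] into [P (1 - Q) P] at [z a]. The [P]
    at the words [z a] add up to [P z]. *)
Lemma conj_L x c : reduced (rcons x c) ->
  Uw W (rcons x c) ** L ** adj (Uw W (rcons x c)) = ell (rcons x c).
Proof.
move=> r; set z := rcons x c in r *; set V := Uw W z.
have LE : L = \sum_a P [:: a] ** (op1 H - Q [:: a]) ** P [:: a].
  apply: eq_bigr => a _; rewrite /Z /X /cross adj_comp (adj_ps_compl sQ) (ps_adj sP).
  by rewrite -compA [_ ** (_ ** P _)]compA (ps_compl_idem sQ) compA.
have cP a : V ** P [:: a] ** adj V = if a == linv c then op1 H - P z else P (rcons z a).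
  exact: conj_letter.
have cQ a : V ** Q [:: a] ** adj V = if a == linv c then op1 H - Q z else Q (rcons z a).
  exact: conj_letter.
have cL a : V ** (P [:: a] ** (op1 H - Q [:: a]) ** P [:: a]) ** adj V =
    (V ** P [:: a] ** adj V) ** (op1 H - V ** Q [:: a] ** adj V) ** (V ** P [:: a] ** adj V).
  have -> : op1 H - V ** Q [:: a] ** adj V = V ** (op1 H - Q [:: a]) ** adj V.
    by rewrite compBr compBl comp1r UV.
  by rewrite !conj_mul.
rewrite LE comp_sumr comp_suml (eq_bigr _ (fun a _ => cL a)) (bigD1 (linv c))//= cP cQ eqxx subKr.
have Pt : P (rcons z (linv c)) = 0.
  apply: (ps_red sP); rewrite /z; case: (x) => [|b s] /=; first by rewrite eqxx.
  by rewrite !rcons_path last_rcons eqxx andbF.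
rewrite (eq_bigr (fun a => P (rcons z a) - P (rcons z a) ** Q (rcons z a) ** P (rcons z a))); last first.
  by move=> a /negbTE ac; rewrite cP cQ ac compBr comp1r compBl (ps_idem sP).
rewrite big_split /= sumrN.
have -> : \sum_(a | a != linv c) P (rcons z a) = P z.
  by rewrite -[RHS](ps_sum sP) [RHS](bigD1 (linv c))//= Pt add0r.
have -> : \sum_(a | a != linv c) P (rcons z a) ** Q (rcons z a) ** P (rcons z a) =
    \sum_a P (rcons z a) ** Q (rcons z a) ** P (rcons z a).
  by rewrite [RHS](bigD1 (linv c))//= Pt !comp0l add0r.
rewrite /ell addrC -!addrA; congr (_ + (_ + _)).
by rewrite compBl comp1l compBr comp1r compBl opprB !addrA addrAC.
Qed.

Let T_Uw x : Uw W' x ** T = T ** Uw W x.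
Proof. by elim: x => [|a x IH] /=; rewrite ?comp1l ?comp1r// -compA IH compA hT compA. Qed.

Let aT_Uw x : adj T ** Uw W' x = Uw W x ** adj T.
Proof.
have := congr1 (@adj _ _ _) (T_Uw (winv x)).
by rewrite !adj_comp (adj_Uw uW) (adj_Uw uW') winvK.
Qed.

(* Left translation by [x^-1] maps the cylinder of [take p.+1 x] onto the complement of the cylinder of
   [take q.+1 x^-1]. *)
Lemma B_flip p q x : reduced x -> size x = (p + q).+1 ->
  B (take p.+1 x) ** Uw W x = Uw W x ** (CT - B (take q.+1 (winv x))).
Proof.
case: x => [//|b x0]; set x := b :: x0 => r sx.
have px : (p < size x)%N by rewrite sx ltnS leq_addr.
have [y [c [z [xE sy sz]]]] : exists y c z, [/\ x = rcons y c ++ z, size y = p & size z = q].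
  exists (take p x), (nth b x p), (drop p.+1 x); split.
  - by rewrite cat_rcons -drop_nth// cat_take_drop.
  - by rewrite size_takel// ltnW.
  - by rewrite size_drop sx subSS addKn.
have rr : reduced (rcons (winv z) (linv c)).
  have : reduced (winv x) by rewrite reduced_winv.
  rewrite xE winv_cat {2}/winv map_rcons rev_rcons -cat_rcons /reduced => h.
  by have := cat_sorted2 h => -[].
have ry : reduced (rcons y c) by move: r; rewrite xE /reduced => h; have := cat_sorted2 h => -[].
have -> : take p.+1 x = rcons y c by rewrite xE take_size_cat// size_rcons sy.
have -> : take q.+1 (winv x) = rcons (winv z) (linv c).
  rewrite xE winv_cat {2}/winv map_rcons rev_rcons -cat_rcons take_size_cat//.
  by rewrite size_rcons size_winv sz.
have key : P' (rcons y c) ** Uw W' x = Uw W' x ** (op1 H' - P' (rcons (winv z) (linv c))).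
  rewrite xE (Uw_cat W') compA (ps_Uw_back sP')// -!compA; congr (_ ** _).
  by rewrite compBl compBr comp1l comp1r (ps_conjV uW' sP').
rewrite /B -compA -T_Uw compA -[_ ** P' _ ** Uw W' x]compA key compA aT_Uw -!compA; congr (_ ** _).
by rewrite compBl comp1l compBr /CT.
Qed.

(** As [tau M] is the trace of [M L], cyclicity makes the first term the trace of
    [(S - B1) L V^-1 L V]. The second is the conjugate of the trace of [B1 V^-1 L V L], that is the
    trace of [B1 L V^-1 L V]. Both copies of [L] are expanded so that only Hilbert-Schmidt pairings
    occur. *)
Lemma tau_flip (V B0 B1 S : op H H) : adj V ** V = op1 H ->
  adj B1 = B1 -> B0 ** V = V ** (S - B1) ->
  tau (B0 ** (V ** L ** adj V)) + (tau (B1 ** (adj V ** L ** V)))^* = tau (adj V ** L ** V ** S).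
Proof.
move=> VV aB1 B0V.
have gen (A M : op H H) : A ** B0 ** V ** M = A ** V ** S ** M - A ** V ** B1 ** M.
  by rewrite -!compA [B0 ** (_ ** _)]compA B0V compBr compBl compBr !compA.
have aMZ (A M : op H H) : adj (adj M ** adj A) = A ** M by rewrite adj_comp !adjK.
have aXVZ (A M : op H H) : adj (A ** adj V ** adj M) = M ** V ** adj A by rewrite !adj_comp !adjK compA.
have aVZ (A : op H H) : adj (adj V ** adj A) = A ** V by rewrite adj_comp !adjK.
have aBVZ (A : op H H) : adj (B1 ** adj V ** adj A) = A ** V ** B1 by rewrite !adj_comp !adjK aB1 compA.
have e1 : tau (B0 ** (V ** L ** adj V)) = \sum_c \sum_d (Hs (X c ** V ** S ** Z d) (X c ** V ** Z d) -
    Hs (X c ** V ** B1 ** Z d) (X c ** V ** Z d)).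
  apply: eq_bigr => c _.
  rewrite /L comp_sumr !comp_suml comp_sumr comp_suml /Hs hs_suml//.
  apply: eq_bigr => d _.
  have -> : B0 ** (V ** (Z d ** X d) ** adj V) ** Z c = (B0 ** V ** Z d) ** (X d ** adj V ** Z c) by rewrite !compA.
  rewrite hs_move -(hs_adj Uoo he (hMZ _ c) (hMZ _ c)) (aMZ (X c)) (aXVZ (X d) (X c)) !compA.
  rewrite (gen (X c)).
  exact: (hsBl (hMZ _ d) (hMZ _ d) (hMZ _ d)).
have e2 : tau (adj V ** L ** V ** S) = \sum_c \sum_d Hs (X c ** V ** S ** Z d) (X c ** V ** Z d).
  rewrite exchange_big; apply: eq_bigr => d _.
  rewrite /L comp_sumr !comp_suml /Hs hs_suml//.
  apply: eq_bigr => c _.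
  have -> : adj V ** (Z c ** X c) ** V ** S ** Z d = (adj V ** Z c) ** (X c ** V ** S ** Z d) by rewrite !compA.
  by rewrite hs_move (aVZ (X c)).
have e3 : tau (B1 ** (adj V ** L ** V)) = \sum_c \sum_d Hs (X c ** V ** Z d) (X c ** V ** B1 ** Z d).
  rewrite exchange_big; apply: eq_bigr => d _.
  rewrite /L comp_sumr !comp_suml comp_sumr comp_suml /Hs hs_suml//.
  apply: eq_bigr => c _.
  have -> : B1 ** (adj V ** (Z c ** X c) ** V) ** Z d = (B1 ** adj V ** Z c) ** (X c ** V ** Z d) by rewrite !compA.
  by rewrite hs_move (aBVZ (X c)).
rewrite e1 e2 e3 rmorph_sum -big_split; apply: eq_bigr => c _ /=.
rewrite rmorph_sum -big_split; apply: eq_bigr => d _ /=.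
rewrite -(hs_conj (e := e)); last 2 first.
- exact: hMZ.
- exact: hMZ.
by rewrite subrK.
Qed.

Lemma ell_flip p q x : size x = (p + q).+1 ->
  tau (B (take p.+1 x) ** ell x) + (tau (B (take q.+1 (winv x)) ** ell (winv x)))^* =
  tau (ell (winv x) ** CT).
Proof.
move=> sx; have [r|r] := boolP (reduced x); last first.
  by rewrite (ell_nred r) (@ell_nred (winv x)) ?reduced_winv// !comp0r comp0l !tau0 conjC0 addr0.
have lastE s : size s = (p + q).+1 -> exists y c, s = rcons y c.
  by case/lastP: s => [//|y c] _; exists y, c.
have aB w : adj (B w) = B w by rewrite /B !adj_comp adjK (ps_adj sP') compA.
have V1 : Uw W x ** L ** adj (Uw W x) = ell x.
  by have [y [c xE]] := lastE _ _ sx; move: r; rewrite xE; exact: conj_L.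
have V2 : adj (Uw W x) ** L ** Uw W x = ell (winv x).
  have -> : adj (Uw W x) = Uw W (winv x) by rewrite (adj_Uw uW).
  have -> : Uw W x = adj (Uw W (winv x)) by rewrite (adj_Uw uW) winvK.
  have [y [c xE]] := lastE _ (winv x) (etrans (size_winv _) sx).
  by move: r; rewrite -reduced_winv xE; exact: conj_L.
by have := tau_flip (VU x) (aB (take q.+1 (winv x))) (B_flip r sx); rewrite V1 V2.
Qed.

Ltac op_abel := apply: opP => ?; apply: inner_eq => ?; rewrite ?(opD, opN) ?(innerDl, innerNl); ring.

Let c1 : nat -> nat -> R := fun n _ => n.+1%:R^-1.
Let E k := wsum k (fun x => P x ** Q x ** P x).
Let Phi j := adj T ** diag P P' T j.
Let Psi j := adj T ** diag Q P' T j.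

(* The part of the sum over words that the means over [p] and [q] send to 0; the [E] terms telescope. *)
Definition remainder (F G : nat -> op H H) p q : op H H :=
  F p ** (E (p.+1 + q) - E (p.+2 + q)) - F p ** D (p.+1 + q) - G p ** D' (p.+1 + q).

Let bE k : bnd 1 (E k).
Proof.
have -> : E k = wsum k (fun t => (P t ** Q t) ** op1 H ** P t).
  by apply: eq_wsum => t _; rewrite comp1r.
move=> u; apply: le_from_sqr; first by rewrite mul1r nr_ge0.
rewrite mul1r /wsum op_sum.
have -> : \sum_(t : k.-tuple _) (P t ** Q t ** op1 H ** P t) u = \sum_(t : k.-tuple _) P t ((Q t ** P t) u).
  by apply: eq_bigr => t _; rewrite comp1r -!compA.
rewrite (ps_pyth sP k (fun t => (Q t ** P t) u)) -(ps_bessel sP k u).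
apply: ler_sum => t _; rewrite ler_pXn2r// ?nnegrE ?nr_ge0//.
apply: le_trans (ps_bnd sP _ _) _; rewrite mul1r compE.
by apply: le_trans (ps_bnd sQ _ _) _; rewrite mul1r.
Qed.

Let sum_corner k : wsum k (fun x => \sum_a (P (rcons x a) ** Q (rcons x a) ** P (rcons x a))) = E k.+1.
Proof. by rewrite /E wsum_rcons. Qed.

Let DE k : D k = wsum k (fun x => P x ** Q x).
Proof. by apply: eq_wsum => x _; rewrite comp1r. Qed.

Let D'E k : D' k = wsum k (fun x => Q x ** P x).
Proof. by apply: eq_wsum => x _; rewrite comp1r. Qed.

Lemma wsum_ell k : wsum k ell = op1 H + op1 H + (E k - E k.+1 - D k - D' k).
Proof.
rewrite /ell !(wsumB, wsumD) (ps_wsum1 sP) (ps_wsum1 sQ) sum_corner DE D'E -/(E k).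
move: (wsum _ _) (wsum _ _) (E k) (E k.+1) (op1 H) => a b c d f; op_abel.
Qed.

(** Against [P x], which lies below [P] at the prefix, only the block of that prefix in
    [diag P P' T p.+1] survives; likewise for [Q]. So [B] at the prefix may be replaced by [Phi] or
    [Psi], which do not depend on [x] and leave the sum. *)
Lemma wsum_B_ell p q : wsum (p + q).+1 (fun x => B (take p.+1 x) ** ell x) =
  Phi p.+1 + Psi p.+1 + remainder (fun p => Phi p.+1) (fun p => Psi p.+1) p q.
Proof.
have hw (P0 : word -> op H H) x : psystem W P0 -> (p < size x)%N ->
    B (take p.+1 x) ** P0 x = adj T ** diag P0 P' T p.+1 ** P0 x.
  move=> s0 px; have e0 : P0 x = P0 (take p.+1 x) ** P0 x.
    by have := ps_mul s0 (take p.+1 x) (drop p.+1 x); rewrite cat_take_drop => ->.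
  rewrite e0 !compA; congr (_ ** _); rewrite -compA (diag_Pr P' s0) ?size_takel//.
  by rewrite subnn wsum0 cats0 !compA.
have step x : size x = (p + q).+1 -> B (take p.+1 x) ** ell x =
    Phi p.+1 ** (P x - \sum_a (P (rcons x a) ** Q (rcons x a) ** P (rcons x a)) - P x ** Q x + P x ** Q x ** P x) +
    Psi p.+1 ** (Q x - Q x ** P x).
  move=> sx; have px : (p < size x)%N by rewrite sx ltnS leq_addr.
  have hP M : B (take p.+1 x) ** (P x ** M) = Phi p.+1 ** (P x ** M) by rewrite !compA hw.
  have hQ M : B (take p.+1 x) ** (Q x ** M) = Psi p.+1 ** (Q x ** M) by rewrite !compA hw.
  have eS : \sum_a P (rcons x a) ** Q (rcons x a) ** P (rcons x a) =
      P x ** \sum_a P (rcons x a) ** Q (rcons x a) ** P (rcons x a).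
    by rewrite comp_sumr; apply: eq_bigr => a _; rewrite -cats1 !compA (ps_mul sP).
  have hPx : B (take p.+1 x) ** P x = Phi p.+1 ** P x by exact: hw.
  have hQx : B (take p.+1 x) ** Q x = Psi p.+1 ** Q x by exact: hw.
  rewrite /ell eS -[P x ** Q x ** P x]compA.
  move: (B _) (Phi _) (Psi _) hP hQ hPx hQx => b f g hP hQ hPx hQx.
  rewrite !(compDr b, compNr b) !(compDr f, compNr f, compDr g, compNr g) !hP.
  rewrite hQ hPx hQx.
  op_abel.
rewrite (eq_wsum step).
have wl (M : op H H) F : wsum (p + q).+1 (fun x => M ** F x) = M ** wsum (p + q).+1 F by rewrite /wsum comp_sumr.
rewrite wsumD !wl !(wsumB, wsumD) (ps_wsum1 sP) (ps_wsum1 sQ) sum_corner -DE -D'E -/(E _).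
rewrite /remainder !addSn !(compDr, compNr) !comp1r.
op_abel.
Qed.

(** At fixed [p] the [E] terms telescope and the [D] terms add up to windows. *)
Lemma remainder_row F G p n : smean c1 (remainder F G p) n =
  (n.+1%:R^-1)%:C%C *: (F p ** (E p.+1 - E (p.+1 + n.+1)) - F p ** window P Q p.+1 n.+1
    - G p ** window Q P p.+1 n.+1).
Proof.
rewrite /smean /c1 -scaler_sumr; congr (_ *: _).
elim: n.+1 => [|m IH].
  by rewrite big_ord0 /window !big_ord0 addn0 subrr !comp0r !subr0.
rewrite big_ord_recr IH /window !big_ord_recr /= /remainder !compDr !compNr !addSnnS -/(D _) -/(D' _).
op_abel.
Qed.

Hypothesis flatD : forall u, flat P Q U u.
Hypothesis flatD' : forall u, flat Q P U u.

Section Remainder.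
Variables (F G : nat -> op H H) (b : R).
Hypothesis b0 : 0 <= b.
Hypothesis bF : forall p, bnd b (F p).
Hypothesis bG : forall p, bnd b (G p).

Let Rm n := smean c1 (fun p => smean c1 (remainder F G p) n) n.

Lemma bnd_remainder n : bnd (4 * b) (Rm n).
Proof.
have b4 : 0 <= 4 * b by rewrite mulr_ge0.
have s1 := @slow_uniform R.
apply: (bnd_smean s1) => // p; apply: (bnd_smean s1) => // q.
have -> : 4 * b = b * (1 + 1) + b * 1 + b * 1 by ring.
apply: bndD; last by apply: bndN; apply: bnd_comp => //; apply: (bnd_diag sP sQ) => // u; rewrite mul1r.
apply: bndD; last by apply: bndN; apply: bnd_comp => //; apply: (bnd_diag sQ sP) => // u; rewrite mul1r.
by apply: bnd_comp => //; apply: bndD => //; apply: bndN.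
Qed.

(** The factors [F p] and [G p] vary with [p] and stand on the left, so each row is estimated in
    norm: flatness bounds its windows uniformly in their starting level [p.+1]. *)
Lemma wlim_remainder : wlim U Rm 0.
Proof.
apply: wlim0 => u eps eps0.
(* The three terms of a row contribute [3 * b] in total; [4 * b + 1] dominates this and is positive
   even for [b = 0]. *)
have m0 : 0 < 4 * b + 1 by rewrite ltr_wpDl// mulr_ge0.
have e4 : 0 < eps / (4 * b + 1) by rewrite divr_gt0.
have m1 : 0 < 2 * nr u + 1 by rewrite ltr_wpDl// mulr_ge0 ?nr_ge0.
have [N hN] := natSinv_small (divr_gt0 e4 m1).
have hU : U [set n | (N <= n)%N] by apply: Uoo; exists N.
apply: filterS (filterI hU (filterI (flatD u e4) (flatD' u e4))) => n [/= Nn [h1 h2]].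
have n0 : 0 < n.+1%:R :> R by [].
have hn : 2 * nr u <= eps / (4 * b + 1) * n.+1%:R.
  have := hN n Nn; rewrite ltr_pdivlMr// mulrC ltr_pdivrMr// => h; lra.
have row p : nr (smean c1 (remainder F G p) n u) <= eps.
  rewrite remainder_row opZ nrZ nrC ger0_norm ?invr_ge0// mulrC ler_pdivrMr//.
  rewrite !(opB, compE).
  have k1 := bF p ((E p.+1 - E (p.+1 + n.+1)%N) u).
  have k2 := bF p (window P Q p.+1 n.+1 u).
  have k3 := bG p (window Q P p.+1 n.+1 u).
  have k4 : nr ((E p.+1 - E (p.+1 + n.+1)%N) u) <= 2 * nr u.
    rewrite opB; apply: le_trans (nrB_le _ _) _.
    by have := bE p.+1 u; have := bE (p.+1 + n.+1)%N u; rewrite !mul1r; lra.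
  have t1 := ler_wpM2l b0 (le_trans k4 hn).
  have t2 := ler_wpM2l b0 (h1 p.+1).
  have t3 := ler_wpM2l b0 (h2 p.+1).
  have t4 : (4 * b + 1) * (eps / (4 * b + 1) * n.+1%:R) = eps * n.+1%:R.
    by rewrite mulrA mulrCA mulfV ?mulr1// gt_eqF.
  have t5 : 0 <= eps / (4 * b + 1) * n.+1%:R by rewrite mulr_ge0// ltW.
  rewrite -t4; apply: le_trans (nrB_le _ _) _; apply: le_trans (lerD (nrB_le _ _) (lexx _)) _.
  move: k1 k2 k3 t1 t2 t3 t5; move: (nr _) (nr _) (nr _) (nr _) (nr _) (nr _) (eps / _ * _) => *; nra.
rewrite subr0 /Rm /smean op_sum; apply: le_trans (nr_sum _ _ _) _.
apply: (@le_trans _ _ (\sum_(p < n.+1) n.+1%:R^-1 * eps)).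
  by apply: ler_sum => p _; rewrite opZ nrZ nrC ger0_norm ?invr_ge0// ler_wpM2l ?invr_ge0//; exact: row.
by rewrite sumr_const card_ord -[leLHS]mulr_natl mulrA mulfV ?mul1r// gt_eqF.
Qed.

End Remainder.

(** Inverting the words exchanges [p] and [q], and the double mean weights all pairs equally, so
    [ell_flip] may be summed over the pairs [(p, q)] and [(q, p)]. *)
Let mean_flip n :
  tau (smean c1 (fun p => smean c1 (fun q => wsum (p + q).+1 (fun x => B (take p.+1 x) ** ell x)) n) n) +
  (tau (smean c1 (fun p => smean c1 (fun q => wsum (p + q).+1 (fun x => B (take p.+1 x) ** ell x)) n) n))^* =
  tau (smean c1 (fun p => smean c1 (fun q => wsum (p + q).+1 ell) n) n ** CT).
Proof.
pose g p q := tau (wsum (p + q).+1 (fun x => B (take p.+1 x) ** ell x)).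
pose k p q := tau (wsum (p + q).+1 ell ** CT).
have gk p q : g p q + (g q p)^* = k p q.
  rewrite /g /k (addnC q p) (wsum_winv _ (fun x => B (take q.+1 x) ** ell x)) (wsum_winv _ ell).
  rewrite /wsum comp_suml !tau_sum rmorph_sum -big_split; apply: eq_bigr => t _ /=.
  by apply: ell_flip; rewrite size_tuple.
have r0 : (n.+1%:R^-1 : R)%:C%C^* = (n.+1%:R^-1 : R)%:C%C by exact: conjR.
have -> : tau (smean c1 (fun p => smean c1 (fun q => wsum (p + q).+1 (fun x => B (take p.+1 x) ** ell x)) n) n) =
    \sum_(p < n.+1) \sum_(q < n.+1) (n.+1%:R^-1 : R)%:C%C * ((n.+1%:R^-1 : R)%:C%C * g p q).
  rewrite /smean tau_sum; apply: eq_bigr => p _; rewrite tauZ tau_sum mulr_sumr.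
  by apply: eq_bigr => q _; rewrite tauZ.
have -> : tau (smean c1 (fun p => smean c1 (fun q => wsum (p + q).+1 ell) n) n ** CT) =
    \sum_(p < n.+1) \sum_(q < n.+1) (n.+1%:R^-1 : R)%:C%C * ((n.+1%:R^-1 : R)%:C%C * k p q).
  rewrite /smean comp_suml tau_sum; apply: eq_bigr => p _; rewrite compZl tauZ comp_suml tau_sum mulr_sumr.
  by apply: eq_bigr => q _; rewrite compZl tauZ.
rewrite [X in _ + X^* ]exchange_big rmorph_sum -big_split; apply: eq_bigr => p _ /=.
rewrite rmorph_sum -big_split; apply: eq_bigr => q _ /=.
by rewrite !rmorphM /= r0 -!mulrDr gk.
Qed.

(** In [mean_flip] the means with [B] tend to [adj T ** A + adj T ** A'] and those of [ell] alone to
    [2]; the latter is [remainder] with both families constant equal to 1. Passing to the limit in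
    [tau] and halving gives the claim. *)
Lemma trace_identity A A' :
  wlim U (smean c1 (fun i => diag P P' T (i + 1))) A ->
  wlim U (smean c1 (fun i => diag Q P' T (i + 1))) A' ->
  complex.Re (tau (adj T ** A)) + complex.Re (tau (adj T ** A')) = complex.Re (tau CT).
Proof.
move=> hA hA'.
have s1 := @slow_uniform R.
have [b b0 bT] := bnd_ex T.
have bd (P0 : word -> op H H) k : psystem W P0 -> bnd (b * b) (adj T ** diag P0 P' T k).
  by move=> s0; apply: bnd_comp => //; [exact: bnd_adj|exact: (bnd_diag s0 sP')].
have bb0 : 0 <= b * b by rewrite mulr_ge0.
have bP p : bnd (b * b) (Phi p.+1) by exact: bd.
have bQ p : bnd (b * b) (Psi p.+1) by exact: bd.
have wP : wlim U (smean c1 (fun p => Phi p.+1)) (adj T ** A).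
  move=> u v; apply: eq_ulim (wlim_compl (adj T) hA u v) => n.
  by rewrite smean_compl; congr (inner (opf _ u) v); apply: eq_smean => i; rewrite addn1.
have wQ : wlim U (smean c1 (fun p => Psi p.+1)) (adj T ** A').
  move=> u v; apply: eq_ulim (wlim_compl (adj T) hA' u v) => n.
  by rewrite smean_compl; congr (inner (opf _ u) v); apply: eq_smean => i; rewrite addn1.
pose G n := smean c1 (fun p => smean c1 (fun q => wsum (p + q).+1 (fun x => B (take p.+1 x) ** ell x)) n) n.
pose K n := smean c1 (fun p => smean c1 (fun q => wsum (p + q).+1 ell) n) n.
have mean1 (f : nat -> op H H) g n :
    smean c1 (fun p => smean c1 (fun q => f p + g p q) n) n =
    smean c1 f n + smean c1 (fun p => smean c1 (g p) n) n.
  rewrite -smeanD; apply: eq_smean => p; rewrite smeanD; congr (_ + _).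
  exact: smean_uniform_cst.
pose RG := fun n => smean c1 (fun p => smean c1 (remainder (fun p => Phi p.+1) (fun p => Psi p.+1) p) n) n.
pose RK := fun n => smean c1 (fun p => smean c1 (remainder (fun _ => op1 H) (fun _ => op1 H) p) n) n.
have GE n : G n = smean c1 (fun p => Phi p.+1) n + smean c1 (fun p => Psi p.+1) n + RG n.
  rewrite -smeanD -mean1; apply: eq_smean => p; apply: eq_smean => q; exact: wsum_B_ell.
have KE n : K n = smean c1 (fun p => op1 H + op1 H) n + RK n.
  rewrite -mean1; apply: eq_smean => p; apply: eq_smean => q; rewrite wsum_ell /remainder !comp1l !addSn.
  by rewrite addrA.
have b1 : forall p : nat, bnd 1 (op1 H) by move=> _ u; rewrite mul1r.
have wG : wlim U G (adj T ** A + adj T ** A').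
  have h : wlim U (fun n => smean c1 (fun p => Phi p.+1) n + smean c1 (fun p => Psi p.+1) n + RG n) (adj T ** A + adj T ** A' + 0).
    by apply: wlimD; [exact: wlimD|exact: (wlim_remainder bb0 bP bQ)].
  rewrite addr0 in h.
  move=> u v; refine (eq_ulim _ (h u v)) => n; by rewrite GE.
have wK : wlim U K (op1 H + op1 H).
  have h : wlim U (fun n => op1 H + op1 H + RK n) (op1 H + op1 H + 0).
    by apply: wlimD; [exact: wlim_cst|exact: (wlim_remainder ler01 b1 b1)].
  rewrite addr0 in h; move=> u v; apply: eq_ulim (h u v) => n; rewrite KE.
  by congr (inner (opf (_ + _) u) v); rewrite smean_uniform_cst.
have bG n : bnd (b * b + b * b + 4 * (b * b)) (G n).
  rewrite GE; apply: bndD; last exact: bnd_remainder.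
  by apply: bndD; apply: bnd_smean.
have bK n : bnd ((1 + 1) + 4 * 1) (K n).
  rewrite KE; apply: bndD; last exact: bnd_remainder.
  by apply: bnd_smean => // i; apply: bndD; exact: (b1 0%N).
have tG : ulim U (fun n => tau (G n)) (tau (adj T ** A + adj T ** A')).
  by apply: tau_wlim wG; [|exact: bG]; rewrite !addr_ge0// mulr_ge0.
have [d d0 bC] := bnd_ex CT.
have tK : ulim U (fun n => tau (K n ** CT)) (tau ((op1 H + op1 H) ** CT)).
  apply: (tau_wlim _ (c := (1 + 1 + 4 * 1) * d)); last exact: wlim_compr.
    by rewrite mulr_ge0// !addr_ge0// mulr_ge0.
  by move=> n; apply: bnd_comp => //; rewrite !addr_ge0// mulr_ge0.
have h : tau (adj T ** A + adj T ** A') + (tau (adj T ** A + adj T ** A'))^* = tau ((op1 H + op1 H) ** CT).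
  apply: (@ulim_unique R U UU _ (fun n => tau (K n ** CT))) tK.
  by apply: eq_ulim (ulimD tG (ulim_conj tG)) => n; exact: mean_flip.
have := congr1 (@complex.Re R) h; rewrite ReD Re_conj tauD ReD compDl !comp1l tauD ReD.
move: (complex.Re (tau (_ ** A))) (complex.Re (tau (_ ** A'))) (complex.Re (tau CT)) => x y z; lra.
Qed.

End TraceIdentity.

(** * The commutant and the splitting of isometries *)

Section Commutant.
Variables (R : realType) (I : finType) (H : hilbertType R).
Local Notation C := R[i].
Local Notation word := (seq (letter I)).
Variable W : letter I -> op H H.
Hypothesis uW : unitary_letters W.
Variables P Q : word -> op H H.
Hypothesis sP : psystem W P.
Hypothesis sQ : psystem W Q.

(** The hypothesis says that [Q a] fixes the range of [P a S]. Then [Q a P b S = 0] for [a <> b],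
    and summing over [b] gives [Q a S = P a S]. Longer words follow by covariance, as [S] commutes
    with the group. *)
Lemma cross0_agree (S : op H H) : (forall a, W a ** S = S ** W a) ->
  (forall a, cross P Q a ** S = 0) -> forall w, P w ** S = Q w ** S.
Proof.
move=> hW h.
have QP a : Q [:: a] ** P [:: a] ** S = P [:: a] ** S.
  by apply/esym/eqP; rewrite -subr_eq0 -compBl -{1}[P [:: a]]comp1l -compBl; apply/eqP; exact: h.
have QPn a b : a != b -> Q [:: a] ** P [:: b] ** S = 0.
  move=> ab; rewrite -compA -QP !compA (ps_orth sQ) ?comp0l//.
  by move=> [e]; rewrite e eqxx in ab.
have h1 a : P [:: a] ** S = Q [:: a] ** S.
  rewrite -[in RHS](comp1l S) -(ps_wsum1 sP 1) wsum1 comp_suml comp_sumr (bigD1 a)//= big1 ?addr0.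
    by rewrite compA QP.
  by move=> b ba; rewrite compA QPn// eq_sym.
elim=> [|a [|b w] IH]; [by rewrite (ps1 sP) (ps1 sQ)|exact: h1|].
have [r|r] := boolP (reduced [:: a, b & w]); last by rewrite (ps_red sP r) (ps_red sQ r).
have [_ e1] := uW a.
have key (P0 : word -> op H H) : psystem W P0 ->
    P0 [:: a, b & w] ** S = W a ** (P0 (b :: w) ** S) ** W (linv a).
  by move=> s0; rewrite -!compA -hW !compA (ps_fwd s0)// -[_ ** _ ** W (linv a)]compA e1 comp1r.
by rewrite (key P)// (key Q)// IH.
Qed.

Hypothesis iP : sys_irreducible W P.
Hypothesis inequiv : forall J : op H H, adj J ** J = op1 H -> J ** adj J = op1 H ->
    (forall a, W a ** J = J ** W a) -> (forall w, P w ** J = J ** Q w) -> False.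

Let PQ_neq : ~ (forall w, P w = Q w).
Proof.
move=> h; apply: (inequiv (J := op1 H)); rewrite ?adj1 ?comp1l// => x; rewrite comp1l comp1r//.
Qed.

Lemma cross_nontrivial : exists a, cross P Q a <> 0.
Proof.
apply: contrapT => /forallNP h; apply: PQ_neq => w.
rewrite -[LHS]comp1r -[RHS]comp1r; apply: cross0_agree => a; first by rewrite comp1l comp1r.
by rewrite comp1r; apply: contrapT; exact: h.
Qed.

Lemma ps_mul_cases (P0 : word -> op H H) w x : psystem W P0 ->
  P0 w ** P0 x = if prefix w x then P0 x else if prefix x w then P0 w else 0.
Proof.
move=> s0; have pre (u v : word) : take (size u) v = u -> v = u ++ drop (size u) v.
  by move=> {1}<-; rewrite cat_take_drop.
case: ifP => [/prefixP[t ->]|wx]; first exact: (ps_mul s0).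
case: ifP => [/prefixP[t ->]|xw]; first exact: (ps_mulr s0).
have [sw|sw] := leqP (size w) (size x).
  rewrite -(cat_take_drop (size w) x); apply: (ps_orth_cat s0); first by rewrite size_takel.
  by move=> e; move/negP: wx; apply; rewrite prefixE -e.
rewrite -(cat_take_drop (size x) w); apply: (ps_orth_catr s0); first by rewrite size_takel// ltnW.
by move=> e; move/negP: xw; apply; rewrite prefixE -e.
Qed.

(** The vectors on which the two systems agree form a closed subspace invariant under [W] and [P].
    It is not the whole space, since otherwise the identity would be an equivalence. *)
Lemma agree_eq0 u : (forall w, P w u = Q w u) -> u = 0.
Proof.
pose V := [set u | forall w, P w u = Q w u].
have lV : linear_subspace V.
  split=> [w|c v v' hv hv' w]; first by rewrite !op0r.
  by rewrite !opDr !opZr hv hv'.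
have cV : closed V.
  rewrite (_ : V = \bigcap_(w in setT) [set v | P w v = Q w v]).
    by apply: closed_bigI => w _; exact: (closed_eq_op (P w) (Q w)).2.
  by apply/seteqP; split=> v /= hv w => [_|]; exact: hv.
(* On [V] the operators [P w] and [Q w] coincide, and both systems have the same multiplication
   table. *)
have PV w v : V v -> V (P w v).
  move=> hv x; rewrite {2}hv -!compE !ps_mul_cases//.
  by case: ifP => _; [exact: hv|case: ifP => _; [exact: hv|]].
have WV a v : V v -> V (W a v).
  move=> hv; suff h w : P w (W a v) = Q w (W a v) by [].
  have [_ e1] := uW a; have [_ e2] := uW (linv a); rewrite linvK in e2.
  case: w => [|b w]; first by rewrite (ps1 sP) (ps1 sQ).
  have [<-|ba] := eqVneq a b.
    case: w => [|c w].
      by rewrite -!compE (ps_back sP) (ps_back sQ) !compE !opB hv.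
    have [r|r] := boolP (reduced [:: a, c & w]); last by rewrite (ps_red sP r) (ps_red sQ r).
    by rewrite -!compE -(ps_fwd sP)// -(ps_fwd sQ)// !compE hv.
  have [r|r] := boolP (reduced (b :: w)); last by rewrite (ps_red sP r) (ps_red sQ r).
  have r' : reduced [:: linv a, b & w] by rewrite /= linvK eq_sym ba.
  have key (P0 : word -> op H H) : psystem W P0 -> P0 (b :: w) ** W a = W a ** P0 [:: linv a, b & w].
    move=> s0; have := ps_fwd s0 r' (fun e => ltac:(discriminate e)).
    move=> /(congr1 (fun S => W a ** S ** W a)).
    by rewrite !compA e1 comp1l -!compA e2 comp1r => ->.
  by rewrite -!compE (key P)// (key Q)// !compE hv.
move=> hu; have [V0|VT] := iP lV cV WV PV; first by move: (hu : V u); rewrite V0.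
by exfalso; apply: PQ_neq => w; apply: opP => v; have : V v by rewrite VT.
Qed.

Variable U : set_system nat.
Context {UU : UltraFilter U}.
Hypothesis Uoo : \oo `<=` U.
Variable e : nat -> H.
Hypothesis he : onbasis e.
Hypothesis hX : forall a, isHS e (cross P Q a).

(** Here [tau] of [S] is the sum of the squared Hilbert-Schmidt norms of [S ** adj (cross P Q a)].
    If it vanishes, every [cross P Q a] kills the range of [S], on which the two systems then
    agree. *)
Lemma tau_proj_eq0 (S : op H H) : adj S = S -> S ** S = S -> (forall a, W a ** S = S ** W a) ->
  complex.Re (tau P Q U e S) = 0 -> S = 0.
Proof.
move=> aS SS hW h0.
have hSZ a : isHS e (S ** adj (cross P Q a)) by apply: isHS_compl; exact: isHS_adj.
have tE : tau P Q U e S = \sum_a hs U e (S ** adj (cross P Q a)) (S ** adj (cross P Q a)).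
  by apply: eq_bigr => a _; rewrite [LHS]hs_move [RHS]hs_move aS compA SS.
have g0 a : 0 <= complex.Re (hs U e (S ** adj (cross P Q a)) (S ** adj (cross P Q a))).
  exact: (Re_hs_ge0 Uoo).
have XS a : cross P Q a ** S = 0.
  apply: (can_inj (@adjK _ _ _)); rewrite adj_comp aS adj0; apply: (hs_eq0 Uoo he (hSZ a)).
  rewrite (hs_real (hSZ a)) (_ : complex.Re _ = 0)//.
  apply/eqP; rewrite eq_le g0 andbT -h0 tE (bigD1 a)//= ReD lerDl.
  by elim/big_rec: _ => [//|b x _ hx]; rewrite ReD addr_ge0.
have PS := cross0_agree hW XS.
by apply: opP => u; apply: agree_eq0 => w; rewrite -!compE PS.
Qed.

End Commutant.

Section Pair.
Variables (R : realType) (I : finType) (H : hilbertType R).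
Local Notation C := R[i].
Local Notation word := (seq (letter I)).
Variable W : letter I -> op H H.
Hypothesis uW : unitary_letters W.
Variables P Q : word -> op H H.
Hypothesis sP : psystem W P.
Hypothesis sQ : psystem W Q.
Hypothesis iP : sys_irreducible W P.
Hypothesis iQ : sys_irreducible W Q.
Hypothesis inequiv : forall J : op H H, adj J ** J = op1 H -> J ** adj J = op1 H ->
    (forall a, W a ** J = J ** W a) -> (forall w, P w ** J = J ** Q w) -> False.
Variable U : set_system nat.
Context {UU : UltraFilter U}.
Hypothesis Uoo : \oo `<=` U.
Variable e : nat -> H.
Hypothesis he : onbasis e.
Hypothesis hX : forall a, isHS e (cross P Q a).
Hypothesis hX' : forall a, isHS e (cross Q P a).

Let c1 : nat -> nat -> R := fun n _ => n.+1%:R^-1.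

Let intertwiner0 (Z : op H H) : (forall a, W a ** Z = Z ** W a) ->
  (forall w, P w ** Z = Z ** Q w) -> Z = 0.
Proof. exact: (sys_intertwiner0 uW sP sQ iP iQ inequiv). Qed.

Let intertwiner0' (Z : op H H) : (forall a, W a ** Z = Z ** W a) ->
  (forall w, Q w ** Z = Z ** P w) -> Z = 0.
Proof.
move=> hW hZ; apply: (can_inj (@adjK _ _ _)); rewrite adj0; apply: intertwiner0; first exact: comm_adj.
by move=> w; have := congr1 (@adj _ _ _) (hZ w); rewrite !adj_comp (ps_adj sP) (ps_adj sQ) => ->.
Qed.

Let cross_nontrivial' : exists a, cross Q P a <> 0.
Proof.
apply: (cross_nontrivial uW sQ sP) => J J1 J2 hW hJ.
apply: (inequiv (J := adj J)); rewrite ?adjK//; first exact: comm_adj.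
by move=> w; have := congr1 (@adj _ _ _) (hJ w); rewrite !adj_comp (ps_adj sP) (ps_adj sQ) => ->.
Qed.

Let flatPQ u : flat P Q U u.
Proof. exact: (flat_all uW sP sQ Uoo he hX intertwiner0 _ iQ (cross_nontrivial uW sP sQ inequiv)). Qed.

Let flatQP u : flat Q P U u.
Proof. exact: (flat_all uW sQ sP Uoo he hX' intertwiner0' _ iP cross_nontrivial'). Qed.

Let mean_ex (H' : hilbertType R) (P0 : word -> op H H) (P' : word -> op H' H')
    (W' : letter I -> op H' H') (T : op H H') : psystem W P0 -> psystem W' P' ->
  exists S, wlim U (smean c1 (fun i => diag P0 P' T (i + 1))) S.
Proof.
move=> s0 s'; have [b b0 bT] := bnd_ex T.
have [S hS _] := wlim_ex b0 (fun n => bnd_smean (@slow_uniform R) n b0 (fun i => bnd_diag s0 s' (i + 1) b0 bT)).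
by exists S.
Qed.

(** Schur's lemma for [P] makes the limit [A] a scalar, and inequivalence makes the limit that
    starts from [Q] zero. What is left of the trace identity is the second equation. *)
Let proj_mean (S A : op H H) : adj S = S -> S ** S = S -> (forall a, W a ** S = S ** W a) ->
  wlim U (smean c1 (fun i => diag P P S (i + 1))) A ->
  exists2 b : R, A = b%:C%C *: op1 H & b * complex.Re (tau P Q U e S) = complex.Re (tau P Q U e S).
Proof.
move=> aS SS hW hA.
have [A' hA'] := mean_ex S sQ sP.
have [h1 h2] := smean_diag_intertwines Uoo (@slow_uniform R) uW uW sP sP (fun a => hW a) hA.
have [h3 h4] := smean_diag_intertwines Uoo (@slow_uniform R) uW uW sQ sP (fun a => hW a) hA'.
have A0 : A' = 0 by exact: intertwiner0.
have aA : adj A = A.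
  apply: (@wlim_unique R U _ _ _ _ _ _ (wlim_adj hA)) => u v; apply: eq_ulim (hA u v) => n.
  congr (inner (opf _ u) v); rewrite /smean adj_sum; apply: eq_bigr => i _.
  by rewrite adjZ conjR (adj_diag _ _ sP sP) aS.
have [b bA] := sys_schur_selfadj iP aA h2 h1.
exists b => //; have : complex.Re (tau P Q U e (adj S ** A)) + complex.Re (tau P Q U e (adj S ** A')) =
    complex.Re (tau P Q U e (adj S ** S)).
  exact: (trace_identity uW uW sP sQ sP Uoo he hX hW flatPQ flatQP hA hA').
by rewrite aS A0 comp0r (tau0 he hX) bA compZr comp1r (tauZ he hX) ReZ SS addr0.
Qed.

(** If [S] is nonzero, [proj_mean] forces its limit to be 1. The limit for [1 - S] is then 0, so
    [proj_mean] for [1 - S] says that its [tau] has real part 0. *)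
Lemma commutant_proj (S : op H H) : adj S = S -> S ** S = S -> (forall a, W a ** S = S ** W a) ->
  S = 0 \/ S = op1 H.
Proof.
move=> aS SS hW.
have [A hA] := mean_ex S sP sP.
have aS' : adj (op1 H - S) = op1 H - S by rewrite adjB adj1 aS.
have SS' : (op1 H - S) ** (op1 H - S) = op1 H - S.
  by rewrite compBr comp1r compBl comp1l SS subrr subr0.
have hW' a : W a ** (op1 H - S) = (op1 H - S) ** W a by rewrite compBr compBl comp1l comp1r hW.
have hA' : wlim U (smean c1 (fun i => diag P P (op1 H - S) (i + 1))) (op1 H - A).
  have h : wlim U (fun n => op1 H - smean c1 (fun i => diag P P S (i + 1)) n) (op1 H - A).
    by apply: wlimD; [exact: wlim_cst|exact: wlimN].
  move=> u v; apply: eq_ulim (h u v) => n; congr (inner (opf _ u) v).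
  have cst : smean c1 (fun _ => op1 H) n = op1 H.
    exact: smean_uniform_cst.
  rewrite -{1}cst /smean -sumrB; apply: eq_bigr => i _; rewrite -scalerBr; congr (_ *: _).
  rewrite /diag -[X in X - _ = _](ps_wsum1 sP (i + 1)) -wsumB; apply: eq_wsum => t _.
  by rewrite compBr compBl comp1r (ps_idem sP).
have [b bA b1] := proj_mean aS SS hW hA.
have [b' bA' b2] := proj_mean aS' SS' hW' hA'.
have [->|S0] := eqVneq S 0; first by left.
right; apply/eqP; rewrite eq_sym -subr_eq0; apply/eqP; apply: (tau_proj_eq0 uW sP sQ iP inequiv Uoo he hX aS' SS' hW').
have t0 : complex.Re (tau P Q U e S) != 0.
  by apply/eqP => t0; case/eqP: S0; exact: (tau_proj_eq0 uW sP sQ iP inequiv Uoo he hX aS SS hW t0).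
have eb : b = 1 by apply: (mulIf t0); rewrite b1 mul1r.
have : b' *: (0 : R^o) = 0 by rewrite scaler0.
have A1 : op1 H - A = 0 by rewrite bA eb rmorph1 scale1r subrr.
move: bA'; rewrite A1 => bA' _.
have [b0|b0] := eqVneq b' 0; first by rewrite -b2 b0 mul0r.
have I0 : op1 H = 0 by move/esym/eqP: bA'; rewrite scaler_eq0 (inj_eq (@complexI R)) (negbTE b0) => /eqP.
by case/eqP: S0; rewrite -[S]comp1l I0 comp0l.
Qed.

Lemma commutant_irreducible (V : set H) : linear_subspace V -> closed V ->
  (forall a u, V u -> V (W a u)) -> V = [set 0] \/ V = setT.
Proof.
move=> lV cV WV; have [S [aS VS SV]] := proj_ex lV cV.
have SS : S ** S = S by apply: opP => u; rewrite compE SV.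
have hW a : W a ** S = S ** W a.
  apply/esym/(proj_comm aS VS SV) => u; first exact: WV.
  by have [-> _] := uW a; exact: WV.
have [S0|S1] := commutant_proj aS SS hW; [left|right]; apply/seteqP; split=> u //=.
- by move=> Vu; rewrite -(SV u Vu) S0.
- by move=> ->; have [] := lV.
- by move=> _; have := VS u; rewrite S1.
Qed.

(** [adj T ** S] commutes with the group, hence is a scalar [c] by [commutant_irreducible]. As [S]
    intertwines the projections, [adj S] times a diagonal part of [T] is already the conjugate of
    [c], at every level; the limit is [adj S ** S]. So [c] is real and nonnegative. *)
Lemma intertwiner_gram (H' : hilbertType R) (W' : letter I -> op H' H') (P0 : word -> op H H)
    (P' : word -> op H' H') (T S : op H H') :
  unitary_letters W' -> psystem W P0 -> psystem W' P' -> adj T ** T = op1 H ->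
  (forall a, W' a ** T = T ** W a) ->
  wlim U (smean c1 (fun i => diag P0 P' T (i + 1))) S ->
  exists a : R, [/\ 0 <= a, adj T ** S = a%:C%C *: op1 H, adj S ** S = a%:C%C *: op1 H,
    forall w, P' w ** S = S ** P0 w & forall b, W' b ** S = S ** W b].
Proof.
move=> uW' s0 s' TT hT hS.
have [h1 h2] := smean_diag_intertwines Uoo (@slow_uniform R) uW uW' s0 s' hT hS.
have aT := adj_intertwiner uW uW' hT.
have com b : W b ** (adj T ** S) = adj T ** S ** W b by rewrite compA -aT -compA h2 compA.
have [c cE] : exists c : C, adj T ** S = c *: op1 H.
  apply: (@schur _ _ [set X | exists b, X = W b]).
  - by move=> V lV cV hV; apply: commutant_irreducible => // b u; apply: hV; exists b.
  - by move=> X [b ->]; exact: com.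
  - by move=> X [b ->]; exact: (comm_adj uW com).
have gE : adj S ** S = c^* *: op1 H.
  apply/esym/(@wlim_unique R U _ _ _ _ _ _ _ (wlim_compl (adj S) hS)) => u v.
  apply: eq_ulim (ulim_cst (U := U) _) => n; congr (inner (opf _ u) v).
  rewrite smean_compl.
  have cst : smean c1 (fun _ => c^* *: op1 H) n = c^* *: op1 H.
    exact: smean_uniform_cst.
  rewrite -cst; apply: eq_smean => i.
  have aS w : adj S ** P' w = P0 w ** adj S.
    by have := congr1 (@adj _ _ _) (h1 w); rewrite !adj_comp (ps_adj s0) (ps_adj s').
  have ac : adj S ** T = c^* *: op1 H by rewrite -[LHS]adjK adj_comp adjK cE adjZ adj1.
  rewrite -(ps_wsum1 s0 (i + 1)) /diag /wsum comp_sumr scaler_sumr.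
  apply: eq_bigr => t _; rewrite !compA aS -[_ ** adj S ** T]compA ac compZr comp1r compZl.
  by rewrite (ps_idem s0).
have [I0|I0] := eqVneq (op1 H) 0.
  have z (X Y : op H H) : X = Y by rewrite -[X]comp1l -[Y]comp1l I0 !comp0l.
  by exists 0; split.
have cc : c^* = c.
  have := congr1 (@adj _ _ _) gE; rewrite adj_comp adjK gE adjZ adj1 conjCK => /eqP.
  by rewrite -subr_eq0 -scalerBl scaler_eq0 (negbTE I0) orbF subr_eq0 => /eqP.
have cR : c = (complex.Re c)%:C%C.
  have := ReE c; rewrite cc -mulr2n rmorphMn /= => h.
  by apply: (mulIf (x := 2)); rewrite ?pnatr_eq0// !mulr_natr.
have [u hu] : exists u : H, u != 0.
  apply: contrapT => /forallNP h; case/eqP: I0; apply: opP => u.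
  by apply/eqP; apply: contrapT => hu; apply: (h u); apply/negP.
exists (complex.Re c); rewrite -cR; split=> //; last by rewrite gE cc.
have := adj_comp_ge0 (Z := S) (c := complex.Re c); rewrite -cR -{1}cc => /(_ gE u) h.
have nu : 0 < nr u ^+ 2 by rewrite exprn_gt0// lt0r nr_eq0 hu nr_ge0.
by rewrite -(pmulr_lge0 _ nu) -h exprn_ge0 ?nr_ge0.
Qed.

(** [adj S ** S'] intertwines [Q] with [P], hence vanishes. The trace identity gives [a + b = 1]
    because [tau] of the identity is nonzero, and the Gram operator of [T - (S + S')] is the scalar
    [1 - (a + b)]. *)
Lemma isometry_splits (H' : hilbertType R) (W' : letter I -> op H' H')
    (P' : word -> op H' H') (T : op H H') :
  unitary_letters W' -> psystem W' P' -> adj T ** T = op1 H ->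
  (forall a, W' a ** T = T ** W a) ->
  exists (S S' : op H H') (a b : R),
  [/\ [/\ T = S + S', 0 <= a, 0 <= b & a + b = 1],
      [/\ adj S ** S = a%:C%C *: op1 H, adj S' ** S' = b%:C%C *: op1 H & adj S ** S' = 0],
      forall w, P' w ** S = S ** P w, forall w, P' w ** S' = S' ** Q w &
      forall c, W' c ** S = S ** W c /\ W' c ** S' = S' ** W c].
Proof.
move=> uW' s' TT hT.
have [S hS] := mean_ex T sP s'.
have [S' hS'] := mean_ex T sQ s'.
have [a [a0 TS SS PS WS]] := intertwiner_gram uW' sP s' TT hT hS.
have [b [b0 TS' SS' QS' WS']] := intertwiner_gram uW' sQ s' TT hT hS'.
have aW := adj_intertwiner uW uW' WS.
have aP w : adj S ** P' w = P w ** adj S.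
  by have := congr1 (@adj _ _ _) (PS w); rewrite !adj_comp (ps_adj sP) (ps_adj s').
have S0 : adj S ** S' = 0.
  apply: intertwiner0 => [c|w]; first by rewrite compA -aW -compA WS' compA.
  by rewrite compA -aP -compA QS' compA.
have ab : a + b = 1.
  have h : complex.Re (tau P Q U e (adj T ** S)) + complex.Re (tau P Q U e (adj T ** S')) =
      complex.Re (tau P Q U e (adj T ** T)).
    exact: (trace_identity uW uW' sP sQ s' Uoo he hX hT flatPQ flatQP hS hS').
  move: h; rewrite TS TS' TT !(tauZ he hX) !ReZ -mulrDl => h.
  have t0 : complex.Re (tau P Q U e (op1 H)) != 0.
    apply/eqP => t0; have [c []] := cross_nontrivial uW sP sQ inequiv.
    rewrite -[cross P Q c]comp1r.
    rewrite [op1 H](tau_proj_eq0 uW sP sQ iP inequiv Uoo he hX (@adj1 _ H) (comp1l _) _ t0) ?comp0r//.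
    by move=> d; rewrite comp1l comp1r.
  by apply: (mulIf t0); rewrite h mul1r.
exists S, S', a, b; split=> //; split=> //.
apply/eqP; rewrite -subr_eq0; apply/eqP; apply: opP => u; apply: nr_le0.
have : adj (T - (S + S')) ** (T - (S + S')) = 0.
  have ST : adj S ** T = a%:C%C *: op1 H by rewrite -[LHS]adjK adj_comp adjK TS adjZ adj1 conjR.
  have ST' : adj S' ** T = b%:C%C *: op1 H by rewrite -[LHS]adjK adj_comp adjK TS' adjZ adj1 conjR.
  have S0' : adj S' ** S = 0 by rewrite -[LHS]adjK adj_comp adjK S0 adj0.
  rewrite adjB adjD !(compBl, compBr, compDl, compDr) TT TS TS' ST ST' SS SS' S0 S0'.
  by rewrite addr0 add0r subrr subr0 -scalerDl -rmorphD ab scale1r subrr.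
move=> h; have := Re_inner_nr ((T - (S + S')) u); rewrite adjE -compE h op0 inner0r => /esym/eqP.
by rewrite sqrf_eq0 => /eqP ->.
Qed.

End Pair.

(** * Functions on the boundary and crossed representations *)

Transparent op_comp adj hs.

Section BoundaryFunctions.
Variables (R : realType) (I : finType).
Local Notation C := R[i].
Local Notation word := (seq (letter I)).
Local Notation fcts := (continuousType (boundary I) R[i]).
Implicit Types (a b : letter I) (x y : word) (w : boundary I) (F G : fcts).

(** Unlike [cylinder], this is defined for arbitrary lists and sequences, which allows induction on
    words and passage to tails. *)
Definition starts x (w : nat -> letter I) : Prop := forall n, (n < size x)%N -> nth (w n) x n = w n.

Lemma starts_mkseq (w : nat -> letter I) n : starts (mkseq w n) w.
Proof. by move=> k; rewrite size_mkseq => kn; rewrite nth_mkseq. Qed.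

Lemma starts_eq x (w : nat -> letter I) : starts x w -> x = mkseq w (size x).
Proof.
move=> h; apply: (@eq_from_nth _ (w 0%N)); rewrite ?size_mkseq// => i ix.
by rewrite nth_mkseq// -[RHS]h//; apply: set_nth_default.
Qed.

Lemma starts_reduced x w : starts x w -> reduced x.
Proof. by move=> /starts_eq ->; exact: prefix_reduced. Qed.

Lemma starts_rcons x a (w : nat -> letter I) : starts (rcons x a) w <-> starts x w /\ w (size x) = a.
Proof.
split=> [h|[h1 h2] n].
  split=> [n nx|]; last by have := h (size x); rewrite size_rcons ltnS leqnn => <-//; rewrite nth_rcons ltnn eqxx.
  by rewrite -[RHS]h ?size_rcons ?leqW// nth_rcons nx.
rewrite size_rcons ltnS leq_eqVlt nth_rcons => /orP[/eqP ->|nx]; first by rewrite ltnn eqxx h2.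
by rewrite nx h1.
Qed.

Lemma starts_cons a x (w : nat -> letter I) :
  starts (a :: x) w <-> w 0%N = a /\ starts x (fun n => w n.+1).
Proof.
split=> [h|[h1 h2] [|n] //=]; last by move=> /h2.
by split=> [|n nx]; [have := h 0%N isT|exact: (h n.+1)].
Qed.

Lemma starts_cat x y (w : nat -> letter I) : starts (x ++ y) w -> starts x w.
Proof.
by elim: x w => [//|a x IH] w /starts_cons[wa /IH h]; apply/starts_cons.
Qed.

(* Koenig's lemma: otherwise some infinite word has only prefixes on whose cylinders [F] varies by more than [eps]. *)
Lemma uniform_prefix F (eps : R) : 0 < eps ->
  exists k, forall w w', (forall n, (n < k)%N -> w n = w' n) -> nr (F w - F w') <= eps.
Proof.
move=> e0; apply: contrapT => /forallNP hk.
pose bad x := forall k, (size x <= k)%N -> exists w w',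
  [/\ forall n, (n < k)%N -> w n = w' n, starts x w & eps < nr (F w - F w')].
have bad0 : bad [::].
  move=> k _; have /existsNP[w /existsNP[w' /not_implyP[h /negP]]] := hk k.
  by rewrite -ltNge => hd; exists w, w'.
have badS x : bad x -> exists a, bad (rcons x a).
  move=> bx; apply: contrapT => /forallNP hn.
  have /choice[K hK] : forall a, exists k, (size x < k)%N /\ ~ exists w w',
      [/\ forall n, (n < k)%N -> w n = w' n, starts (rcons x a) w & eps < nr (F w - F w')].
    move=> a; have /existsNP[k /not_implyP[k1 k2]] := hn a.
    by exists k; rewrite size_rcons in k1.
  (* The alphabet is finite, so one level exceeds all [K a]. The letter that follows [x] in a
     witness at this level contradicts its own [K]. *)
  have KM a : (K a <= \max_b K b)%N by exact: (leq_bigmax a).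
  have xM : (size x <= \max_b K b)%N.
    have [w _] := bx (size x) (leqnn _).
    by apply: leq_trans (KM (w 0%N)); apply: ltnW; case: (hK (w 0%N)).
  have [w [w' [ww' xw hd]]] := bx _ xM.
  have [_] := hK (w (size x)); apply; exists w, w'; split=> //.
    by move=> n nK; apply: ww'; exact: leq_trans nK (KM _).
  by apply/starts_rcons.
have /choice[nx hnx] : forall x, exists a, bad x -> bad (rcons x a).
  move=> x; have [/badS[a ha]|nb] := pselect (bad x); first by exists a.
  by have [w _] := bad0 0%N isT; exists (w 0%N).
pose X n := iter n (fun x => rcons x (nx x)) [::].
have bX n : bad (X n) by elim: n => //= n; exact: hnx.
have sX n : size (X n) = n by elim: n => //= n IH; rewrite size_rcons IH.
pose b n := nx (X n).
have XE n : X n = mkseq b n.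
  by elim: n => //= n IH; rewrite -[in RHS]addn1 /mkseq iotaD map_cat cats1 -/(mkseq b n) -IH.
have rb n : b n.+1 != linv (b n).
  have [w [w' [_ sw _]]] := bX n.+2 n.+2 (eq_leq (sX _)).
  have h1 := sw n; have h2 := sw n.+1.
  rewrite !XE !size_mkseq in h1 h2; move: (h1 (leqW (leqnn _))) (h2 (leqnn _)).
  by rewrite !nth_mkseq// => -> ->; exact: breduced.
pose w0 := Boundary rb.
have c0 : nbhs w0 [set w | nr (F w - F w0) <= eps / 2].
  have := @cts_fun _ _ F w0; move=> /cvgrPdist_le /(_ (eps / 2)%:C%C).
  rewrite ltcR divr_gt0// => /(_ isT); apply: filterS => w /=.
  by rewrite nrE lecR nrB.
have [n hn] := (nbhs_bprefix _ _).1 c0.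
have [w [w' [ww' sw]]] := bX n n (eq_leq (sX _)).
have hw (v : boundary I) : starts (X n) v -> nr (F v - F w0) <= eps / 2.
  move=> sv; apply: hn; apply/cylinder_bprefix => k kn.
  by rewrite -(sv k) ?sX// XE nth_mkseq.
have sw' : starts (X n) w'.
  move=> k; rewrite sX => kn; rewrite -ww'// -(sw k) ?sX//.
  by apply: set_nth_default; rewrite sX.
rewrite ltNge => /negP; apply; apply: le_trans (nr_triB _ (F w0) _) _.
by rewrite [leRHS]splitr lerD// ?hw// nrB hw.
Qed.

Lemma simple_approx F (eps : R) : 0 < eps ->
  exists k (c : word -> C), forall w, nr (F w - c (mkseq w k)) <= eps.
Proof.
move=> e0; have [k hk] := uniform_prefix F e0.
(* The value at a prefix is that of [F] at some boundary point with this prefix, and 0 if there is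
   none. *)
exists k, (fun t => xget 0 [set z | exists2 w : boundary I, starts t w & z = F w]) => w.
case: xgetP => [z _ [w' sw' ->]|hn].
  by apply: hk => n nk; rewrite -sw' ?size_mkseq// nth_mkseq.
by exfalso; apply: (hn (F w)); exists w => //; exact: starts_mkseq.
Qed.

End BoundaryFunctions.

(** * Group operators as products over letters *)

Section GroupOperators.
Variables (R : realType) (I : finType) (H : hilbertType R) (pi : unirep (freeGroup I) H).
Implicit Types (x y : freeGroup I) (a : letter I).

Lemma grp_axiom x : linear (pi x) /\ exists c : R, forall u, nr (pi x u) <= c * nr u.
Proof.
split; first exact: linearP.
exists 1 => u; rewrite mul1r; apply: le_from_sqr; first exact: nr_ge0.
by rewrite -!Re_inner_nr urep_isometry.
Qed.

Definition grp_op x : op H H := Op (grp_axiom x).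

Definition lop a : op H H := grp_op (fgletter a).

Lemma adj_grp_op x : adj (grp_op x) = grp_op x^-1%g.
Proof.
apply: adj_unique => u v; rewrite -[RHS](urep_isometry pi x) /=.
by rewrite -urepM mulgV urep1.
Qed.

Lemma fgletterV a : (fgletter a)^-1%g = fgletter (linv a).
Proof. exact: val_inj. Qed.

Lemma unitary_lop : unitary_letters lop.
Proof.
move=> a; split; first by rewrite /lop adj_grp_op fgletterV.
by apply: opP => u; rewrite compE /= -fgletterV -urepM mulgV urep1.
Qed.

Lemma grp_op_Uw (x : freeGroup I) : grp_op x = Uw lop x.
Proof.
case: x => x rx; elim: x rx => [|a x IH] rx /=.
  by apply: opP => u /=; rewrite -[RHS](urep1 pi); congr (pi _ u); exact: val_inj.
have rx' : reduced x by exact: path_sorted rx.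
rewrite -(IH rx'); apply: opP => u; rewrite compE /= -urepM; congr (pi _ u).
apply: val_inj => /=; move: rx; rewrite /push; case: (x) => //= b y /andP[ba _].
by rewrite (negbTE ba).
Qed.

End GroupOperators.

(** * The sup-norm bound and the system of a crossed representation *)

Section SupNorm.
Variables (R : realType) (I : finType) (H : hilbertType R) (rho : crossrep I H).
Local Notation C := R[i].
Local Notation word := (seq (letter I)).
Local Notation fcts := (continuousType (boundary I) R[i]).
Implicit Types (a b : letter I) (x y : word) (w : boundary I) (F G : fcts).
Local Notation A := (crep_alg rho).

Lemma alg_ext F G u : F =1 G -> A F u = A G u.
Proof. by move=> /continuousEP ->. Qed.

Let cone : fcts := cind_cylinder R 1%g.
Let czero : fcts := clin (-1) cone cone.

Lemma cind_cylinderE (x : freeGroup I) w : cind_cylinder R x w = `[< starts x w >]%:R.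
Proof.
rewrite -[LHS]/(\1_(cylinder x) w) indicE.
by congr (_%:R); congr nat_of_bool; apply/idP/asboolP; rewrite in_setE.
Qed.

Let coneE w : cone w = 1.
Proof. by rewrite cind_cylinderE; have /asboolP -> : starts (1%g : freeGroup I) w by []. Qed.

Let czeroE w : czero w = 0.
Proof. by change (-1 * cone w + cone w = 0); rewrite coneE mulr1 addNr. Qed.

Let A_czero u : A czero u = 0.
Proof. by rewrite crep_lin scaleN1r addNr. Qed.

Let cvgR (f : boundary I -> R) : (forall w (e : R), 0 < e ->
  nbhs w [set w' | `|f w - f w'| <= e]) -> continuous (fun w => (f w)%:C%C : C).
Proof.
move=> h w; apply/(@cvgrPdist_le R[i] R[i] _ _ (nbhs_filter w)) => e e0.
have eE : e = (complex.Re e)%:C%C by apply/esym/RRe_real; exact: gtr0_real.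
have e1 : 0 < complex.Re e by move: e0; rewrite {1}eE ltcR.
apply: filterS (h w _ e1) => w' /=; rewrite eE -rmorphB => h'.
by rewrite /= normc_def /= expr0n addr0 sqrtr_sqr lecR.
Qed.

Let near_nr F w (e : R) : 0 < e -> nbhs w [set w' | nr (F w - F w') <= e].
Proof.
move=> e0; have := @cts_fun _ _ F w; move=> /cvgrPdist_le /(_ e%:C%C).
by rewrite ltcR => /(_ e0); apply: filterS => w' /=; rewrite nrE lecR.
Qed.

Let defect F (c : R) w : R := Num.sqrt (c ^+ 2 - nr (F w) ^+ 2).

Lemma continuous_defect F c : continuous (fun w => (defect F c w)%:C%C : C).
Proof.
apply: cvgR => w e e0.
have cg : continuous (fun x : R => Num.sqrt (c ^+ 2 - x ^+ 2)).
  move=> x; apply: (@continuous_comp _ _ _ (fun x : R => c ^+ 2 - x ^+ 2)); last exact: sqrt_continuous.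
  by apply: (@continuousB _ R^o R^o); [exact: cst_continuous|exact: exprn_continuous].
have := cg (nr (F w)); move=> /cvgrPdist_le /(_ e e0) /nbhs_ballP[d /= d0 hd].
have d2 : 0 < d / 2 by rewrite divr_gt0.
apply: filterS (near_nr F w d2) => w' /= h; apply: hd; rewrite /ball /=.
apply: (@le_lt_trans _ _ (d / 2)); last by rewrite ltr_pdivrMr// mulr2n mulrDr mulr1 ltrDl.
rewrite ler_norml lerNl opprB.
have := nr_triB (F w) (F w') 0; have := nr_triB (F w') (F w) 0.
by rewrite !subr0 [nr (F w' - _)]nrB; move: h; move: (nr _) (nr _) (nr _) => x y z; lra.
Qed.

(* With [G = sqrt (c^2 - |F|^2)], the identity [F^* F + G^* G = c^2] gives [|rho(F) u|^2 + |rho(G) u|^2 = c^2 |rho(1) u|^2]. *)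
Lemma alg_bound F (c : R) u : 0 <= c -> (forall w, nr (F w) <= c) -> nr (A F u) <= c * nr u.
Proof.
move=> c0 hF; pose G : fcts := mkcts (@continuous_defect F c).
pose p := A cone u.
have sq K : inner (A K u) (A K u) = inner u (A (cmul (cconj K) K) u) by rewrite crep_star crep_mul.
(* So far the constant function 1 acts only as a projection, and that this does not increase norms
   has to be derived. *)
have pp : inner p p = inner u p.
  rewrite /p sq; congr (inner u _); apply: alg_ext => w.
  by change ((cone w)^* * cone w = cone w); rewrite coneE conjC1 mulr1.
have pu : nr p <= nr u.
  have [->|p0] := eqVneq (nr p) 0; first exact: nr_ge0.
  have p1 : 0 < nr p by rewrite lt0r p0 nr_ge0.
  rewrite -(ler_pM2r p1) -expr2 -Re_inner_nr pp.
  by apply: le_trans (ler_norm _) _; apply: le_trans (Re_le_nr _) _; exact: CS.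
have key : nr (A F u) ^+ 2 + nr (A G u) ^+ 2 = c ^+ 2 * nr p ^+ 2.
  rewrite -!Re_inner_nr -ReD -ReZ; congr complex.Re.
  rewrite (sq F) (sq G) pp -{1}(conjR (c ^+ 2)) -innerZr -innerDr; congr (inner u _).
  have -> : (c ^+ 2)%:C%C *: p = A (clin (c ^+ 2)%:C%C cone czero) u by rewrite crep_lin A_czero addr0.
  have -> : A (cmul (cconj F) F) u + A (cmul (cconj G) G) u =
      A (clin 1 (cmul (cconj F) F) (cmul (cconj G) G)) u by rewrite crep_lin scale1r.
  apply: alg_ext => w.
  change (1 * ((F w)^* * F w) + ((defect F c w)%:C%C^* * (defect F c w)%:C%C) = (c ^+ 2)%:C%C * cone w + czero w).
  rewrite coneE czeroE mulr1 addr0 mul1r mulrC nr_sqr conjR -rmorphM -rmorphD; congr (_%:C%C).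
  rewrite -expr2 sqr_sqrtr ?subr_ge0 ?ler_pXn2r ?nnegrE ?nr_ge0//.
  by rewrite addrC subrK.
apply: le_from_sqr; first by rewrite mulr_ge0 ?nr_ge0.
rewrite exprMn; apply: (@le_trans _ _ (c ^+ 2 * nr p ^+ 2)); first by rewrite -key lerDl sqr_ge0.
by rewrite ler_wpM2l ?sqr_ge0// ler_pXn2r ?nnegrE ?nr_ge0.
Qed.

Lemma alg_axiom F : linear (A F) /\ exists c : R, forall u, nr (A F u) <= c * nr u.
Proof.
split; first exact: linearP.
(* A bound for [F] comes from a step function within distance 1: it takes finitely many values. *)
have [k [c hc]] := simple_approx F ltr01.
have s0 : 0 <= \sum_(t : k.-tuple (letter I)) nr (c t) by apply: sumr_ge0 => t _; exact: nr_ge0.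
exists (1 + \sum_(t : k.-tuple (letter I)) nr (c t)) => u; apply: alg_bound => [|w]; first by rewrite addr_ge0.
rewrite -[F w](subrK (c (mkseq w k))); apply: le_trans (nrD _ _) _; apply: lerD; first exact: hc.
have tk : size (mkseq w k) == k by rewrite size_mkseq.
rewrite (bigD1 (Tuple tk))//= lerDl; apply: sumr_ge0 => t _; exact: nr_ge0.
Qed.

Definition alg_op F : op H H := Op (alg_axiom F).

Definition cylf (t : word) : fcts :=
  if insub t is Some x then cind_cylinder R (x : freeGroup I) else czero.

Lemma cylfE t w : cylf t w = `[< starts t w >]%:R.
Proof.
rewrite /cylf; case: insubP => [x _ <-|r]; first exact: cind_cylinderE.
by rewrite czeroE; case: asboolP => // /starts_reduced; rewrite (negbTE r).
Qed.

Definition cyl t : op H H := alg_op (cylf t).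

Lemma comb_ex (J : Type) (s : seq J) (c : J -> C) (t : J -> word) u : exists F : fcts,
  A F u = \sum_(j <- s) c j *: cyl (t j) u /\ forall w, F w = \sum_(j <- s) c j * `[< starts (t j) w >]%:R.
Proof.
elim: s => [|j s [F [F1 F2]]].
  by exists czero; rewrite big_nil A_czero; split=> // w; rewrite big_nil czeroE.
exists (clin (c j) (cylf (t j)) F); rewrite crep_lin F1 big_cons; split=> // w.
by rewrite big_cons -F2 -cylfE.
Qed.

Lemma alg_simple F k (c : word -> C) (eps : R) u : 0 <= eps ->
  (forall w, nr (F w - c (mkseq w k)) <= eps) ->
  nr (A F u - wsum k (fun t => c t *: cyl t u)) <= eps * nr u.
Proof.
move=> e0 hc.
have [G [G1 G2]] := comb_ex (index_enum {: k.-tuple (letter I)}) c val u.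
rewrite /wsum -G1 addrC -scaleN1r -crep_lin; apply: alg_bound => // w.
change (nr (-1 * G w + F w) <= eps); rewrite mulN1r addrC G2.
have tk : size (mkseq w k) == k by rewrite size_mkseq.
rewrite (bigD1 (Tuple tk))//= big1 ?addr0.
  have /asboolP -> : starts (mkseq w k) w by exact: starts_mkseq.
  by rewrite mulr1.
move=> t ht; case: asboolP => [/starts_eq h|]; last by rewrite mulr0.
by case/eqP: ht; apply: val_inj => /=; rewrite h size_tuple.
Qed.

Lemma alg_cov (x : freeGroup I) F u : rho x (A F u) = A (translate x F) (rho x u).
Proof. by rewrite -crep_cov -urepM mulVg urep1. Qed.

Hypothesis unital : forall u, A cone u = u.

(** Through [alg_ext] each field becomes a pointwise identity between indicator functions. *)
Lemma cyl_psystem : psystem (lop rho) cyl.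
Proof.
split.
- apply: opP => u; rewrite -[RHS]unital; apply: alg_ext => w.
  by rewrite coneE cylfE; have /asboolP -> : starts [::] w by [].
- move=> t; apply: adj_unique => u v; rewrite [LHS]crep_star; congr (inner u _); apply: alg_ext => w.
  by change ((cylf t w)^* = cylf t w); rewrite cylfE conjC_nat.
- move=> x y; apply: opP => u; rewrite compE [LHS]/= -crep_mul; apply: alg_ext => w.
  change (cylf x w * cylf (x ++ y) w = cylf (x ++ y) w); rewrite !cylfE.
  case: (asboolP (starts (x ++ y) w)) => [h|]; last by rewrite mulr0.
  by have /asboolP -> := starts_cat h; rewrite mul1r.
- move=> x y sxy xy; apply: opP => u; rewrite compE [LHS]/= -crep_mul -[RHS](A_czero u).
  apply: alg_ext => w; change (cylf x w * cylf y w = czero w); rewrite !cylfE czeroE.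
  case: asboolP => [/starts_eq h1|]; last by rewrite mul0r.
  case: asboolP => [/starts_eq h2|]; last by rewrite mulr0.
  by case: xy; rewrite h1 h2 sxy.
- move=> x; apply: opP => u.
  have [F [F1 F2]] := comb_ex (index_enum (letter I)) (fun _ => 1) (rcons x) u.
  rewrite op_sum -(eq_bigr _ (fun a _ => scale1r _)) -F1; apply: alg_ext => w.
  rewrite F2 cylfE (bigD1 (w (size x)))//= big1 ?addr0.
    rewrite mul1r; congr (nat_of_bool _)%:R; apply/asboolP/asboolP; first by case/starts_rcons.
    by move=> h; apply/starts_rcons.
  move=> a /eqP ha; case: asboolP => [/starts_rcons[_ h]|]; last by rewrite mulr0.
  by case: ha.
- move=> x r; apply: opP => u; rewrite -[RHS](A_czero u); apply: alg_ext => w.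
  by rewrite cylfE czeroE; case: asboolP => // /starts_reduced; rewrite (negbTE r).
- move=> a x r x0; apply: opP => u; rewrite !compE [LHS]alg_cov; apply: alg_ext => w.
  change (cylf x (bpush (linv a) w) = cylf (a :: x) w); rewrite !cylfE.
  congr (nat_of_bool _)%:R; apply/asboolP/asboolP => h.
    move: h; rewrite /= /bpush_word linvK; case: eqP => wa h; apply/starts_cons => //.
    by case: x r x0 h => [//|b x] /andP[/negP ba _] _ /starts_cons[/= e _]; case: ba; rewrite -e.
  move: h => /starts_cons[wa h]; rewrite /= /bpush_word linvK wa eqxx.
  exact: h.
- move=> a; apply: opP => u.
  have e1 : u - cyl [:: linv a] u = A (clin (-1) (cylf [:: linv a]) cone) u.
    by rewrite crep_lin unital scaleN1r addrC.
  rewrite !compE opB; change (A (cylf [:: a]) (rho (fgletter a) u) = rho (fgletter a) (u - cyl [:: linv a] u)).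
  rewrite e1 alg_cov; apply: alg_ext => w.
  change (cylf [:: a] w = -1 * cylf [:: linv a] (bpush (linv a) w) + cone (bpush (linv a) w)).
  rewrite coneE !cylfE.
  have e0 b (v : nat -> letter I) : `[< starts [:: b] v >] = (v 0%N == b).
    by apply/asboolP/eqP => [/starts_cons[]|h] //; apply/starts_cons.
  rewrite !e0 /= /bpush_word linvK; have [wa|wa] := eqVneq (w 0%N) a.
    by rewrite (_ : (w 1%N == linv a) = false) ?mulr0 ?add0r//; apply/negbTE; rewrite -wa; exact: breduced.
  by rewrite eqxx mulr1 addNr.
Qed.

End SupNorm.

Lemma closed_span_sub (R : realType) (H : hilbertType R) (S V : set H) :
  linear_subspace V -> closed V -> S `<=` V -> closed_span S `<=` V.
Proof.
move=> lV cV SV; rewrite [X in _ `<=` X](closure_id V).1//.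
by apply: closure_subset; exact: smallest_sub.
Qed.

(** * From cylinders and letters to all functions and group elements *)

Section CrossRepresentations.
Variables (R : realType) (I : finType).
Local Notation C := R[i].
Local Notation word := (seq (letter I)).

Lemma crossrep_unital (H H' : hilbertType R) (rho : crossrep I H') (f : H -> H') :
  closed_span [set w | exists F v, w = crep_alg rho F (f v)] = setT ->
  forall u, crep_alg rho (cind_cylinder R 1%g) u = u.
Proof.
move=> h u; have [lV cV] := closed_eq_op (alg_op rho (cind_cylinder R 1%g)) (op1 H').
have : closed_span [set w | exists F v, w = crep_alg rho F (f v)] u by rewrite h.
apply: (closed_span_sub lV cV) => _ [F [v ->]] /=.
rewrite -crep_mul; apply: alg_ext => w.
change (cind_cylinder R 1%g w * F w = F w); rewrite cind_cylinderE.
by have /asboolP -> : starts (1%g : freeGroup I) w by []; rewrite mul1r.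
Qed.

Lemma alg_invariant (H : hilbertType R) (rho : crossrep I H) (V : set H) :
  linear_subspace V -> closed V -> (forall w u, V u -> V (cyl rho w u)) ->
  forall F u, V u -> V (crep_alg rho F u).
Proof.
move=> [V0 VP] cV hV F u Vu; apply: (closed_approx cV) => e e0.
have m0 : 0 < nr u + 1 by rewrite ltr_wpDl ?nr_ge0.
have e1 : 0 < e / (nr u + 1) by rewrite divr_gt0.
have [k [c hc]] := simple_approx F e1.
exists (wsum k (fun t => c t *: cyl rho t u)).
  rewrite /wsum; elim/big_ind: _ => // [x y Vx Vy|t _].
    by rewrite -[x]scale1r; exact: VP.
  by rewrite -[_ *: _]addr0; apply: VP => //; exact: hV.
apply: le_trans (alg_simple rho u (ltW e1) hc) _.
by rewrite mulrAC ler_pdivrMr// ler_wpM2l ?(ltW e0)// lerDl.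
Qed.

Lemma grp_invariant (H : hilbertType R) (pi : unirep (freeGroup I) H) (V : set H) :
  (forall a u, V u -> V (lop pi a u)) -> forall x u, V u -> V (pi x u).
Proof.
move=> hV x u Vu; change (V (grp_op pi x u)); rewrite grp_op_Uw.
by elim: (fgword x) => //= a s IH; apply: hV.
Qed.

Lemma crossrep_sys_irreducible (H : hilbertType R) (rho : crossrep I H) :
  crossrep_irreducible rho -> sys_irreducible (lop rho) (cyl rho).
Proof.
move=> [_ h] V lV cV WV PV; apply: h => // [x|F] u Vu.
  exact: (grp_invariant WV).
exact: (alg_invariant lV cV).
Qed.

(** Continuous functions are uniform limits of step functions on cylinders, and [alg_simple] carries
    this over to operators. *)
Lemma op_intertwines (H1 H2 : hilbertType R) (rho1 : crossrep I H1) (rho2 : crossrep I H2) (K : op H1 H2) :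
  (forall a, lop rho2 a ** K = K ** lop rho1 a) ->
  (forall w, cyl rho2 w ** K = K ** cyl rho1 w) -> intertwines rho1 rho2 K.
Proof.
move=> hW hP; split=> [x u|F u].
  change (K (grp_op rho1 x u) = grp_op rho2 x (K u)); rewrite !grp_op_Uw.
  by elim: (fgword x) => //= a s <-; exact: (congr1 (fun S : op H1 H2 => S (Uw (lop rho1) s u)) (esym (hW a))).
apply/eqP; rewrite -subr_eq0; apply/eqP; apply: nr_small0 => e e0.
have [b b0 bK] := bnd_ex K.
have m0 : 0 < b * nr u + nr (K u) + 1 by rewrite ltr_wpDl// addr_ge0 ?mulr_ge0 ?nr_ge0.
have e1 : 0 < e / (b * nr u + nr (K u) + 1) by rewrite divr_gt0.
have [k [c hc]] := simple_approx F e1.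
have h1 := alg_simple rho1 u (ltW e1) hc; have h2 := alg_simple rho2 (K u) (ltW e1) hc.
have sE : wsum k (fun t => c t *: cyl rho2 t (K u)) = K (wsum k (fun t => c t *: cyl rho1 t u)).
  by rewrite /wsum op_sumr; apply: eq_bigr => t _; rewrite opZr -compE hP.
apply: le_trans (nr_triB _ (wsum k (fun t => c t *: cyl rho2 t (K u))) _) _.
rewrite {1}sE -opBr; apply: (@le_trans _ _ (b * (e / (b * nr u + nr (K u) + 1) * nr u) + e / (b * nr u + nr (K u) + 1) * nr (K u))).
  apply: lerD; last by rewrite nrB.
  by apply: le_trans (bK _) _; rewrite ler_wpM2l.
rewrite mulrCA -mulrDr mulrAC ler_pdivrMr// ler_wpM2l ?(ltW e0)// lerDl//.
Qed.

End CrossRepresentations.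

(** * Transport of a system along a unitary *)

Section Pullback.
Variables (R : realType) (I : finType) (H H' : hilbertType R).
Local Notation word := (seq (letter I)).
Variables (W : letter I -> op H H) (W' : letter I -> op H' H').
Variable J : op H H'.
Hypothesis JJ : adj J ** J = op1 H.
Hypothesis JJ' : J ** adj J = op1 H'.
Hypothesis hJ : forall a, W' a ** J = J ** W a.
Variable P' : word -> op H' H'.

Definition pullback w : op H H := adj J ** P' w ** J.

Lemma pullback_comm w : P' w ** J = J ** pullback w.
Proof. by rewrite /pullback !compA JJ' comp1l. Qed.

Let WJ a : adj J ** W' a = W a ** adj J.
Proof. by rewrite -[LHS]comp1r -JJ' !compA -[_ ** W' a ** J]compA hJ !compA JJ comp1l. Qed.

Let pbM (S T : op H' H') : adj J ** S ** J ** (adj J ** T ** J) = adj J ** (S ** T) ** J.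
Proof. by rewrite !compA -[_ ** J ** adj J]compA JJ' comp1r. Qed.

Lemma pullback_psystem : psystem W' P' -> psystem W pullback.
Proof.
move=> s; split.
- by rewrite /pullback (ps1 s) comp1r JJ.
- by move=> w; rewrite /pullback !adj_comp adjK (ps_adj s) compA.
- by move=> w x; rewrite /pullback pbM (ps_mul s).
- by move=> w x e wx; rewrite /pullback pbM (ps_orth s)// comp0r comp0l.
- by move=> w; rewrite /pullback -comp_suml -comp_sumr (ps_sum s).
- by move=> w r; rewrite /pullback (ps_red s)// comp0r comp0l.
- move=> a w r w0; rewrite /pullback !compA -WJ -[_ ** W' a ** P' w]compA (ps_fwd s)// -!compA.
  by rewrite hJ.
- move=> a; have -> : op1 H - pullback [:: linv a] = adj J ** (op1 H' - P' [:: linv a]) ** J.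
    by rewrite compBr compBl comp1r JJ.
  rewrite /pullback !compA -WJ -[_ ** W' a ** _]compA -(ps_back s) -!compA.
  by rewrite hJ.
Qed.

Lemma pullback_irreducible : sys_irreducible W' P' -> sys_irreducible W pullback.
Proof.
move=> irr V [V0 VP] cV WV PV.
have adJ u : adj J (J u) = u by rewrite -compE JJ.
have Jad u : J (adj J u) = u by rewrite -compE JJ'.
have [||a u hu|w u hu|h|h] := irr [set u | V (adj J u)].
- by split=> [|c u v hu hv] /=; rewrite ?op0r// opDr opZr; exact: VP.
- exact: op_continuous.
- by rewrite /= -compE WJ; exact: WV.
- have := PV w _ hu; rewrite -compE (_ : pullback w ** adj J = adj J ** P' w)//.
  by rewrite /pullback -compA JJ' comp1r.
- left; apply/seteqP; split=> u /=; last by move=> ->.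
  move=> Vu; have : [set u | V (adj J u)] (J u) by rewrite /= adJ.
  by rewrite h /= => Ju; rewrite -(adJ u) Ju op0r.
- by right; apply/seteqP; split=> u //= _; rewrite -(adJ u); have : [set u | V (adj J u)] (J u) by rewrite h.
Qed.

End Pullback.

(** * Orthonormal bases and the Hilbert-Schmidt norm *)

Section HilbertSchmidtNorm.
Variables (R : realType) (H : hilbertType R).
Local Notation C := R[i].

Lemma adjointE (H1 H2 : hilbertType R) (T : op H1 H2) v : adjoint T v = adj T v.
Proof.
rewrite /adjoint; case: xgetP => [w _ hw|/(_ (adj T v))[]]; last by move=> u; exact: adjE.
by apply: inner_eq => u; rewrite innerC -hw adjE -innerC.
Qed.

(** Points of a countable dense set within distance one half are chosen. Equal choices would put two
    vectors at distance less than 1, but distinct orthonormal vectors have squared distance 2. *)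
Lemma orthonormal_countable (B : set H) :
  (forall f, B f -> inner f f = 1) -> (forall f g, B f -> B g -> f <> g -> inner f g = 0) ->
  countable B.
Proof.
move=> B1 B0; have [D cD dD] := @hilbert_separable _ H.
have h2 : 0 < (2^-1 : R)%:C%C by rewrite ltcR invr_gt0.
have near f : exists d, D d /\ nr (f - d) < 2^-1.
  have [|d [fd Dd]] := dD (ball f (2^-1 : R)%:C%C) _ (ball_open _ _).
    by exists f; exact: ballxx.
  by exists d; split=> //; move: fd; rewrite -ball_normE /= nrE ltcR.
have [s hs] := choice near.
have [c cinj] := countable_injP _ cD.
apply/countable_injP; exists (c \o s) => f g; rewrite !inE => Bf Bg /= scg.
have sg : s f = s g by apply: cinj => //; rewrite inE; case: (hs f) (hs g) => ? ? [].
apply: contrapT => fg.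
have lt1 : nr (f - g) < 1.
  apply: le_lt_trans (nr_triB f (s f) g) _; have [_ h1] := hs f; have [_ h3] := hs g.
  by rewrite {2}sg [nr (s g - g)]nrB; lra.
have : nr (f - g) ^+ 2 = 2.
  by rewrite nrB_sqr B0// -!Re_inner_nr !B1//= mul0rn subr0; ring.
by have := nr_ge0 (f - g); nra.
Qed.

Lemma orthonormal_enum (B : set H) : orthonormal_basis B ->
  exists e : nat -> H, [/\ onbasis e, forall i, e i = 0 \/ B (e i) &
    forall i j, i <> j -> e i = e j -> e i = 0].
Proof.
move=> [B1 B0 BT]; have [c cinj] := countable_injP _ (orthonormal_countable B1 B0).
(* The vector of [B] with code [n], or 0 when no vector has this code. *)
pose e n := xget 0 [set f | B f /\ c f = n].
have eB i : e i = 0 \/ (B (e i) /\ c (e i) = i).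
  by rewrite /e; case: xgetP => [f _ hf|_]; [right|left].
have ee i j : i <> j -> e i = e j -> e i = 0.
  move=> ij eij; case: (eB i) => // -[_ ci]; case: (eB j) => [<- //|[_ cj]].
  by case: ij; rewrite -ci eij cj.
exists e; split=> //; last by move=> i; case: (eB i) => [|[]]; [left|right].
have cBf f : B f -> e (c f) = f.
  move=> Bf; rewrite /e; case: xgetP => [g _ [Bg cg]|/(_ f)[]//].
  by apply: cinj; rewrite ?inE.
split.
- move=> i j ij; case: (eB i) => [->|[Bi ci]]; first by rewrite inner0l.
  case: (eB j) => [->|[Bj cj]]; first by rewrite inner0r.
  by apply: B0 => // eij; case: ij; rewrite -ci eij cj.
- by move=> i; case: (eB i) => [|[Bi _]]; [left|right; exact: B1].
pose V := [set u : H | exists m (a : nat -> C), u = \sum_(i < m) a i *: e i].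
have pad m n (a : nat -> C) : (m <= n)%N ->
    \sum_(i < m) a i *: e i = \sum_(i < n) (if (i < m)%N then a i else 0) *: e i.
  move=> mn; rewrite (big_ord_widen n (fun i => a i *: e i))// [RHS](bigID (fun i : 'I_n => (i < m)%N)) /=.
  rewrite [X in _ + X]big1 ?addr0; first by apply: eq_bigr => i ->.
  by move=> i /negbTE ->; rewrite scale0r.
have lV : linear_subspace V.
  split=> [|k u v [m [a ->]] [n [b ->]]]; first by exists 0%N, (fun _ => 0); rewrite big_ord0.
  exists (maxn m n), (fun i => k * (if (i < m)%N then a i else 0) + (if (i < n)%N then b i else 0)).
  rewrite (pad m (maxn m n)) ?leq_maxl// (pad n (maxn m n)) ?leq_maxr// scaler_sumr -big_split.
  by apply: eq_bigr => i _ /=; rewrite scalerDl scalerA.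
have BV : B `<=` V.
  move=> f Bf; exists (c f).+1, (fun i => (i == c f)%:R).
  rewrite big_ord_recr /= eqxx scale1r cBf// big1 ?add0r// => i _.
  by rewrite (_ : _ == _ = false) ?scale0r//; apply/negbTE; rewrite neq_ltn ltn_ord.
move=> u d d0; have : closed_span B u by rewrite BT.
move=> /closure_approx /(_ _ d0)[v Bv uv]; have [m [a va]] := smallest_sub lV BV Bv.
by exists m, a; rewrite -va.
Qed.

(** An infimum below infinity is witnessed by some basis with a finite sum; this basis depends on
    the operator. *)
Lemma hs_norm_isHS (T : H -> H) (S : op H H) : T =1 S -> (hs_norm T < +oo)%E ->
  exists2 e, onbasis e & isHS e S.
Proof.
move=> TS /ereal_inf_lt[_ [B onB <-] hB].
have [e [he eB ee]] := orthonormal_enum onB; exists e => //.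
set E := esum _ _ in hB.
have E0 : (0 <= E)%E by apply: esum_ge0 => f _; rewrite lee_fin sqr_ge0.
have [c cE] : exists c : R, E = c%:E by case: E E0 hB => // c _ _; exists c.
exists c => m; rewrite -lee_fin -cE.
(* Dropping the zero entries leaves a list without repetition whose members lie in [B], as [esum]
   requires. *)
pose s := [seq e i | i <- iota 0 m & e i != 0].
have us : uniq s.
  rewrite map_inj_in_uniq ?filter_uniq ?iota_uniq// => i j; rewrite mem_filter => /andP[i0 _] _ eij.
  by apply/eqP; apply: contraNT i0 => /eqP ij; apply/eqP; exact: ee eij.
apply: esum_ge; exists [set` s].
  split; first exact: finite_seq.
  move=> f /= /mapP[j]; rewrite mem_filter => /andP[/eqP i0 _] ->.
  by case: (eB j).
rewrite -fsbig_seq// big_map big_filter sumEFin lee_fin.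
rewrite -(big_mkord xpredT (fun i => nr (S (e i)) ^+ 2)) /index_iota subn0 [leRHS]big_mkcond /=.
apply: ler_sum => i _; rewrite TS; case: eqP => //= ->.
by rewrite op0r nr0 expr0n.
Qed.

End HilbertSchmidtNorm.

(** * Boundary realizations *)

Section Realizations.
Variables (R : realType) (I : finType).
Local Notation C := R[i].
Local Notation word := (seq (letter I)).

Lemma isometry_op (H H' : hilbertType R) (J : op H H') : (forall u, nr (J u) = nr u) -> adj J ** J = op1 H.
Proof.
move=> h; apply/eqP; rewrite -subr_eq0; apply/eqP; apply: form_eq0.
  by rewrite adjB adj_comp adjK adj1.
by move=> u; rewrite opB innerBl ReD ReN compE adjE' !Re_inner_nr h subrr.
Qed.

Lemma unitary_op_is_unitary (H H' : hilbertType R) (J : op H H') :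
  adj J ** J = op1 H -> J ** adj J = op1 H' -> Defs.is_unitary J.
Proof.
move=> h1 h2; split=> [u v|y]; last by exists (adj J y); change ((J ** adj J) y = y); rewrite h2.
by change (inner (opf J u) (opf J v) = inner u v); rewrite adjE -compE h1.
Qed.

Lemma iota_axiom (H H' : hilbertType R) (f : {linear H -> H'}) : (forall v, `|f v| = `|v|) ->
  linear f /\ exists c : R, forall u, nr (f u) <= c * nr u.
Proof. by move=> h; split; [exact: linearP|exists 1 => u; rewrite /nr h mul1r]. Qed.

Lemma cyclic_sub (H H' : hilbertType R) (rho : crossrep I H') (f : H -> H') (V : set H') :
  closed_span [set w | exists F v, w = crep_alg rho F (f v)] = setT ->
  linear_subspace V -> closed V -> (forall w u, V u -> V (cyl rho w u)) -> (forall v, V (f v)) ->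
  forall u, V u.
Proof.
move=> h lV cV PV fV u.
have : closed_span [set w | exists F v, w = crep_alg rho F (f v)] u by rewrite h.
apply: (closed_span_sub lV cV) => _ [F [v ->]].
exact: (alg_invariant lV cV).
Qed.

Lemma cyclic_eq_op (H H' : hilbertType R) (rho : crossrep I H') (f : H -> H') (S T : op H' H') :
  closed_span [set w | exists F v, w = crep_alg rho F (f v)] = setT ->
  (forall w, S ** cyl rho w = cyl rho w ** S) -> (forall w, T ** cyl rho w = cyl rho w ** T) ->
  (forall v, S (f v) = T (f v)) -> S = T.
Proof.
move=> h hS hT hf; have [lV cV] := closed_eq_op S T.
apply: opP; apply: (cyclic_sub h lV cV) => // w u hu.
by change ((S ** cyl rho w) u = (T ** cyl rho w) u); rewrite hS hT !compE hu.
Qed.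

Section Perfect.
Variables (H H' : hilbertType R) (pi : unirep (freeGroup I) H) (rho : crossrep I H') (J : op H H').
Hypothesis perfect : perfect_realization pi rho J.

Lemma perfect_isometry : adj J ** J = op1 H.
Proof. by have [[h _ _] _] := perfect; apply: isometry_op => u; rewrite /nr h. Qed.

Lemma perfect_onto : J ** adj J = op1 H'.
Proof.
have [_ [g gJ Jg]] := perfect; apply: opP => u.
by rewrite -{1}(Jg u) compE -(compE (adj J)) perfect_isometry Jg.
Qed.

Lemma perfect_lop a : lop rho a ** J = J ** lop pi a.
Proof. by have [[_ h _] _] := perfect; apply: opP => u; rewrite !compE /= h. Qed.

Lemma perfect_psystem : psystem (lop pi) (pullback J (cyl rho)).
Proof.
have [[_ _ h] _] := perfect.
exact: (pullback_psystem perfect_isometry perfect_onto perfect_lop (cyl_psystem (crossrep_unital h))).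
Qed.

Lemma perfect_irreducible : crossrep_irreducible rho -> sys_irreducible (lop pi) (pullback J (cyl rho)).
Proof.
move=> h; exact: (pullback_irreducible perfect_isometry perfect_onto perfect_lop (crossrep_sys_irreducible h)).
Qed.

Lemma perfect_compression a u :
  compression J (crep_alg rho (cind_cylinder R (fgletter a))) u = pullback J (cyl rho) [:: a] u.
Proof.
rewrite /compression adjointE /pullback !compE; congr (adj J _).
by apply: alg_ext => w; rewrite cylfE cind_cylinderE.
Qed.

(* The range of [T] is closed and invariant, so [T] is onto. *)
Lemma intertwiner_equiv (H1 : hilbertType R) (rho1 : crossrep I H1) (T : op H H1) :
  boundary_realization pi rho1 T -> (forall w, cyl rho1 w ** T = T ** pullback J (cyl rho) w) ->
  realization_equiv rho1 T rho J /\ bijective T.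
Proof.
move=> [T1 T2 T3] hT.
have TT : adj T ** T = op1 H by apply: isometry_op => u; rewrite /nr T1.
have aT w : adj T ** cyl rho1 w = pullback J (cyl rho) w ** adj T.
  have s1 := cyl_psystem (crossrep_unital T3).
  by have := congr1 (@adj _ _ _) (hT w); rewrite adj_comp (adj_comp T (pullback _ _ _)) (ps_adj s1) (ps_adj perfect_psystem).
have TT' : T ** adj T = op1 H1.
  apply: (cyclic_eq_op T3) => [w|w|v]; first by rewrite -compA aT compA -hT -compA.
    by rewrite comp1l comp1r.
  by rewrite compE -(compE (adj T)) TT.
have hW a : lop rho1 a ** T = T ** lop pi a by apply: opP => u; rewrite !compE /= T2.
split; last first.
  by exists (adj T) => u; rewrite -compE ?TT ?TT'.
have KK : adj (J ** adj T) ** (J ** adj T) = op1 H1.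
  by rewrite adj_comp adjK !compA -[_ ** adj J ** J]compA perfect_isometry comp1r TT'.
have KK' : J ** adj T ** adj (J ** adj T) = op1 H'.
  by rewrite adj_comp adjK !compA -[_ ** adj T ** T]compA TT comp1r perfect_onto.
exists (J ** adj T); split; [exact: unitary_op_is_unitary| |]; last first.
  by move=> v; change (J ((adj T ** T) v) = J v); rewrite TT.
apply: op_intertwines => [a|w].
  rewrite compA perfect_lop -compA -(adj_intertwiner (unitary_lop pi) (unitary_lop rho1) hW) compA.
  by [].
by rewrite compA (pullback_comm perfect_onto) -compA -aT compA.
Qed.

End Perfect.

(** * Realizations with two nonzero components *)

Section Mixture.
Variables (H Hp Hm H' : hilbertType R) (pi : unirep (freeGroup I) H).
Variables (rhop : crossrep I Hp) (rhom : crossrep I Hm) (Jp : op H Hp) (Jm : op H Hm).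
Hypothesis perfp : perfect_realization pi rhop Jp.
Hypothesis perfm : perfect_realization pi rhom Jm.
Variables (rho : crossrep I H') (T S S' : op H H') (a b : R).
Hypothesis real : boundary_realization pi rho T.
Hypothesis TE : T = S + S'.
Hypothesis a0 : 0 < a.
Hypothesis b0 : 0 < b.
Hypothesis SS : adj S ** S = a%:C%C *: op1 H.
Hypothesis SS' : adj S' ** S' = b%:C%C *: op1 H.
Hypothesis orth : adj S ** S' = 0.
Hypothesis PS : forall w, cyl rho w ** S = S ** pullback Jp (cyl rhop) w.
Hypothesis QS : forall w, cyl rho w ** S' = S' ** pullback Jm (cyl rhom) w.
Hypothesis WS : forall c, lop rho c ** S = S ** lop pi c.
Hypothesis WS' : forall c, lop rho c ** S' = S' ** lop pi c.

Let ra : C := (Num.sqrt a)^-1%:C%C.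
Let rb : C := (Num.sqrt b)^-1%:C%C.

Let raa : ra * a%:C%C = (Num.sqrt a)%:C%C.
Proof.
have s0 : Num.sqrt a != 0 by rewrite gt_eqF ?sqrtr_gt0.
by rewrite -rmorphM -{2}(sqr_sqrtr (ltW a0)) expr2 mulrA mulVf// mul1r.
Qed.

Let rbb : rb * b%:C%C = (Num.sqrt b)%:C%C.
Proof.
have s0 : Num.sqrt b != 0 by rewrite gt_eqF ?sqrtr_gt0.
by rewrite -rmorphM -{2}(sqr_sqrtr (ltW b0)) expr2 mulrA mulVf// mul1r.
Qed.

Let ras : ra * (Num.sqrt a)%:C%C = 1.
Proof. by rewrite -rmorphM mulVf ?rmorph1// gt_eqF ?sqrtr_gt0. Qed.

Let rbs : rb * (Num.sqrt b)%:C%C = 1.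
Proof. by rewrite -rmorphM mulVf ?rmorph1// gt_eqF ?sqrtr_gt0. Qed.

Let raC : ra^* = ra. Proof. exact: conjR. Qed.
Let rbC : rb^* = rb. Proof. exact: conjR. Qed.

Let orth' : adj S' ** S = 0.
Proof. by rewrite -[LHS]adjK adj_comp adjK orth adj0. Qed.

(** [S] and [S'] divided by the square roots of [a] and [b] are isometries with orthogonal ranges;
    their adjoints, followed by the perfect realizations, are the two components of the
    equivalence. *)
Let Lp := ra *: (Jp ** adj S).
Let Lm := rb *: (Jm ** adj S').

Lemma split_axiom : linear (fun u => (Lp u, Lm u) : hsum Hp Hm) /\
  exists c : R, forall u, nr ((Lp u, Lm u) : hsum Hp Hm) <= c * nr u.
Proof.
split; first by move=> k u v; rewrite !opDr !opZr.
have [c c0 hc] := bnd_ex Lp; have [d d0 hd] := bnd_ex Lm.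
exists (c + d) => u; rewrite mulrDl; apply: (@le_trans _ _ (nr (Lp u) + nr (Lm u))); last exact: lerD.
by rewrite -lecR rmorphD /= -!nrE; exact: hsum_norm_le.
Qed.

Definition split_op : op H' (hsum Hp Hm) := Op split_axiom.

Let adjLp : adj Lp ** Lp = (ra * ra) *: (S ** adj S).
Proof.
rewrite /Lp adjZ adj_comp adjK raC compZl compZr scalerA; congr (_ *: _).
by rewrite !compA -[_ ** adj Jp ** Jp]compA (perfect_isometry perfp) comp1r.
Qed.

Let adjLm : adj Lm ** Lm = (rb * rb) *: (S' ** adj S').
Proof.
rewrite /Lm adjZ adj_comp adjK rbC compZl compZr scalerA; congr (_ *: _).
by rewrite !compA -[_ ** adj Jm ** Jm]compA (perfect_isometry perfm) comp1r.
Qed.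

Let TT3 := let: And3 _ _ h := real in h.

Let sR : psystem (lop rho) (cyl rho) := cyl_psystem (crossrep_unital TT3).

Let aPS w : adj S ** cyl rho w = pullback Jp (cyl rhop) w ** adj S.
Proof.
have := congr1 (@adj _ _ _) (PS w).
by rewrite adj_comp (adj_comp S (pullback _ _ _)) (ps_adj sR) (ps_adj (perfect_psystem perfp)).
Qed.

Let aQS w : adj S' ** cyl rho w = pullback Jm (cyl rhom) w ** adj S'.
Proof.
have := congr1 (@adj _ _ _) (QS w).
by rewrite adj_comp (adj_comp S' (pullback _ _ _)) (ps_adj sR) (ps_adj (perfect_psystem perfm)).
Qed.

Let aST : adj S ** T = a%:C%C *: op1 H.
Proof. by rewrite TE compDr SS orth addr0. Qed.

Let aST' : adj S' ** T = b%:C%C *: op1 H.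
Proof. by rewrite TE compDr SS' orth' add0r. Qed.

(** The left side is the projection onto the sum of the two ranges. It commutes with the cylinder
    projections and fixes the range of [T], so it is 1 by cyclicity. *)
Let gram1 : adj Lp ** Lp + adj Lm ** Lm = op1 H'.
Proof.
rewrite adjLp adjLm; apply: (cyclic_eq_op TT3) => [w|w|v].
- rewrite compDl compDr !compZl !compZr; congr (_ *: _ + _ *: _).
    by rewrite -compA aPS compA -PS -compA.
  by rewrite -compA aQS compA -QS -compA.
- by rewrite comp1l comp1r.
change ((((ra * ra) *: (S ** adj S) + (rb * rb) *: (S' ** adj S')) ** T) v = (op1 H' ** T) v).
rewrite compDl !compZl -!compA aST aST' !compZr !comp1r !scalerA comp1l -!mulrA raa rbb ras rbs.
by rewrite !scale1r TE.
Qed.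

Let LpS : Lp ** S = (Num.sqrt a)%:C%C *: Jp.
Proof. by rewrite compZl -compA SS compZr comp1r scalerA raa. Qed.

Let LpS' : Lp ** S' = 0.
Proof. by rewrite compZl -compA orth comp0r scaler0. Qed.

Let LmS : Lm ** S = 0.
Proof. by rewrite compZl -compA orth' comp0r scaler0. Qed.

Let LmS' : Lm ** S' = (Num.sqrt b)%:C%C *: Jm.
Proof. by rewrite compZl -compA SS' compZr comp1r scalerA rbb. Qed.

Let LpT : Lp ** T = (Num.sqrt a)%:C%C *: Jp.
Proof. by rewrite TE compDr LpS LpS' addr0. Qed.

Let LmT : Lm ** T = (Num.sqrt b)%:C%C *: Jm.
Proof. by rewrite TE compDr LmS LmS' add0r. Qed.

Let split_onto y : exists u, split_op u = y.
Proof.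
case: y => x y; exists (ra *: S (adj Jp x) + rb *: S' (adj Jm y)).
have e1 : Lp (ra *: S (adj Jp x) + rb *: S' (adj Jm y)) = x.
  rewrite opDr !opZr -!(compE Lp) LpS LpS' opZ op0 scaler0 addr0 scalerA ras scale1r.
  by rewrite -compE (perfect_onto perfp).
have e2 : Lm (ra *: S (adj Jp x) + rb *: S' (adj Jm y)) = y.
  rewrite opDr !opZr -!(compE Lm) LmS LmS' opZ op0 scaler0 add0r scalerA rbs scale1r.
  by rewrite -compE (perfect_onto perfm).
by congr pair.
Qed.

Lemma mixture_equiv : realization_equiv rho T (sum_crossrep rhop rhom) (weighted_sum a b Jp Jm).
Proof.
have Wp c : lop rhop c ** Lp = Lp ** lop rho c.
  rewrite compZr compZl compA (perfect_lop perfp) -!compA.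
  by rewrite (adj_intertwiner (unitary_lop pi) (unitary_lop rho) WS).
have Wm c : lop rhom c ** Lm = Lm ** lop rho c.
  rewrite compZr compZl compA (perfect_lop perfm) -!compA.
  by rewrite (adj_intertwiner (unitary_lop pi) (unitary_lop rho) WS').
have Pp w : cyl rhop w ** Lp = Lp ** cyl rho w.
  rewrite compZr compZl compA (pullback_comm (perfect_onto perfp)) -(compA Jp (adj S)) aPS.
  by rewrite -(compA Jp).
have Pm w : cyl rhom w ** Lm = Lm ** cyl rho w.
  rewrite compZr compZl compA (pullback_comm (perfect_onto perfm)) -(compA Jm (adj S')) aQS.
  by rewrite -(compA Jm).
exists split_op; split.
- split=> [u v|]; last exact: split_onto.
  change (inner (Lp u) (Lp v) + inner (Lm u) (Lm v) = inner u v).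
  by rewrite !(adjE _ u) -!compE -innerDr -opD gram1.
- apply: op_intertwines => [c|w]; apply: opP => u.
    change (((lop rhop c ** Lp) u, (lop rhom c ** Lm) u) = ((Lp ** lop rho c) u, (Lm ** lop rho c) u)).
    by rewrite Wp Wm.
  change (((cyl rhop w ** Lp) u, (cyl rhom w ** Lm) u) = ((Lp ** cyl rho w) u, (Lm ** cyl rho w) u)).
  by rewrite Pp Pm.
- move=> v; change (((Lp ** T) v, (Lm ** T) v) = weighted_sum a b Jp Jm v).
  by rewrite LpT LmT.
Qed.

(** In the direct sum the range of [T] is a graph: a vector whose second component is 0 comes from
    0. *)
Lemma mixture_imperfect (v : H) : v <> 0 -> ~ bijective T.
Proof.
move=> v0 [g gT Tg]; apply: v0.
have [w hw] := split_onto (Jp v, 0).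
have : split_op (T (g w)) = (Jp v, 0) by rewrite [X in split_op X]Tg.
change (((Lp ** T) (g w), (Lm ** T) (g w)) = (Jp v, 0) -> v = 0).
rewrite LpT LmT => -[h1 h2].
have gw : g w = 0.
  rewrite -[g w]/(op1 H (g w)) -(perfect_isometry perfm) compE -[Jm _]scale1r -rbs -scalerA.
  by rewrite h2 scaler0 op0r.
rewrite -[v]/(op1 H v) -(perfect_isometry perfp) compE -h1 gw.
by rewrite op0r scaler0 op0r.
Qed.

End Mixture.

Lemma gram_eq0 (H H' : hilbertType R) (S : op H H') : adj S ** S = 0 -> S = 0.
Proof.
move=> h; apply: opP => u; apply: nr_le0.
have := Re_inner_nr (S u); rewrite adjE -compE h op0 inner0r => /esym/eqP.
by rewrite sqrf_eq0 => /eqP ->.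
Qed.

(** * Two inequivalent perfect realizations *)

Section PerfectPair.
Variables (H Hp Hm : hilbertType R) (pi : unirep (freeGroup I) H).
Variables (rhop : crossrep I Hp) (rhom : crossrep I Hm) (Jp : op H Hp) (Jm : op H Hm).
Hypothesis I2 : (1 < #|I|)%N.
Hypothesis irrp : crossrep_irreducible rhop.
Hypothesis irrm : crossrep_irreducible rhom.
Hypothesis inequiv : ~ crossrep_equiv rhop rhom.
Hypothesis perfp : perfect_realization pi rhop Jp.
Hypothesis perfm : perfect_realization pi rhom Jm.
Hypothesis finite_trace : forall a b : letter I, a <> b ->
  (hs_norm (compression Jp (crep_alg rhop (cind_cylinder R (fgletter a))) \o
            compression Jm (crep_alg rhom (cind_cylinder R (fgletter b)))) < +oo)%E.

Let W := lop pi.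
Let P := pullback Jp (cyl rhop).
Let Q := pullback Jm (cyl rhom).

Let uW : unitary_letters W. Proof. exact: unitary_lop. Qed.
Let sP : psystem W P. Proof. exact: perfect_psystem. Qed.
Let sQ : psystem W Q. Proof. exact: perfect_psystem. Qed.
Let iP : sys_irreducible W P. Proof. exact: perfect_irreducible. Qed.
Let iQ : sys_irreducible W Q. Proof. exact: perfect_irreducible. Qed.

Let ineq (J : op H H) : adj J ** J = op1 H -> J ** adj J = op1 H ->
  (forall a, W a ** J = J ** W a) -> (forall w, P w ** J = J ** Q w) -> False.
Proof.
move=> J1 J2 hW hP; apply: inequiv.
have pp := perfect_isometry perfp; have pp' := perfect_onto perfp.
have pm := perfect_isometry perfm; have pm' := perfect_onto perfm.
have hW' := adj_intertwiner uW uW hW.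
have hP' w : adj J ** P w = Q w ** adj J.
  have := congr1 (@adj _ _ _) (hP w).
  by rewrite (adj_comp (P w)) (adj_comp J) (ps_adj sP) (ps_adj sQ).
(* [J] carries the system [Q] to [P], so an equivalence from [rhop] to [rhom] uses its adjoint. *)
exists (Jm ** adj J ** adj Jp); split.
  apply: unitary_op_is_unitary; rewrite !adj_comp !adjK -!compA.
    by rewrite [adj Jm ** _]compA pm comp1l [J ** _]compA J2 comp1l.
  by rewrite [adj Jp ** _]compA pp comp1l [adj J ** _]compA J1 comp1l.
apply: op_intertwines => [a|w].
  rewrite !compA (perfect_lop perfm) -(compA Jm) -hW' -!compA.
  by rewrite (adj_intertwiner uW (unitary_lop rhop) (perfect_lop perfp)).
rewrite !compA (pullback_comm pm') -(compA Jm) -hP' -!compA; congr (_ ** (_ ** _)).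
by rewrite pp' comp1r.
Qed.

Let HS_pair a b : a != b -> exists2 e, onbasis e & isHS e (P [:: a] ** Q [:: b]).
Proof.
move=> ab; apply: hs_norm_isHS (finite_trace (elimN eqP ab)) => u.
rewrite compE -perfect_compression -perfect_compression.
by [].
Qed.

(** Expanding the complement in [cross] over the other letters leaves the products of the finite
    trace condition or their adjoints. Each pair of letters may come with its own basis; two
    applications of [hsb_adj] bring them all to one. *)
Let HS_ex : exists e, [/\ onbasis e, forall a, isHS e (cross P Q a) & forall a, isHS e (cross Q P a)].
Proof.
have [i0 _] : exists i : I, True by case/card_gt0P: (ltnW I2) => i _; exists i.
have [|e he _] := @HS_pair (i0, false) (i0, true); first by apply/eqP => -[].
have hs a b : a != b -> isHS e (P [:: a] ** Q [:: b]).
  move=> /HS_pair[e' he' [c hc]]; exists c; rewrite -[P _ ** Q _]adjK.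
  exact: (hsb_adj he' he (hsb_adj he' he' hc)).
exists e; split=> // a.
  rewrite /cross (ps_compl sQ) comp_suml big_mkcond; apply: isHS_sum => b.
  case: ifP => [ba|_]; last exact: isHS_0.
  have -> : Q [:: b] ** P [:: a] = adj (P [:: a] ** Q [:: b]).
    by rewrite (adj_comp (P _)) (ps_adj sP) (ps_adj sQ).
  by apply: (isHS_adj he); apply: hs; rewrite eq_sym.
rewrite /cross (ps_compl sP) comp_suml big_mkcond; apply: isHS_sum => b.
by case: ifP => [ba|_]; [exact: hs|exact: isHS_0].
Qed.

Lemma pair_irreducible : unirep_irreducible pi.
Proof.
have [e [he hX hX']] := HS_ex.
have [U [UU Uoo]] := ultraFilterLemma (F := \oo) _.
split.
  have [[v v0] _] := irrp; exists (adj Jp v) => h; apply: v0.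
  by rewrite -[v]/(op1 Hp v) -(perfect_onto perfp) compE h op0r.
move=> V lV cV hV; apply: (commutant_irreducible uW sP sQ iP iQ ineq Uoo he hX hX' lV cV) => a u.
exact: (hV (fgletter a)).
Qed.

(** If one of the two components of [isometry_splits] vanishes, [T] intertwines the projections of a
    perfect realization and is equivalent to it; otherwise both weights are positive and the
    realization is the weighted sum. *)
Lemma pair_realization (H' : hilbertType R) (rho : crossrep I H') (T : op H H') :
  boundary_realization pi rho T ->
  [\/ realization_equiv rho T rhop Jp /\ bijective T,
      realization_equiv rho T rhom Jm /\ bijective T |
      ~ bijective T /\ exists tp tm : R, [/\ 0 < tp, 0 < tm, tp + tm = 1 &
        realization_equiv rho T (sum_crossrep rhop rhom) (weighted_sum tp tm Jp Jm)]].
Proof.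
move=> real; have [T1 T2 T3] := real.
have [e [he hX hX']] := HS_ex.
have [U [UU Uoo]] := ultraFilterLemma (F := \oo) _.
have TT : adj T ** T = op1 H by apply: isometry_op => u; rewrite /nr T1.
have hW a : lop rho a ** T = T ** W a by apply: opP => u; rewrite !compE; exact: esym (T2 _ _).
have sR := cyl_psystem (crossrep_unital T3).
have [S [S' [a [b [[TE a0 b0 ab] [SS SS' orth] PS QS WS]]]]] :=
  isometry_splits uW sP sQ iP iQ ineq Uoo he hX hX' (unitary_lop rho) sR TT hW.
have [az|an] := eqVneq a 0.
  apply: Or32; apply: (intertwiner_equiv perfm real) => w.
  have S0 : S = 0 by apply: gram_eq0; rewrite SS az rmorph0 scale0r.
  by rewrite TE S0 add0r; exact: QS.
have [bz|bn] := eqVneq b 0.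
  apply: Or31; apply: (intertwiner_equiv perfp real) => w.
  have S0 : S' = 0 by apply: gram_eq0; rewrite SS' bz rmorph0 scale0r.
  by rewrite TE S0 addr0; exact: PS.
have a1 : 0 < a by rewrite lt0r an.
have b1 : 0 < b by rewrite lt0r bn.
have WS1 c := (WS c).1; have WS2 c := (WS c).2.
apply: Or33; split.
  have [[v v0] _] := pair_irreducible.
  exact: (mixture_imperfect perfp perfm TE a1 b1 SS SS' orth v0).
exists a, b; split=> //.
exact: (mixture_equiv perfp perfm real TE a1 b1 SS SS' orth PS QS WS1 WS2).
Qed.

End PerfectPair.
End Realizations.

Theorem mainTheorem1 (R : realType) (I : finType) (I_ge2 : (1 < #|I|)%N)
    (H Hp Hm : hilbertType R) (pi : unirep (freeGroup I) H)
    (pip : crossrep I Hp) (pim : crossrep I Hm)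
    (iotap : {linear H -> Hp}) (iotam : {linear H -> Hm})
    (pip_irr : crossrep_irreducible pip) (pim_irr : crossrep_irreducible pim)
    (pip_pim_inequiv : ~ crossrep_equiv pip pim)
    (iotap_perfect : perfect_realization pi pip iotap)
    (iotam_perfect : perfect_realization pi pim iotam)
    (finite_trace : forall a b : letter I, a <> b ->
      (hs_norm
        (compression iotap (crep_alg pip (cind_cylinder R (fgletter a))) \o
         compression iotam (crep_alg pim (cind_cylinder R (fgletter b))))
       < +oo)%E) :
  [/\ unirep_irreducible pi,
      forall (H' : hilbertType R) (pi' : crossrep I H')
        (iota' : {linear H -> H'}), perfect_realization pi pi' iota' ->
        realization_equiv pi' iota' pip iotap \/
        realization_equiv pi' iota' pim iotam &
      forall (H' : hilbertType R) (pi' : crossrep I H')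
        (iota' : {linear H -> H'}), imperfect_realization pi pi' iota' ->
        exists tp tm : R, [/\ 0 < tp, 0 < tm, tp + tm = 1 &
          realization_equiv pi' iota'
            (sum_crossrep pip pim) (weighted_sum tp tm iotap iotam)]].
Proof.
have nrmp v : `|iotap v| = `|v| by have [[]] := iotap_perfect.
have nrmm v : `|iotam v| = `|v| by have [[]] := iotam_perfect.
(* The operators have the given maps as underlying functions, so the hypotheses carry over by
   conversion. *)
pose Jp := Op (iota_axiom nrmp); pose Jm := Op (iota_axiom nrmm).
have perfp : perfect_realization pi pip Jp by exact: iotap_perfect.
have perfm : perfect_realization pi pim Jm by exact: iotam_perfect.
have key (H' : hilbertType R) (pi' : crossrep I H') (iota' : {linear H -> H'}) :
  boundary_realization pi pi' iota' ->
  [\/ realization_equiv pi' iota' pip Jp /\ bijective iota',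
      realization_equiv pi' iota' pim Jm /\ bijective iota' |
      ~ bijective iota' /\ exists tp tm : R, [/\ 0 < tp, 0 < tm, tp + tm = 1 &
        realization_equiv pi' iota' (sum_crossrep pip pim) (weighted_sum tp tm Jp Jm)]].
  move=> real; have [nrm' _ _] := real.
  exact: (pair_realization I_ge2 pip_irr pim_irr pip_pim_inequiv perfp perfm finite_trace
    (T := Op (iota_axiom nrm')) real).
split.
- exact: (pair_irreducible I_ge2 pip_irr pim_irr pip_pim_inequiv perfp perfm finite_trace).
- move=> H' pi' iota' [real bij].
  by case: (key _ _ _ real) => [[]|[]|[]]; [left|right|].
- move=> H' pi' iota' [real nbij].
  by case: (key _ _ _ real) => [[]|[]|[]].
Qed.
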